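(* Let $X$ be a complex Banach space and let $\delta$ be an $I\times J$ matrix of free polynomials in $d$ variables. Suppose $\delta(0)=0$, and that $T\in\mathcal{L}(X)^d$ satisfies $$\sup_{0\le r\le1}\|\delta(rT)\|_\bullet<1.$$ Then $T$ has a completely bounded $G_\delta$ functional calculus.
   Context: $\mathcal{L}(X)$ is the algebra of bounded linear operators on $X$. $\mathbb{M}_n$ is the $n\times n$ complex matrices with the operator norm, and $\mathbb{M}^{[d]}=\bigcup_{n\ge1}\mathbb{M}_n^d$. An $I\times J$ matrix $P$ of free (non-commutative) polynomials in $d$ variables evaluated at $x\in\mathbb{M}_n^d$ is regarded as an operator $\mathbb{C}^n\otimes\mathbb{C}^J\to\mathbb{C}^n\otimes\mathbb{C}^I$ with the operator norm. $G_\delta=\{x\in\mathbb{M}^{[d]}:\|\delta(x)\|<1\}$; thus for $t>0$, $G_{\delta/t}=\{x:\|\delta(x)\|<t\}$. A Hilbert tensor norm $h$ on $X$ assigns to each Hilbert space $\mathcal{K}$ a reasonable cross norm $h$ on $X\otimes\mathcal{K}$ (i.e. $h(x\otimes k)=\|x\|\|k\|$ and $\|x^*\otimes k^*\|_{(X\otimes\mathcal{K},h)^*}=\|x^*\|\|k^*\|$), with completion $X\otimes_h\mathcal{K}$, such that $\|R\otimes S\|_{\mathcal{L}(X\otimes_h\mathcal{K}_1,X\otimes_h\mathcal{K}_2)}\le\|R\|\|S\|$ for all $R\in\mathcal{L}(X)$, $S\in\mathcal{L}(\mathcal{K}_1,\mathcal{K}_2)$ and all Hilbert spaces $\mathcal{K}_1,\mathcal{K}_2$.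 For an $m\times n$ matrix $R=(R_{ij})$ over $\mathcal{L}(X)$, put $R_{h,\mathcal{K}}=\sum_{i,j}R_{ij}\otimes_h(E_{ij}\otimes\mathrm{id}_{\mathcal{K}}):X\otimes_h(\mathbb{C}^n\otimes\mathcal{K})\to X\otimes_h(\mathbb{C}^m\otimes\mathcal{K})$ with $E_{ij}$ the matrix units, $\|R\|_h=\sup\{\|R_{h,\mathcal{K}}\|:\mathcal{K}\text{ a Hilbert space}\}$, and $\|R\|_\bullet=\inf\{\|R\|_h: h\text{ a Hilbert tensor norm on }X\}$. $T$ has a completely bounded $G_\delta$ functional calculus if there exist $0<r<1$ and a constant $K$ such that $G_{\delta/r}$ is a complete $K$-spectral set for $T$, i.e. $\|P(T)\|_\bullet\le K\sup_{x\in G_{\delta/r}}\|P(x)\|$ for every finite matrix $P$ of free polynomials in $d$ variables (the right-hand side may be $+\infty$). *)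

(* Defs.v *)
From HB Require Import structures.
From mathcomp Require Import all_boot all_order all_algebra.
From mathcomp Require Import all_classical all_reals topology normedtype ereal.
From mathcomp Require Import complex mxtens finmap ring lra.
(* The notations of monalg clash with those of topology. *)
From mathcomp Require Import -(notations) monalg.

Set Implicit Arguments.
Unset Strict Implicit.
Unset Printing Implicit Defensive.

Import Order.TTheory GRing.Theory Num.Theory.
Import numFieldNormedType.Exports.

Local Open Scope classical_set_scope.
Local Open Scope ring_scope.

(* Norms over R[i] take values in R[i]; nrm reads them in R. *)
Definition nrm (R : realType) (V : normedZmodType R[i]) (v : V) : R :=
  complex.Re `|v|.

Definition opnorm (R : realType) (U V : Type) (NU : U -> R) (NV : V -> R)
    (f : U -> V) : \bar R :=
  ereal_sup [set (NV (f u))%:E | u in [set u | NU u <= 1]].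

Definition l2norm (R : realType) (n : nat) (a : 'I_n -> R) : R :=
  Num.sqrt (\sum_i a i ^+ 2).

Section NormFacts.
Variable R : realType.
Local Notation C := R[i].

Lemma normCE (V : normedZmodType C) (v : V) : `|v| = (nrm v)%:C%C.
Proof. by rewrite /nrm RRe_real// normr_real. Qed.

Lemma nrm_ge0 (V : normedZmodType C) (v : V) : 0 <= nrm v.
Proof. by rewrite -lecR -normCE normr_ge0. Qed.

Lemma nrm0 (V : normedZmodType C) : nrm (0 : V) = 0.
Proof. by rewrite /nrm normr0. Qed.

Lemma nrm0_eq0 (V : normedZmodType C) (v : V) : nrm v = 0 -> v = 0.
Proof. by move=> v0; apply/normr0_eq0; rewrite normCE v0. Qed.

Lemma ler_nrmD (V : normedZmodType C) (u v : V) : nrm (u + v) <= nrm u + nrm v.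
Proof. by rewrite -lecR rmorphD /= -!normCE ler_normD. Qed.

Lemma nrmZ (V : normedModType C) (a : C) (v : V) :
  nrm (a *: v) = nrm a * nrm v.
Proof. by apply: complexI; rewrite rmorphM /= -!normCE normrZ. Qed.

Lemma l2norm_ge0 n (a : 'I_n -> R) : 0 <= l2norm a.
Proof. exact: sqrtr_ge0. Qed.

Lemma sqr_l2norm n (a : 'I_n -> R) : l2norm a ^+ 2 = \sum_i a i ^+ 2.
Proof. by rewrite sqr_sqrtr// sumr_ge0// => i _; rewrite sqr_ge0. Qed.

Lemma l2norm_eq0 n (a : 'I_n -> R) : l2norm a = 0 -> forall i, a i = 0.
Proof.
move=> a0 i; have /eqP := sqr_l2norm a.
rewrite a0 expr0n/= eq_sym psumr_eq0 => [|j _]; last by rewrite sqr_ge0.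
by move/allP => /(_ i (mem_index_enum _))/implyP/(_ isT); rewrite sqrf_eq0 => /eqP.
Qed.

Lemma l2norm_dot n (a b : 'I_n -> R) :
  \sum_i a i * b i <= l2norm a * l2norm b.
Proof.
have [/eqP a0|aN0] := boolP (l2norm a == 0).
  by rewrite a0 mul0r big1// => i _; rewrite (l2norm_eq0 a0) mul0r.
have [/eqP b0|bN0] := boolP (l2norm b == 0).
  by rewrite b0 mulr0 big1// => i _; rewrite (l2norm_eq0 b0) mulr0.
have A0 : 0 < l2norm a by rewrite lt_def aN0 l2norm_ge0.
have B0 : 0 < l2norm b by rewrite lt_def bN0 l2norm_ge0.
rewrite -(ler_pM2l A0) -(ler_pM2l B0) -subr_ge0.
have : 0 <= \sum_i (l2norm b * a i - l2norm a * b i) ^+ 2.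
  by rewrite sumr_ge0// => i _; rewrite sqr_ge0.
have -> : \sum_i (l2norm b * a i - l2norm a * b i) ^+ 2 =
    l2norm b ^+ 2 * (\sum_i a i ^+ 2) + l2norm a ^+ 2 * (\sum_i b i ^+ 2)
    - (l2norm b * (l2norm a * \sum_i a i * b i)) *+ 2.
  rewrite !mulr_sumr -sumrMnl -big_split/= -sumrB.
  by apply: eq_bigr => i _; ring.
rewrite -!sqr_l2norm.
set s := \sum_i _; set A := l2norm a; set B := l2norm b; lra.
Qed.

Lemma ler_l2normD n (a b c : 'I_n -> R) : (forall i, 0 <= c i) ->
  (forall i, c i <= a i + b i) -> l2norm c <= l2norm a + l2norm b.
Proof.
move=> c0 cab; rewrite -ler_sqr ?nnegrE ?addr_ge0 ?l2norm_ge0//.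
rewrite sqrrD !sqr_l2norm.
apply: (@le_trans _ _ (\sum_i (a i + b i) ^+ 2)).
  apply: ler_sum => i _; rewrite ler_sqr ?nnegrE//.
  exact: le_trans (cab i).
under eq_bigr do rewrite sqrrD.
by rewrite big_split/= big_split/= lerD2r lerD2l sumrMnl lerMn2r/= l2norm_dot.
Qed.

Lemma ler_l2norm n (a : 'I_n -> R) i : 0 <= a i -> a i <= l2norm a.
Proof.
move=> ai0; rewrite -ler_sqr ?nnegrE ?l2norm_ge0// sqr_l2norm.
by rewrite (bigD1 i)//= lerDl sumr_ge0// => j _; rewrite sqr_ge0.
Qed.

Lemma l2norm_le_sum n (a : 'I_n -> R) :
  (forall i, 0 <= a i) -> l2norm a <= \sum_i a i.
Proof.
move=> a0; have s0 : 0 <= \sum_i a i by rewrite sumr_ge0.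
rewrite -ler_sqr ?nnegrE ?l2norm_ge0// sqr_l2norm expr2 mulr_suml.
apply: ler_sum => i _; rewrite expr2 ler_wpM2l//.
by rewrite (bigD1 i)//= lerDl sumr_ge0.
Qed.

End NormFacts.

Section BoundedOperators.
Variable R : realType.
Local Notation C := R[i].

Definition bounded_linear (U V : normedModType C) (f : U -> V) : Prop :=
  linear f /\ exists M : R, forall u, nrm (f u) <= M * nrm u.

Definition bounded_linear_pred (U V : normedModType C) : {pred U -> V} :=
  fun f => `[< bounded_linear f >].

Record bop (U V : normedModType C) := Bop {
  bop_fun :> U -> V;
  bopP : bop_fun \in @bounded_linear_pred U V }.

HB.instance Definition _ U V := [isSub for @bop_fun U V].
HB.instance Definition _ U V := [Choice of bop U V by <:].

Definition mkbop (U V : normedModType C) (f : U -> V) (fb : bounded_linear f) :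
  bop U V := Bop (asboolT fb).

Section Lmodule.
Variables U V : normedModType C.

Lemma bop_bounded (f : bop U V) : bounded_linear f.
Proof. exact/asboolP/(bopP f). Qed.

HB.instance Definition _ (f : bop U V) :=
  GRing.isLinear.Build C U V _ f (bop_bounded f).1.

Lemma bop_boundP (f : bop U V) :
  exists2 M : R, 0 <= M & forall u, nrm (f u) <= M * nrm u.
Proof.
have [_ [M fM]] := bop_bounded f; exists (Num.max M 0); first by rewrite le_max lexx orbT.
by move=> u; apply: le_trans (fM u) _; rewrite ler_wpM2r ?nrm_ge0// le_max lexx.
Qed.

Lemma bounded_linear_submod : GRing.subsemimod_closed (@bounded_linear_pred U V).
Proof.
split; [split|].
- apply/asboolP; split; first by move=> a u v; rewrite /= scaler0 addr0.
  by exists 0 => u; rewrite mul0r nrm0.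
- move=> f g /asboolP[fl [M fM]] /asboolP[gl [N gN]]; apply/asboolP; split.
    by move=> a u v; rewrite !fctE fl gl scalerDr addrACA.
  exists (M + N) => u; rewrite mulrDl (le_trans (ler_nrmD _ _))//.
  exact: lerD.
- move=> a f /asboolP[fl [M fM]]; apply/asboolP; split.
    by move=> b u v; rewrite !fctE fl scalerDr !scalerA mulrC.
  by exists (nrm a * M) => u; rewrite nrmZ -mulrA ler_wpM2l ?nrm_ge0.
Qed.

HB.instance Definition _ := GRing.SubChoice_isSubLmodule.Build
  C (U -> V) (@bounded_linear_pred U V) (bop U V) bounded_linear_submod.

Lemma bopDE (f g : bop U V) u : (f + g) u = f u + g u. Proof. by []. Qed.
Lemma bopZE a (f : bop U V) u : (a *: f) u = a *: f u. Proof. by []. Qed.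

End Lmodule.

Section Ring.
Variable X : normedModType C.

Lemma bounded_linear_id : bounded_linear (@idfun X).
Proof. by split=> [a u v //|]; exists 1 => u; rewrite mul1r. Qed.

Lemma bounded_linear_comp (f g : bop X X) : bounded_linear (f \o g).
Proof.
split=> [a u v /=|]; first by rewrite !linearP.
have [M M0 fM] := bop_boundP f; have [N _ gN] := bop_boundP g.
exists (M * N) => u /=; apply: le_trans (fM _) _.
by rewrite -mulrA ler_wpM2l.
Qed.

Definition bop1 : bop X X := mkbop bounded_linear_id.
Definition bop_comp (f g : bop X X) : bop X X := mkbop (bounded_linear_comp f g).

Lemma bop_compA : associative bop_comp.
Proof. by move=> f g h; apply/val_inj. Qed.
Lemma bop_comp1f : left_id bop1 bop_comp.
Proof. by move=> f; apply/val_inj. Qed.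
Lemma bop_compf1 : right_id bop1 bop_comp.
Proof. by move=> f; apply/val_inj. Qed.
Lemma bop_compDl : left_distributive bop_comp +%R.
Proof. by move=> f g h; apply/val_inj. Qed.
Lemma bop_compDr : right_distributive bop_comp +%R.
Proof. by move=> f g h; apply/val_inj/funext => u /=; rewrite !fctE linearD. Qed.

HB.instance Definition _ := GRing.Zmodule_isPzRing.Build (bop X X)
  bop_compA bop_comp1f bop_compf1 bop_compDl bop_compDr.

End Ring.
End BoundedOperators.

(* The algebraic tensor product: elementary tensors act by evaluation on
   bilinear forms, and U (x) V is their span in the space of all scalar-valued
   functions of bilinear forms. *)
Section Tensor.
Variable R : realType.
Local Notation C := R[i].

Definition bilform (U V : lmodType C) : Type := {bilinear U -> V -> C^o}.

Definition tensor_pred (U V : lmodType C) : {pred bilform U V -> C^o} :=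
  fun f => `[< exists s : seq (U * V),
                 f = fun B => \sum_(p <- s) B p.1 p.2 >].

Record tensor (U V : lmodType C) := Tensor {
  tensor_fun :> bilform U V -> C^o;
  tensorP : tensor_fun \in @tensor_pred U V }.

HB.instance Definition _ U V := [isSub for @tensor_fun U V].
HB.instance Definition _ U V := [Choice of tensor U V by <:].

Section Lmodule.
Variables U V : lmodType C.

Lemma tensor_submod : GRing.subsemimod_closed (@tensor_pred U V).
Proof.
split; [split|].
- by apply/asboolP; exists [::]; apply/funext => B; rewrite big_nil.
- move=> f g /asboolP[s ->] /asboolP[t ->]; apply/asboolP.
  by exists (s ++ t); apply/funext => B; rewrite big_cat.
- move=> a f /asboolP[s ->]; apply/asboolP.
  exists [seq (a *: p.1, p.2) | p <- s]; apply/funext => B.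
  rewrite big_map /= fctE scaler_sumr; apply: eq_bigr => p _.
  by rewrite linearZl_LR.
Qed.

HB.instance Definition _ := GRing.SubChoice_isSubLmodule.Build
  C (bilform U V -> C^o) (@tensor_pred U V) (tensor U V) tensor_submod.

Lemma elem_tensor_subproof (u : U) (v : V) :
  (fun B : bilform U V => B u v) \in @tensor_pred U V.
Proof.
by apply/asboolP; exists [:: (u, v)]; apply/funext => B; rewrite big_seq1.
Qed.

Definition elem_tensor (u : U) (v : V) : tensor U V :=
  Tensor (elem_tensor_subproof u v).

End Lmodule.

Section Map.
Variables U1 U2 V1 V2 : lmodType C.
Variables (f : {linear U1 -> U2}) (g : {linear V1 -> V2}).

Definition pullback_form (B : bilform U2 V2) (u : U1) (v : V1) : C^o :=
  B (f u) (g v).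

Lemma pullback_form_bilinear B :
  bilinear_for (@GRing.scale C C^o) (@GRing.scale C C^o) (pullback_form B).
Proof.
by split=> [v|u] a x y; rewrite /pullback_form linearP ?linearPl ?linearPr.
Qed.

HB.instance Definition _ B := @bilinear_isBilinear.Build
  C U1 V1 C^o _ _ (pullback_form B) (pullback_form_bilinear B).

Lemma tensor_map_subproof (w : tensor U1 V1) :
  (fun B : bilform U2 V2 => w (pullback_form B)) \in @tensor_pred U2 V2.
Proof.
have /asboolP[s ws] := tensorP w; apply/asboolP.
exists [seq (f p.1, g p.2) | p <- s]; apply/funext => B.
by rewrite ws big_map.
Qed.

(* f (x) g *)
Definition tensor_map (w : tensor U1 V1) : tensor U2 V2 :=
  Tensor (tensor_map_subproof w).

Lemma tensor_mapE u v : tensor_map (elem_tensor u v) = elem_tensor (f u) (g v).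
Proof. exact/val_inj. Qed.

End Map.

Section Functional.
Variables (U V : lmodType C) (f : {linear U -> C^o}) (g : {linear V -> C^o}).

Definition prod_form (u : U) (v : V) : C^o := f u * g v.

Lemma prod_form_bilinear :
  bilinear_for (@GRing.scale C C^o) (@GRing.scale C C^o) prod_form.
Proof.
split=> [v|u] a x y; rewrite /prod_form linearP.
  by rewrite mulrDl -scalerAl.
by rewrite mulrDr -scalerAr.
Qed.

HB.instance Definition _ := @bilinear_isBilinear.Build
  C U V C^o _ _ prod_form prod_form_bilinear.

(* The functional u (x) v |-> f u * g v. *)
Definition tensor_functional (w : tensor U V) : C^o := w prod_form.

End Functional.
End Tensor.

Section Hilbert.
Variable R : realType.
Local Notation C := R[i].

Record hilbertSpace := HilbertSpace {
  hilbert_sort :> completeNormedModType C;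
  hilbert_dot : {dot hilbert_sort for (@Num.conj C)};
  hilbert_normE : forall u : hilbert_sort, `|u| ^+ 2 = hilbert_dot u u }.

End Hilbert.

(* C^n (x) K is the n-fold Hilbert sum of K. *)
Definition hpow (R : realType) (n : nat) (K : hilbertSpace R) : Type := 'I_n -> K.

Section HilbertPower.
Variable R : realType.
Local Notation C := R[i].
Variables (n : nat) (K : hilbertSpace R).
Local Notation hpow := (hpow n K).

HB.instance Definition _ := GRing.Lmodule.copy hpow ('I_n -> K).

Definition hpow_norm (u : hpow) : C := (l2norm (fun i => nrm (u i)))%:C%C.

Lemma ler_hpow_normD u v : hpow_norm (u + v) <= hpow_norm u + hpow_norm v.
Proof.
rewrite /hpow_norm -rmorphD lecR ler_l2normD// => i; first exact: nrm_ge0.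
exact: ler_nrmD.
Qed.

Lemma hpow_normZ (a : C) u : hpow_norm (a *: u) = `|a| * hpow_norm u.
Proof.
rewrite /hpow_norm normCE -rmorphM; congr (_%:C)%C.
rewrite -[nrm a]ger0_norm ?nrm_ge0// -sqrtr_sqr -sqrtrM ?sqr_ge0//.
rewrite mulr_sumr; congr Num.sqrt; apply: eq_bigr => i _.
by rewrite nrmZ exprMn.
Qed.

Lemma hpow_norm0_eq0 u : hpow_norm u = 0 -> u = 0.
Proof.
move=> /complexI/l2norm_eq0 u0; apply/funext => i.
exact/nrm0_eq0/u0.
Qed.

HB.instance Definition _ := Lmodule_isNormed.Build
  C hpow ler_hpow_normD hpow_normZ hpow_norm0_eq0.

Lemma nrm_hpow (u : hpow) : nrm u = l2norm (fun i => nrm (u i)).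
Proof. by []. Qed.

Lemma hpow_complete (F : set_system hpow) :
  ProperFilter F -> cauchy F -> cvg F.
Proof.
move=> FF Fc.
have Fci i : cvg ((fun u : hpow => u i) @ F).
  apply: cauchy_cvg; apply/cauchy_ballP => e e0.
  have /cauchy_ballP/(_ e e0)[[P Q]/= [FP FQ] PQ] := Fc.
  exists ((fun u : hpow => u i) @` P, (fun u : hpow => u i) @` Q) => /=.
    split; [apply: filterS FP|apply: filterS FQ] => u Pu; exact: imageP.
  move=> [_ _] /= [[u Pu <-] [v Qv <-]].
  have := PQ (u, v) (conj Pu Qv); rewrite -!ball_normE /= => uv.
  apply: le_lt_trans uv; rewrite !normCE lecR nrm_hpow.
  by rewrite (ler_l2norm (a := fun i => nrm ((u - v) i)))// nrm_ge0.
apply/cvg_ex; exists (fun i => lim ((fun u : hpow => u i) @ F)).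
apply/cvgrPdist_lt => e e0.
have en0 : 0 < e / n.+1%:R by rewrite divr_gt0// ltr0n.
have Fi : \forall u \near F, forall i,
    `|lim ((fun u : hpow => u i) @ F) - u i| < e / n.+1%:R.
  apply: filter_forall => i.
  by have /cvgrPdist_lt/(_ _ en0) := Fci i.
apply: filterS Fi => u ui.
rewrite normCE nrm_hpow.
apply: (@le_lt_trans _ _ (\sum_(i < n) e / n.+1%:R)).
  apply: (@le_trans _ _ (\sum_(i < n) nrm (lim ((fun u : hpow => u i) @ F) - u i))%:C%C).
    by rewrite lecR l2norm_le_sum// => i; rewrite nrm_ge0.
  by rewrite rmorph_sum; apply: ler_sum => i _ /=; rewrite -normCE ltW.
rewrite sumr_const card_ord -[_ *+ n]mulr_natr mulrAC ltr_pdivrMr ?ltr0n//.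
by rewrite ltr_pM2l// ltr_nat.
Qed.

HB.instance Definition _ := Uniform_isComplete.Build hpow hpow_complete.

Definition hpow_dot (u v : hpow) : C := \sum_i hilbert_dot K (u i) (v i).

Lemma hpow_dot_bilinear :
  bilinear_for *%R (@Num.conj C \; *%R) hpow_dot.
Proof.
split=> [v|u] a x y /=; rewrite /hpow_dot mulr_sumr -big_split/=;
  apply: eq_bigr => i _; rewrite !fctE.
  by rewrite linearPl.
by rewrite linearPr.
Qed.

HB.instance Definition _ := @bilinear_isBilinear.Build
  C hpow hpow C *%R (@Num.conj C \; *%R) hpow_dot hpow_dot_bilinear.

Lemma hpow_dot_herm u v :
  hpow_dot u v = (-1) ^+ false * (hpow_dot v u)^*.
Proof.
rewrite expr0 mul1r rmorph_sum; apply: eq_bigr => i _ /=.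
by rewrite hermC expr0 mul1r.
Qed.

HB.instance Definition _ := @isHermitianSesquilinear.Build
  C hpow false (@Num.conj C) hpow_dot hpow_dot_herm.

Lemma hpow_normE (u : hpow) : `|u| ^+ 2 = hpow_dot u u.
Proof.
rewrite normCE -rmorphXn nrm_hpow sqr_l2norm rmorph_sum; apply: eq_bigr => i _.
by rewrite rmorphXn /= -normCE hilbert_normE.
Qed.

Lemma hpow_dot_gt0 u : u != 0 -> 0 < hpow_dot u u.
Proof. by move=> u0; rewrite -hpow_normE exprn_gt0// normr_gt0. Qed.

HB.instance Definition _ := @isDotProduct.Build C hpow hpow_dot hpow_dot_gt0.

Definition hilbert_pow : hilbertSpace R := HilbertSpace hpow_normE.

End HilbertPower.

Section MatrixUnit.
Variables (R : realType) (m n : nat) (K : hilbertSpace R).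
Variables (i : 'I_m) (j : 'I_n).

(* E_ij (x) id_K *)
Definition matrix_unit_fun (u : hilbert_pow n K) : hilbert_pow m K :=
  fun k => if k == i then u j else 0.

Lemma matrix_unit_bounded : bounded_linear matrix_unit_fun.
Proof.
split=> [a u v|].
  apply/funext => k; rewrite /matrix_unit_fun !fctE.
  by case: ifP => // _; rewrite scaler0 addr0.
exists 1 => u; rewrite mul1r !nrm_hpow.
rewrite {1}/l2norm (bigD1 i)//= /matrix_unit_fun eqxx.
rewrite big1 ?addr0 => [|k /negPf ->]; last by rewrite nrm0 expr0n.
rewrite sqrtr_sqr ger0_norm ?nrm_ge0//.
exact: (ler_l2norm (a := fun j => nrm (u j)) (nrm_ge0 _)).
Qed.

Definition matrix_unit : bop (hilbert_pow n K) (hilbert_pow m K) :=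
  mkbop matrix_unit_bounded.

End MatrixUnit.

Section HilbertTensorNorm.
Variable R : realType.
Local Notation C := R[i].

Definition bopnorm (U V : normedModType C) (f : bop U V) : \bar R :=
  opnorm (@nrm R U) (@nrm R V) f.

Definition is_norm (V : lmodType C) (N : V -> R) : Prop :=
  [/\ forall u v, N (u + v) <= N u + N v,
      forall (a : C) u, N (a *: u) = nrm a * N u &
      forall u, N u = 0 -> u = 0].

Definition reasonable_cross_norm (X : completeNormedModType C)
    (K : hilbertSpace R) (N : tensor X K -> R) : Prop :=
  [/\ is_norm N,
      forall x k, N (elem_tensor x k) = nrm x * nrm k &
      forall (f : bop X C^o) (g : bop K C^o),
        (opnorm N (@nrm R C^o) (tensor_functional f g) =
         bopnorm f * bopnorm g)%E].

Record completion (V : lmodType C) (N : V -> R) := Completion {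
  compl_space :> completeNormedModType C;
  compl_emb : {linear V -> compl_space};
  compl_isometry : forall v, nrm (compl_emb v) = N v;
  compl_dense : dense (range compl_emb) }.

(* htn_completion K is X (x)_h K, and htn_map S T is the extension of S (x) T
   to the completions; both are determined by htn up to isometry. *)
Record hilbertTensorNorm (X : completeNormedModType C) := HilbertTensorNorm {
  htn : forall K : hilbertSpace R, tensor X K -> R;
  htn_reasonable : forall K, reasonable_cross_norm (@htn K);
  htn_completion : forall K, completion (@htn K);
  htn_map : forall K1 K2 : hilbertSpace R, bop X X -> bop K1 K2 ->
    bop (htn_completion K1) (htn_completion K2);
  htn_mapE : forall (K1 K2 : hilbertSpace R) (S : bop X X) (T : bop K1 K2)
      (w : tensor X K1),
    htn_map S T (compl_emb (htn_completion K1) w) =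
    compl_emb (htn_completion K2) (tensor_map S T w);
  htn_map_norm : forall (K1 K2 : hilbertSpace R) (S : bop X X) (T : bop K1 K2),
    (bopnorm (htn_map S T) <= bopnorm S * bopnorm T)%E }.

Section OperatorMatrixNorm.
Variables (X : completeNormedModType C) (m n : nat) (A : 'M[bop X X]_(m, n)).

Definition htn_matrix (h : hilbertTensorNorm X) (K : hilbertSpace R) :
    bop (htn_completion h (hilbert_pow n K)) (htn_completion h (hilbert_pow m K)) :=
  \sum_i \sum_j htn_map h (A i j) (matrix_unit K i j).

Definition norm_h (h : hilbertTensorNorm X) : \bar R :=
  ereal_sup [set y | exists K : hilbertSpace R, y = bopnorm (htn_matrix h K)].

Definition norm_bullet : \bar R :=
  ereal_inf [set y | exists h : hilbertTensorNorm X, y = norm_h h].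

End OperatorMatrixNorm.
End HilbertTensorNorm.

Section FreePolynomials.
Variable R : realType.
Local Notation C := R[i].
Variable d : nat.

Definition free_poly : Type := malg (fmonom 'I_d) C.

Definition free_eval (A : pzRingType) (c : C -> A) (x : 'I_d -> A)
    (p : free_poly) : A :=
  \sum_(w <- msupp p) c (mcoeff w p) * \prod_(k <- fmonom_val w) x k.

(* Points of M^[d]: a size n >= 1, stored as its predecessor, and a d-tuple of
   n x n matrices. *)
Definition mat_univ : Type := {n : nat & 'I_d -> 'M[C]_n.+1}.

Definition eval_mx (I J n : nat) (P : 'M[free_poly]_(I, J))
    (x : 'I_d -> 'M[C]_n.+1) : 'M[C]_(n.+1 * I, n.+1 * J) :=
  \sum_i \sum_j
    tensmx (free_eval (@scalar_mx C n.+1) x (P i j)) (delta_mx i j).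

Definition eval_op (X : normedModType C) (I J : nat) (P : 'M[free_poly]_(I, J))
    (T : 'I_d -> bop X X) : 'M[bop X X]_(I, J) :=
  map_mx (free_eval (fun a => a *: (1 : bop X X)) T) P.

Definition mx_opnorm (p q : nat) (A : 'M[C]_(p, q)) : \bar R :=
  opnorm (fun v : 'cV[C]_q => l2norm (fun k => nrm (v k 0)))
         (fun v : 'cV[C]_p => l2norm (fun k => nrm (v k 0))) (mulmx A).

(* G_(delta/t) for t > 0 *)
Definition Gset (I J : nat) (delta : 'M[free_poly]_(I, J)) (t : R) :
    set mat_univ :=
  [set x | (mx_opnorm (eval_mx delta (projT2 x)) < t%:E)%E].

Definition complete_spectral_set (X : completeNormedModType C)
    (G : set mat_univ) (K : R) (T : 'I_d -> bop X X) : Prop :=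
  forall (I J : nat) (P : 'M[free_poly]_(I, J)),
    (norm_bullet (eval_op P T) <=
     K%:E * ereal_sup [set mx_opnorm (eval_mx P (projT2 x)) | x in G])%E.

(* K > 0, so that K * +oo is +oo. *)
Definition cb_functional_calculus (X : completeNormedModType C) (I J : nat)
    (delta : 'M[free_poly]_(I, J)) (T : 'I_d -> bop X X) : Prop :=
  exists r : R, 0 < r < 1 /\
  exists K : R, 0 < K /\ complete_spectral_set (Gset delta r) K T.

End FreePolynomials.

(* Main.v *)
(* Let [s < r1 < r < 1], where [s] bounds the norms of [delta(lambda T)] for complex
   [lambda] near [[0, 1]], and let [|P| <= M] on the matrix points with [|delta| < r].
   Fix a degree [N] and let free polynomials act on the space [W] of words of
   length at most [N] by truncated shifts [x]. The cone of hermitian matrices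
   generated by [r1^2 sum v_j v_j^* - sum (delta(x) v)_i (delta(x) v)_i^*] and
   [z z^*] contains [M^2 sum e_l e_l^* - sum (P(x) e)_i (P(x) e)_i^*] up to an
   arbitrarily small error: a separating functional would be a new inner product on
   [W] for which [|delta(x)| <= r1] but [|P(x)| > M]. A lurking isometry turns this
   into contractive scalar matrices [A], [B], [A'], [B'] such that, up to monomials of
   degree greater than [N],
     [P = A E + r1^-1 B delta V]  and  [V = A' E + r1^-1 B' delta V],
   where [E] is [M 1] up to a small error. Since [delta(0) = 0], iterating the
   second equation yields a polynomial [F] that agrees with [P] up to degree [N],
   and [|F(lambda T)| <= (M + small) / (1 - s / r1)] in the Hilbert tensor norm
   attached to [lambda], uniformly in [N]. The entries of [(P - F)(lambda T)] are thus
   polynomials in [lambda], uniformly bounded near [[0, 1]] and vanishing at [0] to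
   order [N + 1], so that they tend to [0] at [lambda = 1]. *)

Require Import Defs.
From HB Require Import structures.
From mathcomp Require Import all_boot all_order all_algebra.
From mathcomp Require Import all_classical all_reals topology normedtype ereal.
From mathcomp Require Import complex mxtens finmap ring lra.
From mathcomp Require Import separable cyclic cyclotomic.
From mathcomp Require Import -(notations) monalg.
Set Implicit Arguments.
Unset Strict Implicit.
Unset Printing Implicit Defensive.

Import Order.TTheory GRing.Theory Num.Theory.
Import numFieldNormedType.Exports.

Local Open Scope classical_set_scope.
Local Open Scope ring_scope.
Local Open Scope sesquilinear_scope.

(** * Vector-valued polynomials near a segment *)

(** The norm [norm_bullet] is an infimum over Hilbert tensor norms, so every [r] in [0, 1] may bring
    a tensor norm of its own. Comparison goes through single entries: each tensor norm dominates the
    norms of the entries ([hbound_entry]) and is dominated by their sum ([hbound_entries]). So the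
    bounds along the segment are read entrywise, the continuation runs in [X], and one tensor norm,
    belonging to [r = 1], carries the final estimate. The segment is indispensable to the argument
    because [T] need not be small: agreement of [P] and [F] up to degree [N] does not by itself make
    [(P - F)(T)] small. It does so near 0, and boundedness transports this to 1. Closedness of the
    cone is never established. The resulting error becomes an extra input of the realization, a
    fixed polynomial matrix times a free scalar; the matrix depends on [N], the scalar is chosen
    after it. The number of defects in the decomposition is not controlled either, which is
    harmless: ampliation costs nothing in a norm that is a supremum over all Hilbert spaces. Besides
    driving the iteration, [delta(0) = 0] makes [delta] small at the shifts once they are scaled
    down, which is what gives the cone a dominating functional. *)

Section Nrm.
Variable R : realType.
Local Notation C := R[i].

Lemma nrmN (V : normedZmodType C) (v : V) : nrm (- v) = nrm v.
Proof. by rewrite /nrm normrN. Qed.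

Lemma nrm1 : nrm (1 : C) = 1.
Proof. by rewrite /nrm normr1. Qed.

Lemma nrmM (a b : C) : nrm (a * b) = nrm a * nrm b.
Proof. by apply: complexI; rewrite rmorphM /= -!normCE normrM. Qed.

Lemma nrmX (a : C) k : nrm (a ^+ k) = nrm a ^+ k.
Proof. by elim: k => [|k IH]; rewrite ?nrm1 // !exprS nrmM IH. Qed.

Lemma nrmV (a : C) : nrm a^-1 = (nrm a)^-1.
Proof. by apply: complexI; rewrite fmorphV /= -!normCE normfV. Qed.

Lemma nrm_real (x : R) : nrm (x%:C)%C = `|x|.
Proof. by apply: complexI; rewrite -normCE normc_def /= expr0n /= addr0 sqrtr_sqr. Qed.

Lemma ler_nrm_sum (V : normedZmodType C) (I : Type) (r : seq I) (P : pred I)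
    (F : I -> V) : nrm (\sum_(i <- r | P i) F i) <= \sum_(i <- r | P i) nrm (F i).
Proof.
elim/big_rec2: _ => [|i y x _ xy]; first by rewrite nrm0.
exact: le_trans (ler_nrmD _ _) (lerD _ xy).
Qed.

End Nrm.

Section PowerSums.
Variable R : realType.
Local Notation C := R[i].
Variable X : normedModType C.

Definition power_sum n (c : nat -> X) (z : C) : X := \sum_(k < n) z ^+ k *: c k.

(** Re-expansion keeps the length [n], so that the estimates on discs about 0 apply at every centre
    of the chain. *)
Lemma power_sum_shift a n c :
  exists c', forall z, power_sum n c (a + z) = power_sum n c' z.
Proof.
exists (fun i => \sum_(k < n) ('C(k, i)%:R * a ^+ (k - i)) *: c k) => z.
rewrite /power_sum; under [RHS]eq_bigr do rewrite scaler_sumr.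
rewrite exchange_big /=; apply: eq_bigr => k _.
under eq_bigr do rewrite scalerA.
rewrite -scaler_suml; congr (_ *: _); rewrite exprDn.
rewrite (big_ord_widen n (fun i => a ^+ (k - i) * z ^+ i *+ 'C(k, i)))//.
rewrite big_mkcond; apply: eq_bigr => i _; case: ifPn => [_|].
  by rewrite -mulr_natl; ring.
by rewrite -leqNgt => ki; rewrite bin_small// mul0r mulr0.
Qed.

(** [X^n - 1] is separable, so it has [n] distinct roots, and [n] distinct [n]-th roots of unity
    include a primitive one. *)
Lemma prim_root_exists n : (0 < n)%N -> exists w : C, n.-primitive_root w.
Proof.
move=> n_gt0; pose p : {poly C} := 'X^n - 1.
have [r Dp] := closed_field_poly_normal p.
rewrite (monicP _) ?monicXnsubC // scale1r in Dp.
have rn1 : all n.-unity_root r by apply/allP=> z; rewrite -root_prod_XsubC -Dp.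
have sz_r : (n < (size r).+1)%N.
  by rewrite -(size_prod_XsubC r id) -Dp size_XnsubC.
have [|z] := hasP (has_prim_root n_gt0 rn1 _ sz_r); last by exists z.
by rewrite -separable_prod_XsubC -Dp separable_Xn_sub_1 // pnatr_eq0 -lt0n.
Qed.

Lemma sum_expr_root (z : C) n : z ^+ n = 1 -> z != 1 -> \sum_(l < n) z ^+ l = 0.
Proof.
move=> zn z1; have /eqP := subrX1 z n; rewrite zn subrr eq_sym mulf_eq0.
by rewrite subr_eq0 (negPf z1) /= => /eqP.
Qed.

(* Averaging over the [n]-th roots of unity extracts a coefficient. *)
Lemma cauchy_estimate n c (rho B : R) : 0 < rho ->
  (forall z, nrm z = rho -> nrm (power_sum n c z) <= B) ->
  forall k, (k < n)%N -> nrm (c k) * rho ^+ k <= B.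
Proof.
move=> rho0 fB k kn; have n0 : (0 < n)%N by apply: leq_ltn_trans kn.
have [w wP] := prim_root_exists n0.
have w1 : nrm w = 1.
  apply/eqP; rewrite -(@pexpr_eq1 _ _ n) ?nrm_ge0// -nrmX.
  by rewrite (prim_expr_order wP) nrm1.
have wN0 : w != 0 by rewrite (prim_root_eq0 wP) -lt0n.
have E : n%:R *: ((rho ^+ k)%:C%C *: c k) =
    \sum_(l < n) (w ^+ k) ^- l *: power_sum n c (rho%:C%C * w ^+ l).
  rewrite /power_sum; under eq_bigr do rewrite scaler_sumr.
  rewrite exchange_big /= (bigD1 (Ordinal kn))//= [X in _ = _ + X]big1 => [|i ik].
    rewrite addr0; under eq_bigr => l _.
      rewrite scalerA exprMn -!exprM mulnC mulrCA mulVf ?expf_neq0// mulr1.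
      over.
    by rewrite sumr_const card_ord scaler_nat rmorphXn.
  under eq_bigr => l _.
    rewrite scalerA exprMn mulrCA -scalerA.
    have -> : (w ^+ k) ^- l * (w ^+ l) ^+ i = (w ^+ i / w ^+ k) ^+ l.
      by rewrite exprMn exprVn mulrC -exprM -[in RHS]exprM (mulnC l).
    over.
  rewrite -scaler_sumr -scaler_suml sum_expr_root ?scale0r ?scaler0//.
    rewrite exprMn exprVn -!exprM !(mulnC _ n) !exprM (prim_expr_order wP).
    by rewrite !expr1n invr1 mulr1.
  apply: contra ik => /eqP/(congr1 (fun x => w ^+ k * x)).
  rewrite mulrCA mulfV ?expf_neq0// !mulr1 => /eqP.
  by rewrite (eq_prim_root_expr wP) !modn_small// => /eqP ik; apply/eqP/val_inj.
have: nrm (n%:R *: ((rho ^+ k)%:C%C *: c k)) <= n%:R * B.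
  rewrite E; apply: le_trans (ler_nrm_sum _ _ _) _.
  have -> : n%:R * B = \sum_(l < n) B by rewrite sumr_const card_ord mulr_natl.
  apply: ler_sum => l _.
  rewrite nrmZ.
  have -> : nrm ((w ^+ k) ^- l) = 1.
    by rewrite nrmV !nrmX w1 !expr1n invr1.
  by rewrite mul1r fB// nrmM nrmX w1 expr1n mulr1 nrm_real gtr0_norm.
rewrite !nrmZ nrm_real ger0_norm; last by rewrite exprn_ge0//; apply: ltW.
have -> : nrm (n%:R : C) = n%:R.
  by rewrite -(rmorph_nat (@real_complex R)) nrm_real ger0_norm.
by rewrite ler_pM2l ?ltr0n// mulrC.
Qed.

Lemma sum_half n : \sum_(k < n) (2^-1 : R) ^+ k <= 2.
Proof.
suff : \sum_(k < n) (2^-1 : R) ^+ k = 2 - 2 * 2^-1 ^+ n.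
  by move->; rewrite gerBl// mulr_ge0// exprn_ge0// invr_ge0.
elim: n => [|n IH]; first by rewrite big_ord0 expr0 mulr1 subrr.
by rewrite big_ord_recr /= IH exprS; field.
Qed.

(* Two Cauchy estimates, on the radii [eta] and [16 * eta], interpolated at [2 * eta]. *)
Lemma two_circles n c (eta e B : R) : 0 < eta -> 0 < e -> 0 < B ->
  (forall z, nrm z <= eta -> nrm (power_sum n c z) <= e ^+ 2 / (4 * B)) ->
  (forall z, nrm z <= 16 * eta -> nrm (power_sum n c z) <= B) ->
  forall z, nrm z <= 2 * eta -> nrm (power_sum n c z) <= e.
Proof.
move=> eta0 e0 B0 f1 f2 z zeta.
(* The radius [4 * eta] is the geometric mean of [eta] and [16 * eta], so [|c k| (4 eta)^k] is at
   most the geometric mean [e / 2] of the two Cauchy bounds; this is the origin of [e^2 / (4 B)]. On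
   [|z| <= 2 eta] the terms then decay like [2^-k]. *)
have term (k : 'I_n) : nrm (z ^+ k *: c k) <= (e / 2) * 2^-1 ^+ k.
  have c1 : nrm (c k) * eta ^+ k <= e ^+ 2 / (4 * B).
    apply: (@cauchy_estimate n) => // y yE.
    by rewrite f1// yE.
  have c2 : nrm (c k) * (16 * eta) ^+ k <= B.
    apply: (@cauchy_estimate n) => [|y yE|//]; first by rewrite mulr_gt0.
    by rewrite f2// yE.
  rewrite nrmZ nrmX; apply: (@le_trans _ _ ((2 * eta) ^+ k * nrm (c k))).
    by rewrite ler_wpM2r ?nrm_ge0// lerXn2r// ?nnegrE ?nrm_ge0// mulr_ge0// ltW.
  have p2 : 0 < (2 : R) ^+ k by rewrite exprn_gt0.
  rewrite exprVn ler_pdivlMr//.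
  have n0 : 0 <= (2 * eta) ^+ k * nrm (c k) * 2 ^+ k.
    by rewrite !mulr_ge0 ?exprn_ge0 ?nrm_ge0 ?mulr_ge0//; apply: ltW.
  rewrite -ler_sqr ?nnegrE//; last by rewrite divr_ge0//; apply: ltW.
  have := ler_pM (mulr_ge0 (nrm_ge0 _) (exprn_ge0 k (ltW eta0)))
     (mulr_ge0 (nrm_ge0 _) (exprn_ge0 k (mulr_ge0 (ler0n _ 16) (ltW eta0)))) c1 c2.
  have -> : e ^+ 2 / (4 * B) * B = (e / 2) ^+ 2 by field; rewrite gt_eqF.
  apply: le_trans; rewrite !exprMn.
  have -> : (16 : R) ^+ k = (2 ^+ k) ^+ 4 by rewrite -exprM mulnC exprM; congr (_ ^+ _); rewrite -natrX.
  by rewrite le_eqVlt; apply/orP; left; apply/eqP; ring.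
rewrite /power_sum; apply: le_trans (ler_nrm_sum _ _ _) _.
apply: le_trans (ler_sum _ (fun k _ => term k)) _.
rewrite -mulr_sumr; have := sum_half n; rewrite -(ler_pM2l (_ : 0 < e / 2)) ?divr_gt0//.
by rewrite divfK.
Qed.

(** The Cauchy estimate on the outer disc makes the [k]-th term at most [16^-k B] on the inner one,
    and only terms with [k > N] survive. The choice [2^N > 2 B / e] depends neither on the length
    nor on the coefficients. *)
Lemma vanishing_order_bound (eta e B : R) : 0 < eta -> 0 < e -> 0 < B ->
  exists N : nat, forall n c, (forall k, (k <= N)%N -> c k = 0) ->
  (forall z, nrm z <= 16 * eta -> nrm (power_sum n c z) <= B) ->
  forall z, nrm z <= eta -> nrm (power_sum n c z) <= e.
Proof.
move=> eta0 e0 B0.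
have [N NP] : exists N : nat, 2 * B / e < 2 ^+ N.
  exists (Num.bound (2 * B / e)).
  apply: (@lt_le_trans _ _ (Num.bound (2 * B / e))%:R).
    by rewrite archi_boundP// divr_ge0 ?mulr_ge0// ltW.
  by rewrite -natrX ler_nat ltnW// ltn_expl.
exists N => n c c0 f2 z zeta.
have term (k : 'I_n) : nrm (z ^+ k *: c k) <= (e / 2) * 2^-1 ^+ k.
  have [kN|kN] := leqP k N.
    rewrite c0// scaler0 nrm0 mulr_ge0 ?divr_ge0 ?exprn_ge0 ?invr_ge0// ltW//.
  have c2 : nrm (c k) * (16 * eta) ^+ k <= B.
    apply: (@cauchy_estimate n) => [|y yE|//]; first by rewrite mulr_gt0.
    by rewrite f2// yE.
  rewrite nrmZ nrmX; apply: (@le_trans _ _ (eta ^+ k * nrm (c k))).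
    by rewrite ler_wpM2r ?nrm_ge0// lerXn2r// ?nnegrE ?nrm_ge0// ltW.
  have p2 : 0 < (2 : R) ^+ k by rewrite exprn_gt0.
  rewrite exprVn ler_pdivlMr//.
  have Be : B <= (e / 2) * 2 ^+ k.
    have -> : B = e / 2 * (2 * B / e) by field; rewrite gt_eqF.
    rewrite ler_pM2l ?divr_gt0//; apply: le_trans (ltW NP) _.
    by rewrite ler_eXn2l ?ltr1n// ltnW.
  rewrite -(ler_pM2r p2); apply: le_trans Be; apply: le_trans c2.
  rewrite exprMn [X in X <= _](_ : _ = nrm (c k) * (4 ^+ k * eta ^+ k)).
    rewrite ler_wpM2l ?nrm_ge0// ler_wpM2r ?exprn_ge0//; first exact: ltW.
    by rewrite lerXn2r ?nnegrE// ler_nat.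
  have -> : (4 : R) = 2 * 2 by rewrite -natrM.
  by rewrite exprMn; ring.
rewrite /power_sum; apply: le_trans (ler_nrm_sum _ _ _) _.
apply: le_trans (ler_sum _ (fun k _ => term k)) _.
rewrite -mulr_sumr; have := sum_half n; rewrite -(ler_pM2l (_ : 0 < e / 2)) ?divr_gt0//.
by rewrite divfK.
Qed.

(* Analytic continuation along a chain of discs from [0] to [1]. *)
Lemma chain_of_discs (eta e B : R) : 0 < eta -> 0 < e -> 0 < B ->
  exists N : nat, forall n c, (forall k, (k <= N)%N -> c k = 0) ->
  (forall (t : R) z, 0 <= t <= 1 -> nrm (z - t%:C%C) <= 16 * eta ->
    nrm (power_sum n c z) <= B) ->
  nrm (power_sum n c 1) <= e.
Proof.
move=> eta0 e0 B0.
(* The tolerance is quantified inside the induction: to reach [e] at centre [j + 1], the previous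
   centre must deliver [e^2 / (4 B)]. The number of centres depends on [eta] alone, so [N] stays
   independent of the polynomial. *)
have chain j : j%:R * eta <= 1 -> forall e, 0 < e ->
    exists N : nat, forall n c, (forall k, (k <= N)%N -> c k = 0) ->
    (forall (t : R) z, 0 <= t <= 1 -> nrm (z - t%:C%C) <= 16 * eta ->
      nrm (power_sum n c z) <= B) ->
    forall z, nrm (z - (j%:R * eta)%:C%C) <= eta -> nrm (power_sum n c z) <= e.
  elim: j => [_|j IH j1] {}e {}e0.
    have [N NP] := vanishing_order_bound eta0 e0 B0.
    exists N => n c c0 cB z; rewrite mul0r subr0 => zeta.
    by apply: NP => // y yeta; apply: (cB 0); rewrite ?lexx ?ler01// subr0.
  have j1' : j%:R * eta <= 1.
    by apply: le_trans j1; rewrite ler_wpM2r ?ler_nat// ltW.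
  have e1 : 0 < e ^+ 2 / (4 * B) by rewrite divr_gt0 ?mulr_gt0 ?exprn_gt0.
  have [N NP] := IH j1' _ e1.
  exists N => n c c0 cB z zeta.
  have [c' c'E] := power_sum_shift (j%:R * eta)%:C%C n c.
  have -> : z = (j%:R * eta)%:C%C + (z - (j%:R * eta)%:C%C) by rewrite addrC subrK.
  rewrite c'E; apply: (@two_circles n c' eta e B) => // [y yeta|y yeta|].
  - rewrite -c'E; apply: NP => //.
    by rewrite addrAC subrr add0r.
  - rewrite -c'E; apply: (cB (j%:R * eta)).
      by rewrite j1' andbT mulr_ge0// ltW.
    by rewrite addrAC subrr add0r.
  have -> : z - (j%:R * eta)%:C%C = z - (j.+1%:R * eta)%:C%C + eta%:C%C.
    by rewrite -natr1 mulrDl mul1r rmorphD /=; ring.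
  apply: le_trans (ler_nrmD _ _) _; rewrite nrm_real gtr0_norm//.
  by rewrite [leRHS]mulr_natl mulr2n lerD2r.
(* [m * eta <= 1 < (m + 1) * eta], so 1 lies in the disc about the last centre. *)
pose m := Num.truncn eta^-1.
have ei : 0 <= eta^-1 by rewrite invr_ge0 ltW.
have /andP[m1 m2] := truncn_itv ei.
have [|N NP] := chain m _ e e0.
  by rewrite -ler_pdivlMr// mul1r.
exists N => n c c0 cB; apply: NP => //.
rewrite -(rmorph1 (@real_complex R)) -rmorphB nrm_real ger0_norm.
  have : 1 <= m.+1%:R * eta by rewrite -ler_pdivrMr// mul1r ltW.
  by rewrite -natr1 mulrDl mul1r lerBlDl.
by rewrite subr_ge0 -ler_pdivlMr// mul1r.
Qed.

End PowerSums.

(** * Hilbert tensor norms of operator matrices *)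

Section ScalarHilbertSpace.
Variable R : realType.
Local Notation C := R[i].

(** Real and imaginary parts do not increase distances, so both converge in [R], and their limits
    assemble to a limit in [C]. *)
Lemma scalar_complete (F : set_system C^o) : ProperFilter F -> cauchy F -> cvg F.
Proof.
move=> FF /cauchy_ballP Fc.
have cvg_part (f : C^o -> R) : (forall a b, `|f a - f b| <= nrm (a - b)) ->
    cvg (f @ F).
  move=> fl; apply: cauchy_cvg; apply/cauchy_ballP => e e0.
  have e0' : 0 < (e%:C)%C by rewrite ltcR.
  have [[P Q]/= [FP FQ] PQ] := Fc _ e0'.
  exists (f @` P, f @` Q) => /=.
    split; [apply: filterS FP|apply: filterS FQ] => u Pu; exact: imageP.
  move=> [_ _] /= [[u Pu <-] [v Qv <-]].
  have := PQ (u, v) (conj Pu Qv); rewrite -!ball_normE /= => uv.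
  apply: le_lt_trans (fl u v) _.
  by rewrite -ltcR -normCE.
have leRe (a b : C^o) : `|complex.Re a - complex.Re b| <= nrm (a - b).
  rewrite -lecR -normCE; case: a b => [a1 a2] [b1 b2] /=.
  by rewrite normc_def lecR /= -sqrtr_sqr ler_sqrt ?addr_ge0 ?sqr_ge0// lerDl sqr_ge0.
have leIm (a b : C^o) : `|complex.Im a - complex.Im b| <= nrm (a - b).
  rewrite -lecR -normCE; case: a b => [a1 a2] [b1 b2] /=.
  by rewrite normc_def lecR /= -sqrtr_sqr ler_sqrt ?addr_ge0 ?sqr_ge0// lerDr sqr_ge0.
have decomp a b (u : C) : (a +i* b)%C - u =
    (a - complex.Re u)%:C%C + 'i%C * (b - complex.Im u)%:C%C.
  by case: u => u1 u2; apply/eqP; rewrite eq_complex /=; apply/andP;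
     split; apply/eqP => /=; ring.
have c1 := cvg_part _ leRe; have c2 := cvg_part _ leIm.
set l1 := lim _ in c1; set l2 := lim _ in c2.
apply/cvg_ex; exists (l1 +i* l2)%C; apply/cvgrPdist_lt => e e0.
have eR : e = (complex.Re e)%:C%C by rewrite RRe_real// gtr0_real.
have e20 : 0 < complex.Re e / 2 by rewrite divr_gt0// -ltcR -eR.
have /cvgrPdist_lt/(_ _ e20) h1 := c1.
have /cvgrPdist_lt/(_ _ e20) h2 := c2.
near=> u.
have u1 : `|l1 - complex.Re u| < complex.Re e / 2 by near: u.
have u2 : `|l2 - complex.Im u| < complex.Re e / 2 by near: u.
have -> : (l1 +i* l2)%C - u =
    (l1 - complex.Re u)%:C%C + 'i%C * (l2 - complex.Im u)%:C%C.
  exact: decomp.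
apply: le_lt_trans (ler_normD _ _) _.
rewrite normrM normCi mul1r !normCE -rmorphD /= eR ltcR !nrm_real.
by rewrite (le_lt_trans (lerD (ltW u1) (lexx _)))// [ltRHS](splitr _) ltrD2l.
Unshelve. all: by end_near.
Qed.

(** A separate name to carry completeness and the dot product. This one-dimensional Hilbert space is
    the test space on which [hbound_entry] isolates an entry. *)
Definition scalars : Type := C^o.
HB.instance Definition _ := NormedModule.copy scalars C^o.
HB.instance Definition _ := Uniform_isComplete.Build scalars scalar_complete.

Definition scalar_dot (u v : scalars) : C := u * v^*.

Lemma scalar_dot_bilinear : bilinear_for *%R (@Num.conj C \; *%R) scalar_dot.
Proof.
split=> [v|u] a x y /=; rewrite /scalar_dot.
  by rewrite mulrDl -mulrA.
by rewrite rmorphD rmorphM mulrDr mulrCA.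
Qed.

HB.instance Definition _ := @bilinear_isBilinear.Build
  C scalars scalars C *%R (@Num.conj C \; *%R) scalar_dot scalar_dot_bilinear.

Lemma scalar_dot_herm u v : scalar_dot u v = (-1) ^+ false * (scalar_dot v u)^*.
Proof. by rewrite expr0 mul1r /scalar_dot rmorphM /= conjCK mulrC. Qed.

HB.instance Definition _ := @isHermitianSesquilinear.Build
  C scalars false (@Num.conj C) scalar_dot scalar_dot_herm.

Lemma scalar_normE (u : scalars) : `|u| ^+ 2 = scalar_dot u u.
Proof. by rewrite /scalar_dot -normCK. Qed.

Lemma scalar_dot_gt0 (u : scalars) : u != 0 -> 0 < scalar_dot u u.
Proof. by move=> u0; rewrite -scalar_normE exprn_gt0// normr_gt0. Qed.

HB.instance Definition _ := @isDotProduct.Build C scalars scalar_dot scalar_dot_gt0.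

Definition scalar_space : hilbertSpace R := @HilbertSpace R scalars scalar_dot scalar_normE.

End ScalarHilbertSpace.

Section Bops.
Variable R : realType.
Local Notation C := R[i].

Lemma bopnorm_le (U V : normedModType C) (f : bop U V) (c : R) : 0 <= c ->
  (bopnorm f <= c%:E)%E <-> forall u, nrm (f u) <= c * nrm u.
Proof.
move=> c0; split=> [fc u|fc].
  have [u0|u0] := eqVneq (nrm u) 0.
    by rewrite u0 mulr0 (nrm0_eq0 u0) linear0 nrm0.
  have u0' : 0 < nrm u by rewrite lt_def u0 nrm_ge0.
  have : ((nrm (f ((nrm u)^-1%:C%C *: u)))%:E <= c%:E)%E.
    apply: le_trans fc; apply: ereal_sup_ubound; exists ((nrm u)^-1%:C%C *: u) => //=.
    by rewrite nrmZ nrm_real ger0_norm ?invr_ge0 ?nrm_ge0// mulVf.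
  rewrite lee_fin linearZ nrmZ nrm_real ger0_norm ?invr_ge0 ?nrm_ge0//.
  by rewrite ler_pdivrMl// mulrC.
apply: ge_ereal_sup => _ [u u1 <-]; rewrite lee_fin; apply: le_trans (fc u) _.
by rewrite ler_piMr.
Qed.

Lemma bounded_linear_bcomp (U V W : normedModType C) (f : bop V W) (g : bop U V) :
  bounded_linear (f \o g).
Proof.
split=> [a u v /=|]; first by rewrite !linearP.
have [M M0 fM] := bop_boundP f; have [N _ gN] := bop_boundP g.
exists (M * N) => u /=; apply: le_trans (fM _) _.
by rewrite -mulrA ler_wpM2l.
Qed.

Definition bcomp (U V W : normedModType C) (f : bop V W) (g : bop U V) : bop U W :=
  mkbop (bounded_linear_bcomp f g).

Lemma bop_sumE (U V : normedModType C) (I : Type) (r : seq I) (P : pred I)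
    (F : I -> bop U V) u : (\sum_(i <- r | P i) F i) u = \sum_(i <- r | P i) F i u.
Proof. exact: (big_morph (fun f : bop U V => f u)). Qed.

(** [htn_mapE] specifies [htn_map] on the algebraic tensor product only; every identity about it is
    checked there and carried to the completion by this lemma. *)
Lemma eq_on_dense (V : lmodType C) (N : V -> R) (c : completion N)
    (W : normedModType C) (f g : bop c W) :
  (forall v, f (compl_emb c v) = g (compl_emb c v)) -> forall z, f z = g z.
Proof.
move=> fg z; apply/eqP; rewrite -subr_eq0; apply/eqP/nrm0_eq0.
have [M M0 fM] := bop_boundP f; have [M' M'0 gM] := bop_boundP g.
apply/eqP; rewrite eq_le nrm_ge0 andbT leNgt; apply/negP => d0.
set d := nrm (f z - g z) in d0.
have MM : 0 < M + M' + 1 by rewrite ltr_wpDl// addr_ge0.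
have e0 : 0 < (d / (M + M' + 1))%:C%C by rewrite ltcR divr_gt0.
set O := (ball z (d / (M + M' + 1))%:C%C)^°.
have O0 : O !=set0 by exists z; apply: nbhsx_ballx.
have [y [bz [v _ vE]]] := compl_dense O0 (@open_interior _ _).
have := interior_subset bz; rewrite -vE -ball_normE /= normCE ltcR => zv.
suff : d <= (M + M') * nrm (z - compl_emb c v).
  apply/negP; rewrite -ltNge; apply: le_lt_trans (_ : (M + M') * (d / (M + M' + 1)) < d).
    by rewrite ler_wpM2l ?addr_ge0// ltW.
  by rewrite mulrCA gtr_pMr// ltr_pdivrMr// mul1r ltrDl.
have -> : d = nrm (f (z - compl_emb c v) - g (z - compl_emb c v)).
  by rewrite (linearB f) (linearB g) /= fg opprB addrA subrK.
apply: le_trans (ler_nrmD _ _) _; rewrite nrmN mulrDl; exact: lerD.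
Qed.

Lemma tensor_val_sum (U V : lmodType C) (I : Type) (r : seq I) (F : I -> tensor U V) B :
  (\sum_(i <- r) F i) B = \sum_(i <- r) F i B.
Proof. exact: (big_morph (fun w : tensor U V => w B)). Qed.

(** One representation [s] of [w] serves all [f] and [g] at once, so images under different maps can
    be compared term by term. *)
Lemma tensor_map_sumE (U1 V1 : lmodType C) (w : tensor U1 V1) :
  exists s : seq (U1 * V1), forall (U2 V2 : lmodType C) (f : {linear U1 -> U2})
    (g : {linear V1 -> V2}),
  tensor_map f g w = \sum_(p <- s) elem_tensor (f p.1) (g p.2).
Proof.
have /asboolP[s ws] := tensorP w; exists s => U2 V2 f g.
apply/val_inj/funext => B; rewrite [RHS]tensor_val_sum.
by rewrite -[LHS]/(tensor_fun w (pullback_form f g B)) ws.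
Qed.

Lemma tensor_map_sum (U1 V1 U2 V2 : lmodType C) (f : {linear U1 -> U2})
    (g : {linear V1 -> V2}) (I : Type) (r : seq I) (F : I -> tensor U1 V1) :
  tensor_map f g (\sum_(i <- r) F i) = \sum_(i <- r) tensor_map f g (F i).
Proof.
by apply/val_inj/funext => B; rewrite [RHS]tensor_val_sum /= tensor_val_sum.
Qed.

Lemma elem_tensorDl (U V : lmodType C) (u u' : U) (v : V) :
  elem_tensor (u + u') v = elem_tensor u v + elem_tensor u' v.
Proof. by apply/val_inj/funext => B; apply: linearDl. Qed.

Lemma elem_tensorDr (U V : lmodType C) (u : U) (v v' : V) :
  elem_tensor u (v + v') = elem_tensor u v + elem_tensor u v'.
Proof. by apply/val_inj/funext => B; apply: linearDr. Qed.

Lemma elem_tensorZ (U V : lmodType C) a (u : U) (v : V) :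
  elem_tensor (a *: u) v = elem_tensor u (a *: v).
Proof.
apply/val_inj/funext => B; rewrite -[LHS]/(B _ _) -[RHS]/(B _ _).
by rewrite linearZl_LR linearZr_LR.
Qed.

End Bops.

Section HtnMap.
Variables (R : realType) (X : completeNormedModType R[i]) (h : hilbertTensorNorm X).
Local Notation C := R[i].
Implicit Types K : hilbertSpace R.

Lemma htn_mapDl K1 K2 (S S' : bop X X) (T : bop K1 K2) z :
  htn_map h (S + S') T z = htn_map h S T z + htn_map h S' T z.
Proof.
rewrite -bopDE; move: z; apply: eq_on_dense => w; rewrite bopDE !htn_mapE -linearD.
congr (compl_emb _ _); have [s ws] := tensor_map_sumE w.
by rewrite !ws -big_split /=; apply: eq_bigr => p _; exact: elem_tensorDl.
Qed.

Lemma htn_mapDr K1 K2 (S : bop X X) (T T' : bop K1 K2) z :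
  htn_map h S (T + T') z = htn_map h S T z + htn_map h S T' z.
Proof.
rewrite -bopDE; move: z; apply: eq_on_dense => w; rewrite bopDE !htn_mapE -linearD.
congr (compl_emb _ _); have [s ws] := tensor_map_sumE w.
by rewrite !ws -big_split /=; apply: eq_bigr => p _; exact: elem_tensorDr.
Qed.

Lemma htn_mapZ K1 K2 a (S : bop X X) (T : bop K1 K2) z :
  htn_map h (a *: S) T z = htn_map h S (a *: T) z.
Proof.
move: z; apply: eq_on_dense => w; rewrite !htn_mapE.
congr (compl_emb _ _); have [s ws] := tensor_map_sumE w.
by rewrite !ws; apply: eq_bigr => p _; exact: elem_tensorZ.
Qed.

(** The composite [T''] is a parameter known only pointwise, so that it can be taken to be a matrix
    unit or 0. *)
Lemma htn_map_comp K1 K2 K3 (S S' : bop X X) (T : bop K2 K3) (T' : bop K1 K2)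
    (T'' : bop K1 K3) z : (forall u, T'' u = T (T' u)) ->
  htn_map h S T (htn_map h S' T' z) = htn_map h (S * S') T'' z.
Proof.
move=> TT; rewrite -[LHS]/(bcomp (htn_map h S T) (htn_map h S' T') z).
move: z; apply: eq_on_dense => w; rewrite /= !htn_mapE.
congr (compl_emb _ _); have [s ws] := tensor_map_sumE w.
rewrite !ws tensor_map_sum; apply: eq_bigr => p _; rewrite tensor_mapE /= -TT //.
Qed.

Lemma htn_map0l K1 K2 (T : bop K1 K2) z : htn_map h 0 T z = 0.
Proof. by apply: (addrI (htn_map h 0 T z)); rewrite -htn_mapDl !addr0. Qed.

Lemma htn_map0r K1 K2 S z : htn_map h S (0 : bop K1 K2) z = 0.
Proof. by apply: (addrI (htn_map h S 0 z)); rewrite -htn_mapDr !addr0. Qed.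

Lemma htn_map_suml K1 K2 (I : Type) (r : seq I) (P : pred I) (S : I -> bop X X)
    (T : bop K1 K2) z :
  htn_map h (\sum_(i <- r | P i) S i) T z = \sum_(i <- r | P i) htn_map h (S i) T z.
Proof.
apply: (big_morph (fun S => htn_map h S T z)); last exact: htn_map0l.
by move=> S1 S2; rewrite htn_mapDl.
Qed.

Lemma htn_map_sumr K1 K2 (I : Type) (r : seq I) (P : pred I) (S : bop X X)
    (T : I -> bop K1 K2) z :
  htn_map h S (\sum_(i <- r | P i) T i) z = \sum_(i <- r | P i) htn_map h S (T i) z.
Proof.
apply: (big_morph (fun T => htn_map h S T z)); last exact: htn_map0r.
by move=> S1 S2; rewrite htn_mapDr.
Qed.

Lemma htn_map_le K1 K2 (S : bop X X) (T : bop K1 K2) a b : 0 <= a -> 0 <= b ->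
  (forall x, nrm (S x) <= a * nrm x) -> (forall x, nrm (T x) <= b * nrm x) ->
  forall z, nrm (htn_map h S T z) <= a * b * nrm z.
Proof.
move=> a0 b0 Sa Tb; apply/bopnorm_le; first by rewrite mulr_ge0.
apply: le_trans (htn_map_norm _ _ _) _; rewrite EFinM.
apply: lee_pmul; [| |exact/bopnorm_le|exact/bopnorm_le].
- by apply: ereal_sup_ubound; exists 0; rewrite /= ?linear0 nrm0.
- by apply: ereal_sup_ubound; exists 0; rewrite /= ?linear0 nrm0.
Qed.

End HtnMap.

Section Hbound.
Variables (R : realType) (X : completeNormedModType R[i]) (h : hilbertTensorNorm X).
Local Notation C := R[i].
Implicit Types K : hilbertSpace R.

(** For [c >= 0] this is [norm_h A h <= c] ([norm_h_le]), freed from extended reals. *)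
Definition hbound m n (A : 'M[bop X X]_(m, n)) (c : R) : Prop :=
  forall K z, nrm (htn_matrix A h K z) <= c * nrm z.

Lemma htn_matrixE m n (A : 'M[bop X X]_(m, n)) K z :
  htn_matrix A h K z = \sum_i \sum_j htn_map h (A i j) (matrix_unit K i j) z.
Proof. by rewrite bop_sumE; apply: eq_bigr => i _; rewrite bop_sumE. Qed.

Lemma norm_h_le m n (A : 'M[bop X X]_(m, n)) c : 0 <= c ->
  (norm_h A h <= c%:E)%E <-> hbound A c.
Proof.
move=> c0; split=> [Ac K|Ac].
  apply/bopnorm_le => //; apply: le_trans Ac.
  by apply: ereal_sup_ubound; exists K.
by apply: ge_ereal_sup => _ [K ->]; apply/bopnorm_le => //; apply: Ac.
Qed.

Lemma hbound_le m n (A : 'M[bop X X]_(m, n)) c c' : c <= c' ->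
  hbound A c -> hbound A c'.
Proof.
by move=> cc Ac K z; apply: le_trans (Ac K z) _; rewrite ler_wpM2r ?nrm_ge0.
Qed.

Lemma hboundD m n (A B : 'M[bop X X]_(m, n)) a b :
  hbound A a -> hbound B b -> hbound (A + B) (a + b).
Proof.
move=> Aa Bb K z.
have -> : htn_matrix (A + B) h K z = htn_matrix A h K z + htn_matrix B h K z.
  rewrite !htn_matrixE -big_split; apply: eq_bigr => i _ /=.
  by rewrite -big_split; apply: eq_bigr => j _ /=; rewrite mxE htn_mapDl.
by apply: le_trans (ler_nrmD _ _) _; rewrite mulrDl lerD.
Qed.

Lemma matrix_unitM m n p K (i : 'I_m) (j j' : 'I_n) (k : 'I_p) u :
  matrix_unit K i j (matrix_unit K j' k u) =
  if j == j' then matrix_unit K i k u else 0.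
Proof.
rewrite /= /matrix_unit_fun; case: eqVneq => // _.
by apply/funext => l; case: ifP.
Qed.

(** [htn_matrix] is multiplicative, since a product of matrix units vanishes unless the inner
    indices agree. *)
Lemma hboundM m n p (A : 'M[bop X X]_(m, n)) (B : 'M[bop X X]_(n, p)) a b :
  0 <= a -> hbound A a -> hbound B b -> hbound (A *m B) (a * b).
Proof.
move=> a0 Aa Bb K z.
have -> : htn_matrix (A *m B) h K z = htn_matrix A h K (htn_matrix B h K z).
  rewrite !htn_matrixE; apply: eq_bigr => i _.
  under eq_bigr do rewrite mxE htn_map_suml.
  rewrite exchange_big; apply: eq_bigr => j _ /=.
  rewrite linear_sum (bigD1 j)//= [X in _ = _ + X]big1 => [|j' j'j].
    rewrite addr0 linear_sum; apply: eq_bigr => k _ /=.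
    by rewrite (@htn_map_comp _ _ _ _ _ _ _ _ _ _ (matrix_unit K i k))// => u;
       rewrite matrix_unitM eqxx.
  rewrite linear_sum big1// => k _ /=.
  rewrite (@htn_map_comp _ _ _ _ _ _ _ _ _ _ (0 : bop _ _)) ?htn_map0r// => u.
  by rewrite matrix_unitM eq_sym (negPf j'j).
by apply: le_trans (Aa _ _) _; rewrite -mulrA ler_wpM2l.
Qed.

Lemma matrix_unit_le m n (i : 'I_m) (j : 'I_n) K u :
  nrm (matrix_unit K i j u) <= 1 * nrm u.
Proof.
rewrite mul1r nrm_hpow [in leRHS]nrm_hpow /l2norm (bigD1 i)//= /matrix_unit_fun eqxx.
rewrite big1 ?addr0 => [|k /negPf ->]; last by rewrite nrm0 expr0n.
rewrite ler_sqrt ?sumr_ge0// => [|k _]; last by rewrite sqr_ge0.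
by rewrite (bigD1 j)//= lerDl sumr_ge0// => k _; rewrite sqr_ge0.
Qed.

(** Crude, but the bound is the same for every [h]: this is the passage from entries back to an
    arbitrary tensor norm. *)
Lemma hbound_entries m n (A : 'M[bop X X]_(m, n)) (c : 'I_m -> 'I_n -> R) :
  (forall i j, 0 <= c i j) -> (forall i j x, nrm (A i j x) <= c i j * nrm x) ->
  hbound A (\sum_i \sum_j c i j).
Proof.
move=> c0 Ac K z; rewrite htn_matrixE mulr_suml.
apply: le_trans (ler_nrm_sum _ _ _) _; apply: ler_sum => i _; rewrite mulr_suml.
apply: le_trans (ler_nrm_sum _ _ _) _; apply: ler_sum => j _.
rewrite -[c i j]mulr1; apply: htn_map_le => //; exact: matrix_unit_le.
Qed.

Lemma htn_elem_norm K x k :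
  nrm (compl_emb (htn_completion h K) (elem_tensor x k)) = nrm x * nrm k.
Proof. by rewrite compl_isometry; have [_ ->] := htn_reasonable h K. Qed.

Definition single n (i : 'I_n) : hilbert_pow n (scalar_space R) :=
  fun j => if j == i then 1 else 0.

Lemma nrm_single n (i : 'I_n) : nrm (single i) = 1.
Proof.
rewrite nrm_hpow /l2norm (bigD1 i)//= /single eqxx.
rewrite big1 ?addr0 => [|k /negPf ->]; last by rewrite nrm0 expr0n.
by rewrite nrm1 expr1n sqrtr1.
Qed.

(** The operator is applied to [x (x) e_j] with scalar [K] and compressed by [E_ii]. The result is
    [A i j x (x) e_i], whose norm is [|A i j x|] by the cross norm property, whatever [h] is. *)
Lemma hbound_entry m n (A : 'M[bop X X]_(m, n)) c : hbound A c ->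
  forall i j x, nrm (A i j x) <= c * nrm x.
Proof.
move=> Ac i j x; set K := scalar_space R.
pose z := compl_emb (htn_completion h (hilbert_pow n K)) (elem_tensor x (single j)).
have := Ac K z; rewrite htn_elem_norm nrm_single mulr1; apply: le_trans.
have : nrm (htn_map h 1 (matrix_unit K i i) (htn_matrix A h K z)) <=
    1 * 1 * nrm (htn_matrix A h K z).
  apply: htn_map_le; rewrite ?ler01//; last exact: matrix_unit_le.
  by move=> y; rewrite mul1r.
rewrite !mul1r; apply: le_trans.
rewrite htn_matrixE linear_sum (bigD1 i)//= [X in _ + X]big1 => [|i' i'i].
  rewrite addr0 linear_sum (bigD1 j)//= [X in _ + X]big1 => [|j' j'j].
    rewrite addr0 (@htn_map_comp _ _ _ _ _ _ _ _ _ _ (matrix_unit K i j)) => [|u];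
      last by rewrite matrix_unitM eqxx.
    rewrite mul1r [htn_map _ _ _ z](_ : _ =
      compl_emb (htn_completion h (hilbert_pow m K)) (elem_tensor (A i j x) (single i))).
      by rewrite htn_elem_norm nrm_single mulr1.
    rewrite htn_mapE tensor_mapE; congr (compl_emb _ (elem_tensor _ _)).
    by apply/funext => k; rewrite /= /matrix_unit_fun /single eqxx.
  rewrite (@htn_map_comp _ _ _ _ _ _ _ _ _ _ (matrix_unit K i j')) => [|u];
    last by rewrite matrix_unitM eqxx.
  rewrite mul1r [htn_map _ _ _ z](_ : _ =
    compl_emb (htn_completion h (hilbert_pow m K)) (elem_tensor (A i j' x) 0)).
    by apply: nrm0_eq0; rewrite htn_elem_norm nrm0 mulr0.
  rewrite htn_mapE tensor_mapE; congr (compl_emb _ (elem_tensor _ _)).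
  apply/funext => k; rewrite /= /matrix_unit_fun /single eq_sym (negPf j'j).
  by case: ifP.
rewrite linear_sum big1// => j' _ /=.
rewrite (@htn_map_comp _ _ _ _ _ _ _ _ _ _ (0 : bop _ _)) ?htn_map0r// => u.
by rewrite matrix_unitM eq_sym (negPf i'i).
Qed.

End Hbound.

(** * Contractive scalar matrices and ampliations *)

Section Contractions.
Variable R : realType.
Local Notation C := R[i].

(* [U^* U + V^* V = 1] exhibits [1 - U^* U] as positive. *)
Definition contraction m n (U : 'M[C]_(m, n)) : Prop :=
  exists p (V : 'M[C]_(p, n)), U ^t* *m U + V ^t* *m V = 1%:M.

Lemma tr_mulC m n p (A : 'M[C]_(m, n)) (B : 'M[C]_(n, p)) :
  (A *m B) ^t* = B ^t* *m A ^t*.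
Proof. by rewrite trmx_mul map_mxM. Qed.

Lemma tr_colC m1 m2 n (A : 'M[C]_(m1, n)) (B : 'M[C]_(m2, n)) :
  (col_mx A B) ^t* = row_mx (A ^t*) (B ^t*).
Proof. by rewrite tr_col_mx map_row_mx. Qed.

(** With certificates [U'] and [V'], the defect [1 - (U V)^* (U V)] is
    [V'^* V' + (U' V)^* (U' V)]. *)
Lemma contractionM m n p (U : 'M[C]_(m, n)) (V : 'M[C]_(n, p)) :
  contraction U -> contraction V -> contraction (U *m V).
Proof.
move=> [q [U' UE]] [r [V' VE]]; exists (r + q)%N, (col_mx V' (U' *m V)).
rewrite tr_colC mul_row_col !tr_mulC -!mulmxA addrCA.
have UV : U ^t* *m (U *m V) + U' ^t* *m (U' *m V) = V.
  by rewrite !mulmxA -mulmxDl UE mul1mx.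
by rewrite -mulmxDr UV addrC.
Qed.

Lemma contraction_row m n : contraction (row_mx 1%:M 0 : 'M[C]_(m, m + n)).
Proof.
exists n, (row_mx 0 1%:M).
rewrite !tr_row_mx !map_col_mx !mul_col_row !trmx1 !map_mx1 !trmx0 !map_mx0.
rewrite !mulmx1 !mulmx0 add_block_mx ?mul0mx !addr0 !add0r.
by rewrite scalar_mx_block.
Qed.

Lemma contraction_row' m n : contraction (row_mx 0 1%:M : 'M[C]_(n, m + n)).
Proof.
exists m, (row_mx 1%:M 0).
rewrite !tr_row_mx !map_col_mx !mul_col_row !trmx1 !map_mx1 !trmx0 !map_mx0.
rewrite !mulmx1 !mulmx0 add_block_mx ?mul0mx !addr0 !add0r.
by rewrite scalar_mx_block.
Qed.

Lemma contraction_col m n : contraction (col_mx 1%:M 0 : 'M[C]_(m + n, m)).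
Proof.
exists 0%N, 0; rewrite mulmx0 addr0 tr_colC mul_row_col trmx1 map_mx1 mulmx1.
by rewrite mulmx0 addr0.
Qed.

Lemma contraction_col' m n : contraction (col_mx 0 1%:M : 'M[C]_(m + n, n)).
Proof.
exists 0%N, 0; rewrite mulmx0 addr0 tr_colC mul_row_col trmx1 map_mx1 mulmx1.
by rewrite mulmx0 add0r.
Qed.

Variable K : hilbertSpace R.

Lemma dot_sqr_nrm (u : K) : hilbert_dot K u u = (nrm u ^+ 2)%:C%C.
Proof. by rewrite -hilbert_normE normCE rmorphXn. Qed.

Lemma sqr_nrm_hpow n (u : hilbert_pow n K) : nrm u ^+ 2 = \sum_i nrm (u i) ^+ 2.
Proof. by rewrite nrm_hpow sqr_l2norm. Qed.

Lemma dot_suml n (F : 'I_n -> K) w :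
  hilbert_dot K (\sum_j F j) w = \sum_j hilbert_dot K (F j) w.
Proof.
apply: (big_morph (fun u => hilbert_dot K u w)); last exact: linear0l.
by move=> u v; apply: linearDl.
Qed.

Lemma dot_sumr n (F : 'I_n -> K) w :
  hilbert_dot K w (\sum_j F j) = \sum_j hilbert_dot K w (F j).
Proof.
apply: (big_morph (fun u => hilbert_dot K w u)); last exact: linear0r.
by move=> u v; apply: linearDr.
Qed.

Lemma sum_dot_matrix m n (U : 'M[C]_(m, n)) (v : 'I_n -> K) :
  \sum_i hilbert_dot K (\sum_j U i j *: v j) (\sum_j U i j *: v j) =
  \sum_j \sum_k (U ^t* *m U) k j * hilbert_dot K (v j) (v k).
Proof.
under [RHS]eq_bigr do under eq_bigr do rewrite mxE mulr_suml.
under [LHS]eq_bigr do rewrite dot_suml.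
rewrite exchange_big; apply: eq_bigr => j _ /=.
rewrite [RHS]exchange_big; apply: eq_bigr => i _ /=.
rewrite dot_sumr; apply: eq_bigr => k _ /=.
rewrite linearZl_LR linearZr_LR /= !mxE; ring.
Qed.

(** Pairing the certificate with the Gram matrix of [v] gives
    [sum |U v|^2 + sum |V v|^2 = sum |v|^2] over any Hilbert space. An algebraic certificate is what
    makes this transfer immediate. *)
Lemma contraction_ampliation m n (U : 'M[C]_(m, n)) (v : 'I_n -> K) :
  contraction U ->
  \sum_i nrm (\sum_j U i j *: v j) ^+ 2 <= \sum_j nrm (v j) ^+ 2.
Proof.
move=> [p [V UV]]; rewrite -lecR !rmorph_sum /=.
under eq_bigr do rewrite -dot_sqr_nrm.
under [leRHS]eq_bigr do rewrite -dot_sqr_nrm.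
have -> : \sum_j hilbert_dot K (v j) (v j) =
   \sum_j \sum_k (1%:M : 'M[C]_n) k j * hilbert_dot K (v j) (v k).
  apply: eq_bigr => j _; rewrite (bigD1 j)//= big1 => [|k kj].
    by rewrite mxE eqxx mul1r addr0.
  by rewrite mxE (negPf kj) mul0r.
have sum0 (q : nat) (W : 'M[C]_(q, n)) :
    0 <= \sum_i hilbert_dot K (\sum_j W i j *: v j) (\sum_j W i j *: v j).
  by rewrite sumr_ge0// => i _; rewrite dot_sqr_nrm lecR sqr_ge0.
rewrite -UV.
under [leRHS]eq_bigr do under eq_bigr do rewrite mxE mulrDl.
under [leRHS]eq_bigr do rewrite big_split /=.
rewrite big_split /= -!sum_dot_matrix lerDl; exact: sum0.
Qed.

End Contractions.

Section ScalarMatrices.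
Variables (R : realType) (X : completeNormedModType R[i]) (h : hilbertTensorNorm X).
Local Notation C := R[i].

Lemma hpow_sumE n (K : hilbertSpace R) (I : Type) (r : seq I) (P : pred I)
    (F : I -> hilbert_pow n K) k :
  (\sum_(i <- r | P i) F i) k = \sum_(i <- r | P i) F i k.
Proof. exact: (big_morph (fun v : hilbert_pow n K => v k)). Qed.

Definition scalar_bop (a : C) : bop X X := a *: (1 : bop X X).

(** Scalars cross the tensor sign: the whole matrix becomes [1 (x) (U (x) id_K)], a single operator
    on the Hilbert factor, to which the defining inequality of a Hilbert tensor norm applies. *)
Lemma hbound_scalar m n (U : 'M[C]_(m, n)) : contraction U ->
  hbound h (map_mx scalar_bop U) 1.
Proof.
move=> Uc K z.
pose T : bop (hilbert_pow n K) (hilbert_pow m K) :=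
  \sum_i \sum_j U i j *: matrix_unit K i j.
have -> : htn_matrix (map_mx scalar_bop U) h K z = htn_map h 1 T z.
  rewrite htn_matrixE htn_map_sumr; apply: eq_bigr => i _.
  by rewrite htn_map_sumr; apply: eq_bigr => j _; rewrite mxE htn_mapZ.
have TE v : T v = fun i => \sum_j U i j *: v j.
  apply/funext => k; rewrite bop_sumE hpow_sumE (bigD1 k)//=.
  rewrite bop_sumE hpow_sumE [X in _ + X]big1 => [|i ik].
    rewrite addr0; apply: eq_bigr => j _.
    by rewrite bopZE /= !fctE /matrix_unit_fun eqxx.
  rewrite bop_sumE hpow_sumE big1// => j _.
  by rewrite bopZE /= !fctE /matrix_unit_fun eq_sym (negPf ik) scaler0.
rewrite -[1 in leRHS](mulr1 1); apply: htn_map_le => // [x|v].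
  by rewrite mul1r.
rewrite mul1r -ler_sqr ?nnegrE ?nrm_ge0// !sqr_nrm_hpow TE.
exact: contraction_ampliation.
Qed.

Lemma sum_mxtens (V : nmodType) m n (F : 'I_(m * n) -> V) :
  \sum_a F a = \sum_i \sum_k F (mxtens_index (i, k)).
Proof.
rewrite pair_bigA /= (reindex (@mxtens_index m n))/=; last first.
  exists (@mxtens_unindex m n) => a _; [exact: mxtens_indexK|exact: mxtens_unindexK].
by apply: eq_bigr => -[i k].
Qed.

(** The matrix [A (x) 1_k], written with [*+] so that one definition serves free polynomials and
    operators alike. *)
Definition ampliation (S : nmodType) k m n (A : 'M[S]_(m, n)) : 'M[S]_(m * k, n * k) :=
  \matrix_(a, b) (A (mxtens_unindex a).1 (mxtens_unindex b).1 *+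
    ((mxtens_unindex a).2 == (mxtens_unindex b).2)).

End ScalarMatrices.

Section Ampliation.
Variables (R : realType) (X : completeNormedModType R[i]) (h : hilbertTensorNorm X).
Local Notation C := R[i].
Variables (K : hilbertSpace R) (k : nat).

(** With [uncurry_fun], the unitary identification of [C^(n k) (x) K] with [C^n (x) (C^k (x) K)]. *)
Definition curry_fun n (v : hilbert_pow (n * k) K) : hilbert_pow n (hilbert_pow k K) :=
  fun i l => v (mxtens_index (i, l)).

Definition uncurry_fun n (v : hilbert_pow n (hilbert_pow k K)) : hilbert_pow (n * k) K :=
  fun a => v (mxtens_unindex a).1 (mxtens_unindex a).2.

Lemma nrm_curry n v : nrm (@curry_fun n v) = nrm v.
Proof.
apply/eqP; rewrite -(@eqrXn2 _ 2) ?nrm_ge0// !sqr_nrm_hpow sum_mxtens.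
by apply/eqP/eq_bigr => i _; rewrite sqr_nrm_hpow.
Qed.

Lemma uncurryK n : cancel (@uncurry_fun n) (@curry_fun n).
Proof.
by move=> v; apply/funext => i; apply/funext => l; rewrite /curry_fun /uncurry_fun mxtens_indexK.
Qed.

Lemma curry_bounded n : bounded_linear (@curry_fun n).
Proof.
split; first by move=> a u v.
by exists 1 => u; rewrite mul1r nrm_curry.
Qed.

Lemma uncurry_bounded n : bounded_linear (@uncurry_fun n).
Proof.
split; first by move=> a u v.
by exists 1 => u; rewrite mul1r -nrm_curry uncurryK.
Qed.

Definition curry_bop n := mkbop (curry_bounded n).
Definition uncurry_bop n := mkbop (uncurry_bounded n).

Lemma uncurry_unit_curry m n (i : 'I_m) (j : 'I_n) v :
  uncurry_bop m (matrix_unit (hilbert_pow k K) i j (curry_bop n v)) =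
  (\sum_(l < k) matrix_unit K (mxtens_index (i, l)) (mxtens_index (j, l))) v.
Proof.
rewrite bop_sumE; apply/funext => a; rewrite hpow_sumE /= /uncurry_fun /matrix_unit_fun /=.
have -> : (if (mxtens_unindex a).1 == i then curry_fun v j else 0) (mxtens_unindex a).2
   = if (mxtens_unindex a).1 == i then v (mxtens_index (j, (mxtens_unindex a).2)) else 0.
  by case: ifP.
have aE l : (a == mxtens_index (i, l)) =
    ((mxtens_unindex a).1 == i) && ((mxtens_unindex a).2 == l).
  rewrite -(can_eq (@mxtens_unindexK m k)) mxtens_indexK.
  by case: (mxtens_unindex a).
rewrite (bigD1 (mxtens_unindex a).2)//= big1 => [|l lk].
  by rewrite aE eqxx andbT addr0.
by rewrite aE [_ == l]eq_sym (negPf lk) andbF.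
Qed.

End Ampliation.

(** Up to the unitaries [curry_bop] and [uncurry_bop], the ampliation acting over [K] is [A] acting
    over [C^k (x) K]. As [hbound] ranges over all Hilbert spaces, [k] costs nothing. *)
Lemma hbound_ampliation (R : realType) (X : completeNormedModType R[i])
    (h : hilbertTensorNorm X) k m n (A : 'M[bop X X]_(m, n)) c : 0 <= c ->
  hbound h A c -> hbound h (ampliation k A) c.
Proof.
move=> c0 Ac K z.
have -> : htn_matrix (ampliation k A) h K z =
    htn_map h 1 (uncurry_bop K k m)
     (htn_matrix A h (hilbert_pow k K) (htn_map h 1 (curry_bop K k n) z)).
  rewrite !htn_matrixE sum_mxtens linear_sum; apply: eq_bigr => i _ /=.
  under eq_bigr do rewrite sum_mxtens.
  rewrite exchange_big linear_sum; apply: eq_bigr => j _ /=.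
  rewrite (@htn_map_comp _ _ _ _ _ _ _ _ _ _
    (bcomp (matrix_unit (hilbert_pow k K) i j) (curry_bop K k n)))// mulr1.
  rewrite (@htn_map_comp _ _ _ _ _ _ _ _ _ _ (\sum_(l < k)
     matrix_unit K (mxtens_index (i, l)) (mxtens_index (j, l)))); last first.
    by move=> u; rewrite -uncurry_unit_curry.
  rewrite mul1r htn_map_sumr; apply: eq_bigr => l _.
  rewrite (bigD1 l)//= [X in _ + X]big1 => [|l' l'l].
    by rewrite addr0 mxE !mxtens_indexK eqxx mulr1n.
  by rewrite mxE !mxtens_indexK /= eq_sym (negPf l'l) mulr0n htn_map0l.
have le1 (K1 K2 : hilbertSpace R) (T : bop K1 K2) y : (forall u, nrm (T u) <= 1 * nrm u) ->
    nrm (htn_map h 1 T y) <= nrm y.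
  move=> T1; rewrite -[leRHS]mul1r -[X in X * _](mulr1 1).
  by apply: htn_map_le => // x; rewrite mul1r.
apply: le_trans (le1 _ _ _ _ _) _ => [u|].
  by rewrite mul1r -nrm_curry uncurryK.
apply: le_trans (Ac _ _) _; rewrite ler_wpM2l// le1// => u.
by rewrite mul1r nrm_curry.
Qed.

(** * Cone separation and isometries *)

(* Separation of a point from a cone that need not be closed: instead of the
   metric projection, an almost nearest point of the cone is used, and the error
   is absorbed by a multiple of the functional [dot L0], which dominates the norm
   on the cone. *)
Lemma approx_separation (R : realType) (V : lmodType R[i]) (dot : V -> V -> R)
    (cone : V -> Prop) (L0 h : V) :
  (forall u v w, dot (u + v) w = dot u w + dot v w) ->
  (forall u v, dot u v = dot v u) ->
  (forall (t : R) u v, dot (t%:C%C *: u) v = t * dot u v) ->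
  (forall u, 0 <= dot u u) ->
  cone 0 -> (forall u v, cone u -> cone v -> cone (u + v)) ->
  (forall (t : R) u, 0 <= t -> cone u -> cone (t%:C%C *: u)) ->
  (forall c, cone c -> 0 <= dot L0 c /\ dot c c <= dot L0 c ^+ 2) ->
  (forall e, 0 < e -> exists c, cone c /\ dot (c - h) (c - h) < e) \/
  exists c gamma eta, [/\ cone c, 0 < eta,
    forall c', cone c' -> eta * dot L0 c' <= dot (c - h + gamma%:C%C *: L0) c' &
    dot (c - h + gamma%:C%C *: L0) h < 0].
Proof.
move=> dotDl dotC dotZl dot_ge0 cone0 coneD coneZ coneL.
have dotDr u v w : dot w (u + v) = dot w u + dot w v by rewrite dotC dotDl !(dotC w).
have dotZr t u v : dot v (t%:C%C *: u) = t * dot v u by rewrite dotC dotZl dotC.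
have [?|far] := pselect (forall e, 0 < e -> exists c, cone c /\ dot (c - h) (c - h) < e).
  by left.
right; have [e0 [e00 e0P]] : exists e0, 0 < e0 /\ forall c, cone c -> e0 <= dot (c - h) (c - h).
  apply: contrapT => H; apply: far => e e_gt0; apply: contrapT => H'.
  apply: H; exists e; split=> // c cc; rewrite leNgt; apply/negP => lt.
  by apply: H'; exists c.
pose S := [set dot (c - h) (c - h) | c in [set c | cone c]].
have Sinf : has_inf S.
  split; first by exists (dot (0 - h) (0 - h)); exists 0.
  by exists e0 => _ [c cc <-]; apply: e0P.
pose D := inf S.
have D0 : 0 < D.
  apply: lt_le_trans e00 _; apply: lb_le_inf; first by case: Sinf.
  by move=> _ [c cc <-]; apply: e0P.
have Dle c : cone c -> D <= dot (c - h) (c - h).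
  by move=> cc; apply: ge_inf; [case: Sinf|exists c].
(* [B] bounds [dot c c] for an almost nearest [c], by writing [c = h + (c - h)]. [Q] collects all
   errors proportional to [eta] in the final inequality, and [eta * Q < D] keeps the functional
   negative at [h]. *)
pose B := 2 * dot h h + 2 * (D + 1); pose Q := (1 + B) / 2 + 2 * `|dot L0 h|.
have B0 : 0 <= B by rewrite /B addr_ge0 ?mulr_ge0// addr_ge0// ltW.
have Q0 : 0 <= Q by rewrite /Q addr_ge0 ?mulr_ge0 ?divr_ge0// addr_ge0.
have Q1 : 0 < Q + 1 by rewrite ltr_wpDl.
pose eta := Num.min 1 (D / (Q + 1)).
have eta0 : 0 < eta by rewrite lt_min ltr01 divr_gt0.
have eta1 : eta <= 1 by rewrite ge_min lexx.
have etaQ : eta * Q < D.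
  have : eta * (Q + 1) <= D by rewrite -ler_pdivlMr// ge_min lexx orbT.
  by apply: lt_le_trans; rewrite ltr_pM2l// ltrDl.
have [_ [c cc <-] cD] := inf_adherent (exprn_gt0 2 eta0) Sinf.
rewrite -/D in cD.
pose L1 := c - h; have L1E : L1 = c - h by [].
rewrite -L1E in cD; clearbody L1.
have expand t c' : dot (L1 + t%:C%C *: c') (L1 + t%:C%C *: c') =
    dot L1 L1 + 2 * t * dot L1 c' + t ^+ 2 * dot c' c'.
  by rewrite !(dotDl, dotDr, dotZl, dotZr) (dotC c' L1); ring.
(* No move inside the cone can reduce the squared distance by more than [eta^2]. *)
have near_c t c' : cone (c + t%:C%C *: c') ->
    - (eta ^+ 2) <= 2 * t * dot L1 c' + t ^+ 2 * dot c' c'.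
  move=> /Dle; rewrite addrAC -L1E expand; move: cD; lra.
(* With [t = eta / dot L0 c'] the quadratic term is at most [eta^2]. If [dot L0 c' = 0], then [c']
   is null for [dot] and a large [t] rules out a negative value. *)
have L1c' c' : cone c' -> - (eta * dot L0 c') <= dot L1 c'.
  move=> cc'; have [l0 nl] := coneL _ cc'.
  have [l_eq0|lN0] := eqVneq (dot L0 c') 0.
    rewrite l_eq0 mulr0 oppr0 leNgt; apply/negP => neg.
    have t0 : 0 < eta ^+ 2 / - dot L1 c' by rewrite divr_gt0 ?exprn_gt0// oppr_gt0.
    have := near_c (eta ^+ 2 / - dot L1 c') c' (coneD _ _ cc (coneZ _ _ (ltW t0) cc')).
    have -> : dot c' c' = 0.
      by apply/eqP; rewrite eq_le dot_ge0 andbT; rewrite l_eq0 expr0n in nl.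
    rewrite mulr0 addr0.
    have -> : 2 * (eta ^+ 2 / - dot L1 c') * dot L1 c' = - (2 * eta ^+ 2).
      by field; rewrite lt_eqF.
    have := exprn_gt0 2 eta0; lra.
  have l1 : 0 < dot L0 c' by rewrite lt_def lN0.
  have t0 : 0 < eta / dot L0 c' by rewrite divr_gt0.
  have := near_c (eta / dot L0 c') c' (coneD _ _ cc (coneZ _ _ (ltW t0) cc')).
  have : (eta / dot L0 c') ^+ 2 * dot c' c' <= eta ^+ 2.
    rewrite expr_div_n mulrAC ler_pdivrMr ?exprn_gt0// ler_wpM2l//.
    by rewrite exprn_ge0// ltW.
  move=> h1 h2; have {h1 h2} : - (2 * eta ^+ 2) <= 2 * (eta / dot L0 c') * dot L1 c' by lra.
  have -> : 2 * (eta / dot L0 c') * dot L1 c' = 2 * eta * (dot L1 c' / dot L0 c').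
    by field; rewrite lN0.
  rewrite expr2 mulrA -mulrN ler_pM2l ?mulr_gt0//.
  by rewrite ler_pdivlMr// mulNr.
(* Shrinking [c] by the factor [1 - eta] stays in the cone; this replaces the exact orthogonality of
   [c] and [c - h] for a metric projection. *)
have L1c : dot L1 c <= eta * (1 + dot c c) / 2.
  have cone_t : cone (c + (- eta)%:C%C *: c).
    have -> : c + (- eta)%:C%C *: c = (1 - eta)%:C%C *: c.
      by rewrite -{1}[c]scale1r -scalerDl rmorphB rmorphN rmorph1.
    by apply: coneZ => //; rewrite subr_ge0.
  have := near_c _ _ cone_t; rewrite sqrrN => H.
  rewrite -(ler_pM2l eta0); lra.
have ccB : dot c c <= B.
  have hL : c = h + L1 by rewrite L1E addrC subrK.
  have : 0 <= dot (h + (-1)%:C%C *: L1) (h + (-1)%:C%C *: L1) by [].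
  rewrite /B {1 2}hL !(dotDl, dotDr, dotZl, dotZr) (dotC L1 h).
  have : eta ^+ 2 <= 1 by rewrite exprn_ile1// ltW.
  by move: cD; lra.
(* Of [gamma = 2 * eta], one [eta] cancels the deficit in [L1c'] and the other is the remaining
   strict positivity. *)
exists c, (2 * eta), eta; split=> // [c' cc'|].
  rewrite -L1E dotDl dotZl; have := L1c' _ cc'; lra.
rewrite -L1E dotDl dotZl.
have -> : dot L1 h = dot L1 c - dot L1 L1.
  have cE : c = h + L1 by rewrite L1E addrC subrK.
  by rewrite {1}cE dotDr addrK.
have DL : D <= dot L1 L1 by rewrite L1E; apply: Dle.
have : eta * (1 + dot c c) / 2 <= eta * ((1 + B) / 2).
  by rewrite -mulrA ler_pM2l// ler_pM2r// lerD2l.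
have : 2 * eta * dot L0 h <= eta * (2 * `|dot L0 h|).
  by rewrite mulrCA -mulrA ler_pM2l// ler_pM2l// ler_norm.
move: etaQ; rewrite /Q mulrDr; lra.
Qed.

Section PositiveMatrices.
Variable R : realType.
Local Notation C := R[i].

Lemma tr_C_K m n (A : 'M[C]_(m, n)) : (A ^t*) ^t* = A.
Proof. exact: trmxCK. Qed.

Lemma tr_DC m n (A B : 'M[C]_(m, n)) : (A + B) ^t* = A ^t* + B ^t*.
Proof. by rewrite linearD map_mxD. Qed.

Lemma tr_BC m n (A B : 'M[C]_(m, n)) : (A - B) ^t* = A ^t* - B ^t*.
Proof. by rewrite linearB map_mxB. Qed.

Lemma tr_1C n : (1%:M : 'M[C]_n) ^t* = 1%:M.
Proof. by rewrite trmx1 map_mx1. Qed.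

Lemma mulC_tr_eq0 m n (A : 'M[C]_(m, n)) : A ^t* *m A = 0 -> A = 0.
Proof.
move=> AA; apply/matrixP => i j; rewrite [RHS]mxE.
have /eqP := congr1 (fun M : 'M_n => M j j) AA; rewrite !mxE.
under eq_bigr do rewrite !mxE mulrC -normCK.
rewrite psumr_eq0 => [|k _]; last by rewrite exprn_ge0.
by move=> /allP/(_ i (mem_index_enum _)); rewrite implyTb expf_eq0 normr_eq0 => /eqP.
Qed.

(* With [g] a generalized inverse of [G = A^* A = B^* B], the partial isometry
   taking [B] to [A] is [A (g G g^* ) B^*]. *)
Lemma lurking_isometry p q n (A : 'M[C]_(p, n)) (B : 'M[C]_(q, n)) :
  A ^t* *m A = B ^t* *m B -> exists2 U, contraction U & A = U *m B.
Proof.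
move=> AB; pose G := A ^t* *m A; pose g := pinvmx G; have GE : A ^t* *m A = G by [].
have GE' : B ^t* *m B = G by rewrite -AB.
have GgG : G *m g *m G = G by rewrite mulmxKpV.
have Gh : G ^t* = G by rewrite /G tr_mulC tr_C_K.
clearbody g G.
have GgG' : G *m g ^t* *m G = G.
  by rewrite -[in LHS]Gh -!tr_mulC mulmxA GgG.
pose Gp := g *m G *m g ^t*.
have Gph : Gp ^t* = Gp by rewrite /Gp !tr_mulC tr_C_K Gh mulmxA.
have GpG : Gp *m G = g *m G by rewrite /Gp -!mulmxA [G *m _]mulmxA GgG'.
have GpGGp : Gp *m G *m Gp = Gp.
  rewrite GpG /Gp !mulmxA; congr (_ *m _).
  by rewrite -!mulmxA [G *m _]mulmxA GgG.
clearbody Gp.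
have AgG : A *m (g *m G) = A.
  apply/eqP; rewrite -subr_eq0 -[X in _ - X]mulmx1 -mulmxBr; apply/eqP/mulC_tr_eq0.
  rewrite tr_mulC -mulmxA [A ^t* *m _]mulmxA GE mulmxBr mulmx1.
  by rewrite mulmxA GgG subrr mulmx0.
exists (A *m Gp *m B ^t*); last by rewrite -mulmxA GE' -mulmxA GpG AgG.
(* The orthogonal projection onto the range of [B]. It equals [U^* U], so [1 - Pi] certifies that
   [U] is a contraction. *)
pose Pi := B *m Gp *m B ^t*.
have Pih : Pi ^t* = Pi by rewrite /Pi !tr_mulC tr_C_K Gph mulmxA.
have PiPi : Pi *m Pi = Pi.
  rewrite /Pi !mulmxA; congr (_ *m _).
  by rewrite -!mulmxA (mulmxA _ B Gp) GE' (mulmxA Gp) GpGGp.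
exists q, (1%:M - Pi).
have -> : (A *m Gp *m B ^t*) ^t* *m (A *m Gp *m B ^t*) = Pi.
  rewrite !tr_mulC tr_C_K Gph /Pi !mulmxA; congr (_ *m _).
  by rewrite -!mulmxA (mulmxA _ A Gp) GE (mulmxA Gp) GpGGp.
rewrite tr_BC tr_1C Pih mulmxBl mul1mx mulmxBr mulmx1 PiPi subrr subr0.
by rewrite addrC subrK.
Qed.

(** Spectral theorem: [Q] is the square root of the diagonal part times the unitary. Testing on
    eigenvectors gives positive eigenvalues, hence an invertible [Q], which can serve as a
    similarity. *)
Lemma positive_factor n (A : 'M[C]_n) : A ^t* = A ->
  (forall v : 'cV[C]_n, v != 0 -> 0 < (v ^t* *m A *m v) 0 0) ->
  exists2 Q, Q \in unitmx & A = Q ^t* *m Q.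
Proof.
move=> Ah Apos.
have Aherm : A \is hermsymmx by apply/is_hermitianmxP; rewrite expr0 scale1r Ah.
have /hermitian_normalmx/orthomx_spectralP := Aherm.
set P := spectralmx A; set D := spectral_diag A => AE.
have PU : P \is unitarymx := spectral_unitarymx A.
have Punit : P \in unitmx := spectral_unit A.
rewrite invmx_unitary// in AE; clearbody P D.
have D0 i : 0 < D 0 i.
  pose e : 'cV[C]_n := delta_mx i 0.
  have PP : P *m P ^t* = 1%:M by apply/unitarymxP.
  have := Apos (P ^t* *m e).
  rewrite AE tr_mulC tr_C_K -!mulmxA [P *m (_ *m e)]mulmxA PP mul1mx.
  rewrite [P *m (P ^t* *m _)]mulmxA PP mul1mx mulmxA.
  have -> : (e ^t* *m diag_mx D *m e) 0 0 = D 0 i.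
    by rewrite trmx_delta map_delta_mx -rowE -colE !mxE eqxx mulr1n.
  apply; apply/eqP => /(congr1 (mulmx P)).
  rewrite mulmx0 mulmxA PP mul1mx => /matrixP/(_ i 0).
  by rewrite !mxE !eqxx => /eqP; rewrite oner_eq0.
pose s : 'rV[C]_n := \row_i sqrtC (D 0 i).
exists (diag_mx s *m P).
  rewrite unitmx_mul Punit andbT unitmxE det_diag unitfE prodf_seq_neq0.
  by apply/allP => i _; rewrite mxE sqrtC_eq0 gt_eqF.
rewrite tr_mulC tr_diag_mx map_diag_mx [RHS]mulmxA -[X in X *m P]mulmxA.
rewrite mulmx_diag [X in diag_mx X](_ : _ = D)//.
apply/rowP => i; rewrite !mxE /=.
have sr : (sqrtC (D 0 i))^* = sqrtC (D 0 i).
  by rewrite conj_Creal// ger0_real// sqrtC_ge0; apply: ltW.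
rewrite sr.
by rewrite -expr2 sqrtCK.
Qed.

End PositiveMatrices.

(** * Free polynomials *)

Section FreePolynomials.
Variables (R : realType) (d : nat).
Local Notation C := R[i].
Local Notation poly := (free_poly R d).
Local Notation word := (fmonom 'I_d).

Definition monomial (w : seq 'I_d) (a : C) : poly := mkmalgU (FMonom w) a.

Lemma coef_monomial w a u : mcoeff u (monomial w a) = a *+ (w == fmonom_val u).
Proof. by rewrite /monomial mcoeffU fmP. Qed.

Lemma poly_sumE (p : poly) :
  p = \sum_(w <- msupp p) monomial (fmonom_val w) (mcoeff w p).
Proof. by rewrite {1}[p]monalgE; apply: eq_bigr => w _; rewrite /monomial fmK. Qed.

Lemma monomialM u v a b : monomial u a * monomial v b = monomial (u ++ v) (a * b).
Proof.
rewrite /monomial malgM_def fgmulUU; congr (mkmalgU _ _).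
by apply/eqP; rewrite fmP fmM.
Qed.

Lemma poly_ind (P : poly -> Prop) :
  P 0 -> (forall p q, P p -> P q -> P (p + q)) -> (forall w a, P (monomial w a)) ->
  forall p, P p.
Proof.
by move=> P0 PD Pm p; rewrite [p]poly_sumE; elim/big_ind: _.
Qed.

Section Evaluation.
Variables (A : pzRingType) (c : C -> A) (x : 'I_d -> A).
Hypothesis cD : forall a b, c (a + b) = c a + c b.

Let wp (w : seq 'I_d) : A := \prod_(k <- w) x k.

Let c0 : c 0 = 0.
Proof. by apply: (addrI (c 0)); rewrite -cD !addr0. Qed.

Lemma free_evalEw (D : {fset word}) (p : poly) : (msupp p `<=` D)%fset ->
  free_eval c x p = \sum_(w <- D) c (mcoeff w p) * wp (fmonom_val w).
Proof.
move=> le; rewrite /free_eval (big_fset_incl _ le)// => w wD /mcoeff_outdom ->.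
by rewrite c0 mul0r.
Qed.

Lemma free_eval0 : free_eval c x 0 = 0.
Proof. by rewrite /free_eval msupp0 big_nil. Qed.

Lemma free_evalD (p q : poly) : free_eval c x (p + q) = free_eval c x p + free_eval c x q.
Proof.
pose D := (msupp p `|` msupp q)%fset.
rewrite !(@free_evalEw D) ?fsubsetUl ?fsubsetUr ?msuppD_le// -big_split /=.
by apply: eq_bigr => w _; rewrite mcoeffD cD mulrDl.
Qed.

Lemma free_eval_sum (I : Type) (r : seq I) (P : pred I) (F : I -> poly) :
  free_eval c x (\sum_(i <- r | P i) F i) = \sum_(i <- r | P i) free_eval c x (F i).
Proof. exact: (big_morph (free_eval c x) free_evalD free_eval0). Qed.

Lemma free_evalB (p q : poly) : free_eval c x (p - q) = free_eval c x p - free_eval c x q.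
Proof. by apply: (addIr (free_eval c x q)); rewrite -free_evalD !subrK. Qed.

Lemma free_eval_monomial w a : free_eval c x (monomial w a) = c a * wp w.
Proof.
by rewrite (@free_evalEw [fset FMonom w]%fset) ?msuppU_le// big_seq_fset1 mcoeffUU.
Qed.

Lemma free_evalMn p n : free_eval c x (p *+ n) = free_eval c x p *+ n.
Proof. by elim: n => [|n IH]; rewrite ?free_eval0// !mulrS free_evalD IH. Qed.

Hypothesis cM : forall a b, c (a * b) = c a * c b.
Hypothesis c_comm : forall a y, c a * y = y * c a.

Lemma free_evalM (p q : poly) : free_eval c x (p * q) = free_eval c x p * free_eval c x q.
Proof.
elim/poly_ind: p => [|p p' IH IH'|u a].
- by rewrite mul0r free_eval0 mul0r.
- have -> : (p + p') * q = p * q + p' * q by apply: mulrDl.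
  rewrite (free_evalD (p * q)) (free_evalD p p') mulrDl.
  exact: (congr2 +%R IH IH').
elim/poly_ind: q => [|q q' IH IH'|v b].
- by rewrite mulr0 free_eval0 mulr0.
- have -> : monomial u a * (q + q') = monomial u a * q + monomial u a * q' by apply: mulrDr.
  rewrite (free_evalD (_ * q)) (free_evalD q q') mulrDr.
  exact: (congr2 +%R IH IH').
rewrite monomialM !free_eval_monomial cM /wp big_cat /=.
by rewrite !mulrA; congr (_ * _); rewrite -!mulrA; congr (_ * _); rewrite c_comm.
Qed.

Lemma map_free_evalM m n k (P : 'M[poly]_(m, n)) (Q : 'M[poly]_(n, k)) :
  map_mx (free_eval c x) (P *m Q) = map_mx (free_eval c x) P *m map_mx (free_eval c x) Q.
Proof.
apply/matrixP => i j; rewrite !mxE free_eval_sum; apply: eq_bigr => l _.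
by rewrite free_evalM !mxE.
Qed.

Lemma map_free_evalD m n (P Q : 'M[poly]_(m, n)) :
  map_mx (free_eval c x) (P + Q) = map_mx (free_eval c x) P + map_mx (free_eval c x) Q.
Proof. by apply/matrixP => i j; rewrite !mxE free_evalD. Qed.

Lemma map_free_evalB m n (P Q : 'M[poly]_(m, n)) :
  map_mx (free_eval c x) (P - Q) = map_mx (free_eval c x) P - map_mx (free_eval c x) Q.
Proof. by apply/matrixP => i j; rewrite !mxE free_evalB. Qed.

Definition const_poly_mx m n (U : 'M[C]_(m, n)) : 'M[poly]_(m, n) :=
  map_mx (monomial [::]) U.

Lemma map_free_eval_const m n (U : 'M[C]_(m, n)) :
  map_mx (free_eval c x) (const_poly_mx U) = map_mx c U.
Proof.
by apply/matrixP => i j; rewrite !mxE free_eval_monomial /wp big_nil mulr1.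
Qed.

Lemma map_free_eval_ampliation k m n (P : 'M[poly]_(m, n)) :
  map_mx (free_eval c x) (ampliation k P) = ampliation k (map_mx (free_eval c x) P).
Proof. by apply/matrixP => i j; rewrite !mxE free_evalMn. Qed.

End Evaluation.

(** The morphism laws are hypotheses because the application is to conjugation by an invertible
    matrix. *)
Lemma free_eval_morph (A B : pzRingType) (c : C -> A) (c' : C -> B) (x : 'I_d -> A)
    (f : A -> B) :
  (forall a b, f (a + b) = f a + f b) -> (forall a b, f (a * b) = f a * f b) ->
  f 1 = 1 -> (forall a, f (c a) = c' a) ->
  forall p, f (free_eval c x p) = free_eval c' (fun k => f (x k)) p.
Proof.
move=> fD fM f1 fc p.
have f0 : f 0 = 0 by apply: (addrI (f 0)); rewrite -fD !addr0.
rewrite /free_eval (big_morph f fD f0); apply: eq_bigr => w _.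
by rewrite fM fc (big_morph f fM f1).
Qed.

(** Membership in the [k]-th power of the ideal generated by the variables. *)
Definition ordge (k : nat) (p : poly) : Prop :=
  forall w : word, (size (fmonom_val w) < k)%N -> mcoeff w p = 0.

Lemma ordge0 p : ordge 0 p.
Proof. by []. Qed.

Lemma ordge_zero k : ordge k 0.
Proof. by move=> w _; rewrite mcoeff0. Qed.

Lemma ordgeD k p q : ordge k p -> ordge k q -> ordge k (p + q).
Proof. by move=> pk qk w wk; rewrite mcoeffD pk// qk// addr0. Qed.

Lemma ordgeMn k p n : ordge k p -> ordge k (p *+ n).
Proof. by move=> pk w wk; rewrite mcoeffMn pk// mul0rn. Qed.

Lemma ordge_le k l p : (l <= k)%N -> ordge k p -> ordge l p.
Proof. by move=> lk pk w wl; apply: pk; apply: leq_trans lk. Qed.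

Lemma ordgeM k l p q : ordge k p -> ordge l q -> ordge (k + l) (p * q).
Proof.
move=> pk ql w wkl; rewrite mcoeffMl big1// => u _; rewrite big1// => v _.
have [uk|uk] := ltnP (size (fmonom_val u)) k; first by rewrite pk// mul0r mul0rn.
have [vl|vl] := ltnP (size (fmonom_val v)) l; first by rewrite ql// mulr0 mul0rn.
rewrite [_ == w](_ : _ = false)//; apply/eqP => uvw; move: wkl.
by rewrite -uvw fmM size_cat ltnNge leq_add.
Qed.

Definition ordge_mx k m n (P : 'M[poly]_(m, n)) := forall i j, ordge k (P i j).

Lemma ordge_mxD k m n (P Q : 'M[poly]_(m, n)) :
  ordge_mx k P -> ordge_mx k Q -> ordge_mx k (P + Q).
Proof. by move=> Pk Qk i j; rewrite mxE; apply: ordgeD. Qed.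

Lemma ordge_mxM k l m n p (P : 'M[poly]_(m, n)) (Q : 'M[poly]_(n, p)) :
  ordge_mx k P -> ordge_mx l Q -> ordge_mx (k + l) (P *m Q).
Proof.
move=> Pk Ql i j; rewrite mxE; elim/big_ind: _ => [|a b|s _].
- exact: ordge_zero.
- exact: ordgeD.
- exact: ordgeM.
Qed.

Lemma ordge_ampliation k l m n (P : 'M[poly]_(m, n)) :
  ordge_mx k P -> ordge_mx k (ampliation l P).
Proof. by move=> Pk i j; rewrite mxE; apply/ordgeMn/Pk. Qed.

Section Lipschitz.
Variables (A : pzRingType) (c : C -> A) (bound : A -> R -> Prop).
Hypothesis cD : forall a b, c (a + b) = c a + c b.
Hypothesis cM : forall a b, c (a * b) = c a * c b.
Hypothesis c1 : c 1 = 1.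
Hypothesis c_comm : forall a y, c a * y = y * c a.
Hypothesis bound_ge0 : forall y M, bound y M -> 0 <= M.
Hypothesis boundD : forall y z M N, bound y M -> bound z N -> bound (y + z) (M + N).
Hypothesis boundM : forall y z M N, bound y M -> bound z N -> bound (y * z) (M * N).
Hypothesis bound_le : forall y M N, M <= N -> bound y M -> bound y N.
Variable gamma : R.
Hypothesis bound_const : forall a, bound (c a) (gamma * nrm a).

Lemma wordZ (a : C) (x : 'I_d -> A) (w : seq 'I_d) :
  \prod_(k <- w) (c a * x k) = c (a ^+ size w) * \prod_(k <- w) x k.
Proof.
elim: w => [|k w IH]; first by rewrite !big_nil /= expr0 c1 mulr1.
rewrite !big_cons IH /= exprS cM -!mulrA; congr (_ * _).
by rewrite mulrA -c_comm mulrA.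
Qed.

Lemma sub_expr_le (a b : C) k : nrm a <= 2 -> nrm b <= 2 ->
  nrm (a ^+ k - b ^+ k) <= (k%:R * 2 ^+ k) * nrm (a - b).
Proof.
move=> a2 b2; elim: k => [|k IH]; first by rewrite subrr nrm0 !mul0r.
have -> : a ^+ k.+1 - b ^+ k.+1 = a * (a ^+ k - b ^+ k) + (a - b) * b ^+ k.
  by rewrite !exprS; ring.
apply: le_trans (ler_nrmD _ _) _; rewrite !nrmM nrmX.
have h1 : nrm a * nrm (a ^+ k - b ^+ k) <= 2 * (k%:R * 2 ^+ k * nrm (a - b)).
  by apply: ler_pM => //; rewrite nrm_ge0.
have h2 : nrm (a - b) * nrm b ^+ k <= 2 ^+ k * nrm (a - b).
  by rewrite mulrC ler_wpM2r ?nrm_ge0// lerXn2r// ?nnegrE ?nrm_ge0.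
have h3 : 0 <= 2 ^+ k * nrm (a - b) by rewrite mulr_ge0 ?exprn_ge0 ?nrm_ge0.
have -> : k.+1%:R * 2 ^+ k.+1 * nrm (a - b) =
    2 * (k%:R * 2 ^+ k * nrm (a - b)) + 2 * (2 ^+ k * nrm (a - b)).
  by rewrite exprS -natr1; ring.
by apply: lerD => //; apply: le_trans h2 _; rewrite ler_peMl// ler1n.
Qed.

(** [bound y M] stands for a submultiplicative norm estimate, with [gamma] bounding the norm of the
    unit. It is used with [entry_sum] for the shift matrices and with [bop_le] for operators.
    Parameters stay within 2 because they lie within distance 1 of [0, 1]. *)
Lemma free_eval_lipschitz (x : 'I_d -> A) (p : poly) :
  (forall k, exists M, bound (x k) M) ->
  exists2 L, 0 <= L & forall a b, nrm a <= 2 -> nrm b <= 2 ->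
    bound (free_eval c (fun k => c a * x k) p - free_eval c (fun k => c b * x k) p)
      (L * nrm (a - b)).
Proof.
move=> xb; elim/poly_ind: p => [|p q [L L0 Lp] [M M0 Mq]|w e].
- exists 0 => // a b _ _; rewrite !free_eval0 subr0 mul0r.
  have := bound_const 0; rewrite nrm0 mulr0.
  by rewrite (_ : c 0 = 0)//; apply: (addrI (c 0)); rewrite -cD !addr0.
- exists (L + M) => [|a b a2 b2]; first exact: addr_ge0.
  rewrite !free_evalD// mulrDl opprD addrACA.
  by apply: boundD; [apply: Lp|apply: Mq].
have [N Nw] : exists N, bound (\prod_(k <- w) x k) N.
  elim: w => [|k w [N IH]].
    by exists (gamma * nrm 1); rewrite big_nil -c1.
  by have [M xM] := xb k; exists (M * N); rewrite big_cons; apply: boundM.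
have N0 := bound_ge0 Nw.
have gamma0 : 0 <= gamma by have := bound_ge0 (bound_const 1); rewrite nrm1 mulr1.
exists (gamma * nrm e * ((size w)%:R * 2 ^+ size w) * N) => [|a b a2 b2].
  by rewrite !mulr_ge0 ?nrm_ge0 ?exprn_ge0.
rewrite !free_eval_monomial// !wordZ !mulrA -!cM -mulrBl.
have -> : c (e * a ^+ size w) - c (e * b ^+ size w) = c (e * (a ^+ size w - b ^+ size w)).
  by rewrite mulrBr; apply: (addIr (c (e * b ^+ size w))); rewrite -cD !subrK.
rewrite mulrAC; apply: boundM => //; apply: bound_le (bound_const _).
rewrite nrmM -!mulrA ler_wpM2l// ler_wpM2l ?nrm_ge0// mulrA.
exact: sub_expr_le.
Qed.

End Lipschitz.

End FreePolynomials.

Arguments const_poly_mx {R d m n} U.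

(** * The cone of defects *)

Section HermitianForms.
Variable R : realType.
Local Notation C := R[i].

Lemma ReD (a b : C) : complex.Re (a + b) = complex.Re a + complex.Re b.
Proof. by case: a b => [? ?] [? ?]. Qed.

Lemma Re_sum (I : Type) (r : seq I) (P : pred I) (F : I -> C) :
  complex.Re (\sum_(i <- r | P i) F i) = \sum_(i <- r | P i) complex.Re (F i).
Proof. exact: (big_morph _ ReD). Qed.

Lemma ReZ (t : R) (a : C) : complex.Re (t%:C%C * a) = t * complex.Re a.
Proof. by case: a => a b /=; rewrite mul0r subr0. Qed.

Lemma Re_conj (a : C) : complex.Re a^* = complex.Re a.
Proof. by case: a. Qed.

Lemma mulC_nrm (a : C) : a^* * a = (nrm a ^+ 2)%:C%C.
Proof. by rewrite mulrC -normCK normCE rmorphXn. Qed.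

Lemma conj_real_complex (t : R) : (t%:C%C)^* = t%:C%C :> C.
Proof. by apply/eqP; rewrite eq_complex /= oppr0 !eqxx. Qed.

Lemma nrm_conj (a : C) : nrm a^* = nrm a.
Proof. by rewrite /nrm norm_conjC. Qed.

Lemma Re_le_nrm (a : C) : `|complex.Re a| <= nrm a.
Proof.
rewrite -lecR -normCE; case: a => [a1 a2] /=.
by rewrite normc_def lecR /= -sqrtr_sqr ler_sqrt ?addr_ge0 ?sqr_ge0// lerDl sqr_ge0.
Qed.

(** The real part of the Hilbert-Schmidt inner product: cone separation is done over the reals. *)
Definition rdot n (A B : 'M[C]_n) : R := \sum_i \sum_j complex.Re ((A i j)^* * B i j).

Lemma rdotDl n (A B D : 'M[C]_n) : rdot (A + B) D = rdot A D + rdot B D.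
Proof.
rewrite -big_split; apply: eq_bigr => i _; rewrite -big_split; apply: eq_bigr => j _.
by rewrite mxE rmorphD mulrDl ReD.
Qed.

Lemma rdotC n (A B : 'M[C]_n) : rdot A B = rdot B A.
Proof.
apply: eq_bigr => i _; apply: eq_bigr => j _.
by rewrite -Re_conj rmorphM /= conjCK mulrC.
Qed.

Lemma rdotZl n (t : R) (A B : 'M[C]_n) : rdot (t%:C%C *: A) B = t * rdot A B.
Proof.
rewrite mulr_sumr; apply: eq_bigr => i _; rewrite mulr_sumr; apply: eq_bigr => j _.
have -> : ((t%:C%C *: A) i j)^* = t%:C%C * (A i j)^*.
  by rewrite mxE rmorphM /= conj_real_complex.
by rewrite -mulrA ReZ.
Qed.

Lemma rdotDr n (A B D : 'M[C]_n) : rdot D (A + B) = rdot D A + rdot D B.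
Proof. by rewrite rdotC rdotDl !(rdotC D). Qed.

Lemma rdotZr n (t : R) (A B : 'M[C]_n) : rdot B (t%:C%C *: A) = t * rdot B A.
Proof. by rewrite rdotC rdotZl rdotC. Qed.

Lemma rdotBr n (A B D : 'M[C]_n) : rdot D (A - B) = rdot D A - rdot D B.
Proof. by apply: (addIr (rdot D B)); rewrite -rdotDr !subrK. Qed.

Lemma rdot0r n (D : 'M[C]_n) : rdot D 0 = 0.
Proof. by apply: (addIr (rdot D 0)); rewrite -rdotDr !add0r. Qed.

Lemma rdot_sumr n (I : Type) (r : seq I) (P : pred I) (F : I -> 'M[C]_n) D :
  rdot D (\sum_(i <- r | P i) F i) = \sum_(i <- r | P i) rdot D (F i).
Proof. by apply: (big_morph (rdot D)); [move=> A B; rewrite rdotDr|rewrite rdot0r]. Qed.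

Lemma rdotE n (A : 'M[C]_n) : rdot A A = \sum_i \sum_j nrm (A i j) ^+ 2.
Proof. by apply: eq_bigr => i _; apply: eq_bigr => j _; rewrite mulC_nrm. Qed.

Lemma rdot_ge0 n (A : 'M[C]_n) : 0 <= rdot A A.
Proof.
by rewrite rdotE sumr_ge0// => i _; rewrite sumr_ge0// => j _; rewrite sqr_ge0.
Qed.

Definition outer n (z : 'cV[C]_n) : 'M[C]_n := z *m z ^t*.

Lemma outerE n (z : 'cV[C]_n) i j : outer z i j = z i 0 * (z j 0)^*.
Proof. by rewrite !mxE big_ord1 !mxE. Qed.

Lemma outerZ n (t : R) (z : 'cV[C]_n) : 0 <= t ->
  outer ((Num.sqrt t)%:C%C *: z) = t%:C%C *: outer z.
Proof.
move=> t0; apply/matrixP => i j; rewrite outerE [RHS]mxE outerE !mxE rmorphM /=.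
rewrite conj_real_complex mulrACA.
by rewrite -rmorphM -expr2 sqr_sqrtr.
Qed.

Lemma outer_hermitian n (z : 'cV[C]_n) : (outer z) ^t* = outer z.
Proof. by rewrite tr_mulC tr_C_K. Qed.

Definition sqn n (z : 'cV[C]_n) : R := \sum_i nrm (z i 0) ^+ 2.

Lemma sqn_ge0 n (z : 'cV[C]_n) : 0 <= sqn z.
Proof. by rewrite sumr_ge0// => i _; rewrite sqr_ge0. Qed.

Lemma sqn_eq0 n (z : 'cV[C]_n) : sqn z = 0 -> z = 0.
Proof.
move=> /eqP; rewrite psumr_eq0 => [/allP z0|i _]; last by rewrite sqr_ge0.
apply/colP => i; rewrite mxE; apply: nrm0_eq0.
by have := z0 i (mem_index_enum _); rewrite implyTb sqrf_eq0 => /eqP.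
Qed.

(** For hermitian [L] this is [z^* L z] ([hform_entry]), so a functional on matrices, evaluated on
    squares, is a quadratic form. *)
Definition hform n (L : 'M[C]_n) (z : 'cV[C]_n) : R := rdot L (outer z).

Lemma hform1 n (z : 'cV[C]_n) : hform 1%:M z = sqn z.
Proof.
apply: eq_bigr => i _; rewrite (bigD1 i)//= big1 => [|j ji].
  by rewrite outerE !mxE eqxx rmorph1 mul1r addr0 mulrC mulC_nrm.
by rewrite !mxE eq_sym (negPf ji) rmorph0 mul0r.
Qed.

Lemma hform_mulC n (Q : 'M[C]_n) (z : 'cV[C]_n) : hform (Q ^t* *m Q) z = sqn (Q *m z).
Proof.
rewrite /hform /rdot /sqn.
under [RHS]eq_bigr do rewrite -[nrm _ ^+ 2]/(complex.Re (nrm _ ^+ 2)%:C%C) -mulC_nrm mxE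
   rmorph_sum mulr_suml Re_sum.
rewrite [RHS]exchange_big /=; apply: eq_bigr => i _.
under [RHS]eq_bigr do rewrite mulr_sumr Re_sum.
rewrite [RHS]exchange_big /=; apply: eq_bigr => j _.
rewrite -Re_sum outerE mxE rmorph_sum mulr_suml -Re_conj; congr complex.Re.
rewrite rmorph_sum; apply: eq_bigr => k _.
by rewrite !mxE !rmorphM /= !conjCK; ring.
Qed.

Lemma hform_entry n (L : 'M[C]_n) (z : 'cV[C]_n) : L ^t* = L ->
  (z ^t* *m L *m z) 0 0 = (hform L z)%:C%C.
Proof.
move=> Lh; have E : (z ^t* *m L *m z) 0 0 = \sum_i \sum_j (L i j)^* * outer z i j.
  rewrite mxE; apply: eq_bigr => i _; rewrite mxE mulr_suml; apply: eq_bigr => j _.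
  rewrite outerE !mxE -{1}Lh !mxE; ring.
have Hr : ((z ^t* *m L *m z) ^t*) = z ^t* *m L *m z.
  by rewrite !tr_mulC tr_C_K Lh mulmxA.
have : ((z ^t* *m L *m z) 0 0)^* = (z ^t* *m L *m z) 0 0.
  by rewrite -{2}Hr !mxE.
move=> /CrealP/RRe_real <-; congr (_%:C)%C; rewrite E Re_sum.
by apply: eq_bigr => i _; rewrite Re_sum.
Qed.

(** From [|z_i z_j| <= (|z_i|^2 + |z_j|^2) / 2], summed over all pairs. *)
Lemma hform_bound n (E : 'M[C]_n) (e : R) (z : 'cV[C]_n) :
  (forall i j, nrm (E i j) <= e) -> - (e * n%:R * sqn z) <= hform E z.
Proof.
move=> Ee; rewrite lerNl /hform /rdot -sumrN.
have -> : e * n%:R * sqn z = \sum_i \sum_j e * ((nrm (z i 0) ^+ 2 + nrm (z j 0) ^+ 2) / 2).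
  under eq_bigr do rewrite -mulr_sumr -mulr_suml big_split /= sumr_const card_ord -/(sqn z).
  rewrite -mulr_sumr -mulr_suml big_split /= sumr_const card_ord sumrMnl -/(sqn z).
  by rewrite -[_ *+ n]mulr_natr; field.
apply: ler_sum => i _; rewrite -sumrN; apply: ler_sum => j _.
apply: le_trans (_ : nrm ((E i j)^* * outer z i j) <= _).
  by apply: le_trans (Re_le_nrm _); rewrite -normrN ler_norm.
rewrite nrmM nrm_conj outerE nrmM nrm_conj.
apply: ler_pM; rewrite ?mulr_ge0 ?nrm_ge0//.
have := sqr_ge0 (nrm (z i 0) - nrm (z j 0)); lra.
Qed.

End HermitianForms.

Section Cone.
Variable R : realType.
Local Notation C := R[i].
Variables (n I J : nat) (D : 'I_I -> 'I_J -> 'M[C]_n) (r : R).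
Implicit Types (v : 'I_J -> 'cV[C]_n) (z : 'cV[C]_n).

Definition defect v : 'M[C]_n :=
  (r ^+ 2)%:C%C *: (\sum_j outer (v j)) - \sum_i outer (\sum_j D i j *m v j).

Definition defect_cone (c : 'M[C]_n) : Prop :=
  exists (Y : seq ('I_J -> 'cV[C]_n)) (Z : seq 'cV[C]_n),
    c = \sum_(v <- Y) defect v + \sum_(z <- Z) outer z.

Lemma defect_cone_ind (P : 'M[C]_n -> Prop) :
  P 0 -> (forall a b, P a -> P b -> P (a + b)) ->
  (forall v, P (defect v)) -> (forall z, P (outer z)) ->
  forall c, defect_cone c -> P c.
Proof.
move=> P0 PD Pd Po c [Y [Z ->]]; apply: (PD).
  by elim/big_ind: _ => [|a b|v _]; [exact: P0|exact: PD|exact: Pd].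
by elim/big_ind: _ => [|a b|v _]; [exact: P0|exact: PD|exact: Po].
Qed.

Lemma defect_cone0 : defect_cone 0.
Proof. by exists [::], [::]; rewrite !big_nil addr0. Qed.

Lemma defect_coneD a b : defect_cone a -> defect_cone b -> defect_cone (a + b).
Proof.
move=> [Y [Z ->]] [Y' [Z' ->]]; exists (Y ++ Y'), (Z ++ Z').
by rewrite !big_cat /= addrACA.
Qed.

Lemma defect_cone_defect v : defect_cone (defect v).
Proof. by exists [:: v], [::]; rewrite big_seq1 big_nil addr0. Qed.

Lemma defect_cone_outer z : defect_cone (outer z).
Proof. by exists [::], [:: z]; rewrite big_seq1 big_nil add0r. Qed.

(** A nonnegative factor is absorbed into the vectors as its square root, which is why the cone
    consists of plain sums. *)
Lemma defectZ (t : R) v : 0 <= t ->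
  defect (fun j => (Num.sqrt t)%:C%C *: v j) = t%:C%C *: defect v.
Proof.
move=> t0; rewrite /defect scalerBr.
have -> : \sum_j outer ((Num.sqrt t)%:C%C *: v j) = t%:C%C *: \sum_j outer (v j).
  by rewrite scaler_sumr; apply: eq_bigr => j _; rewrite outerZ.
rewrite !scalerA [t%:C%C * _]mulrC; congr (_ - _).
rewrite scaler_sumr; apply: eq_bigr => i _; rewrite -outerZ//; congr outer.
by rewrite scaler_sumr; apply: eq_bigr => j _; rewrite scalemxAr.
Qed.

Lemma defect_coneZ (t : R) c : 0 <= t -> defect_cone c -> defect_cone (t%:C%C *: c).
Proof.
move=> t0; elim/defect_cone_ind => {c} [|a b ca cb|v|z].
- by rewrite scaler0; apply: defect_cone0.
- by rewrite scalerDr; apply: defect_coneD.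
- by rewrite -defectZ//; apply: defect_cone_defect.
- by rewrite -outerZ//; apply: defect_cone_outer.
Qed.

Lemma tr_ZC m p (t : R) (A : 'M[C]_(m, p)) : (t%:C%C *: A) ^t* = t%:C%C *: A ^t*.
Proof. by apply/matrixP => i j; rewrite !mxE rmorphM /= conj_real_complex. Qed.

Lemma tr_sumC m p (K : Type) (s : seq K) (P : pred K) (F : K -> 'M[C]_(m, p)) :
  (\sum_(k <- s | P k) F k) ^t* = \sum_(k <- s | P k) (F k) ^t*.
Proof.
apply: (big_morph (fun A : 'M[C]_(m, p) => A ^t*)); first by move=> A B; rewrite tr_DC.
by rewrite trmx0 map_mx0.
Qed.

Lemma defect_cone_hermitian c : defect_cone c -> c ^t* = c.
Proof.
elim/defect_cone_ind => {c} [|a b ca cb|v|z].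
- by rewrite trmx0 map_mx0.
- by rewrite tr_DC ca cb.
- rewrite /defect tr_BC tr_ZC 2!tr_sumC.
  by under eq_bigr do rewrite outer_hermitian; under [X in _ - X]eq_bigr do rewrite outer_hermitian.
- exact: outer_hermitian.
Qed.

Lemma rdot_defect L v : rdot L (defect v) =
  r ^+ 2 * \sum_j hform L (v j) - \sum_i hform L (\sum_j D i j *m v j).
Proof. by rewrite rdotBr rdotZr !rdot_sumr. Qed.

Lemma nrm_outer_le z i j : nrm (outer z i j) <= sqn z.
Proof.
have le k : nrm (z k 0) ^+ 2 <= sqn z.
  by rewrite /sqn (bigD1 k)//= lerDl sumr_ge0// => l _; rewrite sqr_ge0.
rewrite outerE nrmM nrm_conj; have := le i; have := le j.
have := sqr_ge0 (nrm (z i 0) - nrm (z j 0)); lra.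
Qed.

Hypothesis Dsmall : forall v,
  \sum_i sqn (\sum_j D i j *m v j) <= r ^+ 2 / 2 * \sum_j sqn (v j).

(** By [Dsmall] a defect has entries at most [3/2 r^2 sum |v_j|^2] and trace at least
    [1/2 r^2 sum |v_j|^2]; their ratio is the constant 3. *)
Lemma defect_cone_entry c : defect_cone c ->
  forall i j, nrm (c i j) <= 3 * rdot 1%:M c.
Proof.
elim/defect_cone_ind => {c} [i j|a b ca cb i j|v i j|z i j].
- by rewrite rdot0r mulr0 mxE nrm0.
- rewrite mxE rdotDr mulrDr; apply: le_trans (ler_nrmD _ _) _; exact: lerD.
- rewrite rdot_defect; under eq_bigr do rewrite hform1.
  under [X in _ <= 3 * (_ - X)]eq_bigr do rewrite hform1.
  rewrite !mxE !summxE; apply: le_trans (ler_nrmD _ _) _.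
  rewrite nrmN nrmM nrm_real ger0_norm ?sqr_ge0//.
  have h1 : r ^+ 2 * nrm (\sum_k outer (v k) i j) <= r ^+ 2 * \sum_k sqn (v k).
    rewrite ler_wpM2l ?sqr_ge0//; apply: le_trans (ler_nrm_sum _ _ _) _.
    by apply: ler_sum => k _; apply: nrm_outer_le.
  have h2 : nrm (\sum_k outer (\sum_l D k l *m v l) i j) <=
      \sum_k sqn (\sum_l D k l *m v l).
    apply: le_trans (ler_nrm_sum _ _ _) _.
    by apply: ler_sum => k _; apply: nrm_outer_le.
  have := Dsmall v; lra.
- have := nrm_outer_le z i j; have := sqn_ge0 z.
  rewrite -/(hform _ _) hform1; lra.
Qed.

(* Either [h] is approximately a sum of defects and squares, or a new inner
   product [<Q u, Q v>] makes [D] a contraction and [h] negative. *)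
Lemma defect_cone_alternative (h : 'M[C]_n) (e : R) : h ^t* = h -> 0 < e ->
  defect_cone (h + e%:C%C%:M) \/
  exists2 Q : 'M[C]_n, Q \in unitmx &
    (forall v, \sum_i sqn (Q *m \sum_j D i j *m v j) <= r ^+ 2 * \sum_j sqn (Q *m v j)) /\
    rdot (Q ^t* *m Q) h < 0.
Proof.
(* All entries of a cone element are at most 3 times its trace, so its Hilbert-Schmidt norm is at
   most [3 n] times the trace; [L0] dominates this. *)
move=> hh e0; pose L0 : 'M[C]_n := (3 * n.+1%:R)%:C%C *: 1%:M.
have L0E c : rdot L0 c = n.+1%:R * (3 * rdot 1%:M c) by rewrite rdotZl; ring.
have coneL c : defect_cone c -> 0 <= rdot L0 c /\ rdot c c <= rdot L0 c ^+ 2.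
  move=> cc; have ce := defect_cone_entry cc; rewrite L0E.
  case: (posnP n) => [n0|n0].
    have noord (i : 'I_n) : False by case: i => i /=; rewrite n0.
    rewrite /rdot !big1 ?mulr0 ?expr0n// => i _; by case: (noord i).
  have t0 : 0 <= 3 * rdot 1%:M c := le_trans (nrm_ge0 _) (ce (Ordinal n0) (Ordinal n0)).
  split; first by rewrite mulr_ge0.
  rewrite rdotE; apply: (@le_trans _ _ (\sum_(i < n) \sum_(j < n) (3 * rdot 1%:M c) ^+ 2)).
    apply: ler_sum => i _; apply: ler_sum => j _.
    by rewrite lerXn2r ?nnegrE ?nrm_ge0.
  move: (3 * rdot 1%:M c) => a.
  rewrite !sumr_const !card_ord -mulrnA -[leLHS]mulr_natl exprMn ler_wpM2r ?sqr_ge0//.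
  by rewrite -natrX ler_nat -mulnn leq_mul.
have [near|[c [gamma [eta [cc eta0 Lpos Lneg]]]]] := @approx_separation _ _ (@rdot R n)
    defect_cone L0 h (@rdotDl R n) (@rdotC R n) (@rdotZl R n) (@rdot_ge0 R n)
    defect_cone0 defect_coneD defect_coneZ coneL.
(* Entries of [E = h - c] of size [e'] change a quadratic form by at most [e' n < e]. So [E + e] is
   positive definite, and [h + e] is [c] plus a sum of squares. *)
- left; pose e' := e / (2 * n.+1%:R).
  have e'0 : 0 < e' by rewrite divr_gt0// mulr_gt0.
  have [c [cc cE]] := near _ (exprn_gt0 2 e'0).
  pose E := h - c.
  have Eh : E ^t* = E by rewrite tr_BC hh (defect_cone_hermitian cc).
  have Ee i j : nrm (E i j) <= e'.
    rewrite -ler_sqr ?nnegrE ?nrm_ge0 ?(ltW e'0)//; apply: le_trans (ltW cE).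
    rewrite rdotE (bigD1 i)//= (bigD1 j)//= -addrA /E.
    have -> : nrm ((h - c) i j) = nrm ((c - h) i j) by rewrite -nrmN !mxE opprB.
    rewrite lerDl addr_ge0// sumr_ge0// => k _; first by rewrite sqr_ge0.
    by rewrite sumr_ge0// => l _; rewrite sqr_ge0.
  have Eeh : (E + e%:C%C%:M) ^t* = E + e%:C%C%:M.
    by rewrite tr_DC Eh tr_scalar_mx map_scalar_mx /= conj_real_complex.
  have [z z0|Q _ QE] := positive_factor Eeh.
    rewrite hform_entry// ltcR /hform rdotDl -scalemx1 rdotZl -/(hform E z) -/(hform 1%:M z) hform1.
    have sz : 0 < sqn z.
      rewrite lt_def sqn_ge0 andbT; apply: contra z0 => /eqP/sqn_eq0 ->.
      by rewrite eqxx.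
    have H := hform_bound z Ee; apply: lt_le_trans (lerD H (lexx _)).
    rewrite addrC -mulrBl mulr_gt0// subr_gt0 /e'.
    have -> : e / (2 * n.+1%:R) * n%:R = e * (n%:R / (2 * n.+1%:R)) by ring.
    rewrite gtr_pMr// ltr_pdivrMr ?mulr_gt0// mul1r -natrM ltr_nat.
    by rewrite mul2n -addnn ltn_addl.
  have -> : h + e%:C%C%:M = c + Q ^t* *m Q.
    by rewrite -QE /E addrA [c + _]addrC subrK.
  apply: defect_coneD => //.
  have -> : Q ^t* *m Q = \sum_k outer (col k (Q ^t*)).
    apply/matrixP => i j; rewrite mxE summxE; apply: eq_bigr => k _.
    by rewrite outerE !mxE conjCK.
  elim/big_ind: _ => [||k _]; [exact: defect_cone0|exact: defect_coneD|].
  exact: defect_cone_outer.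
(* Strict positivity on the squares [outer z] makes [L] positive definite, hence [L = Q^* Q];
   nonnegativity on defects is contractivity for the inner product of [L]. *)
- right; set L := c - h + gamma%:C%C *: L0 in Lpos Lneg.
  have Lh : L ^t* = L.
    rewrite /L tr_DC tr_BC hh (defect_cone_hermitian cc) !tr_ZC tr_1C; by [].
  have [z z0|Q Qu LE] := positive_factor Lh.
    rewrite hform_entry// ltcR; apply: lt_le_trans (Lpos _ (defect_cone_outer z)).
    rewrite L0E -/(hform _ _) hform1 !mulr_gt0// lt_def sqn_ge0 andbT.
    by apply: contra z0 => /eqP/sqn_eq0 ->; rewrite eqxx.
  exists Q => //; split; last by rewrite -LE.
  have hE u : hform L u = sqn (Q *m u) by rewrite LE hform_mulC.
  move=> v; have [Lv _] := coneL _ (defect_cone_defect v).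
  have := le_trans (mulr_ge0 (ltW eta0) Lv) (Lpos _ (defect_cone_defect v)).
  rewrite rdot_defect subr_ge0 (eq_bigr _ (fun i _ => hE _)).
  by rewrite (eq_bigr _ (fun j _ => hE (v j))).
Qed.

End Cone.

(** * Matrix points, decomposition and transfer function *)

Section OperatorNorms.
Variable R : realType.
Local Notation C := R[i].

Lemma sqr_l2norm_col n (v : 'cV[C]_n) : l2norm (fun k => nrm (v k 0)) ^+ 2 = sqn v.
Proof. by rewrite sqr_l2norm. Qed.

Lemma sqn0 n : sqn (0 : 'cV[C]_n) = 0.
Proof. by rewrite /sqn big1// => i _; rewrite mxE nrm0 expr0n. Qed.

Lemma sqnZ n (t : R) (v : 'cV[C]_n) : sqn (t%:C%C *: v) = t ^+ 2 * sqn v.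
Proof.
rewrite mulr_sumr; apply: eq_bigr => i _.
by rewrite mxE nrmM nrm_real exprMn real_normK// num_real.
Qed.

Lemma mx_opnorm_le p q (A : 'M[C]_(p, q)) (c : R) : 0 <= c ->
  (mx_opnorm A <= c%:E)%E <-> forall v, sqn (A *m v) <= c ^+ 2 * sqn v.
Proof.
move=> c0; split=> [Ac v|Ac].
  have [v0|v0] := eqVneq (sqn v) 0.
    by rewrite (sqn_eq0 v0) mulmx0 !sqn0 mulr0.
  have sv : 0 < sqn v by rewrite lt_def v0 sqn_ge0.
  pose t := (Num.sqrt (sqn v))^-1.
  have t2 : t ^+ 2 = (sqn v)^-1 by rewrite exprVn sqr_sqrtr// ltW.
  have : ((l2norm (fun k => nrm ((A *m (t%:C%C *: v)) k 0)))%:E <= c%:E)%E.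
    apply: le_trans Ac; apply: ereal_sup_ubound; exists (t%:C%C *: v) => //=.
    rewrite -(@expr_le1 _ 2)// ?l2norm_ge0// sqr_l2norm_col sqnZ t2 mulVf//.
  rewrite lee_fin -ler_sqr ?nnegrE ?l2norm_ge0// sqr_l2norm_col -scalemxAr sqnZ t2.
  by rewrite ler_pdivrMl// mulrC.
apply: ge_ereal_sup => _ [v v1 <-]; rewrite lee_fin -ler_sqr ?nnegrE ?l2norm_ge0//.
rewrite sqr_l2norm_col; apply: le_trans (Ac v) _.
by rewrite ler_piMr ?sqr_ge0// -sqr_l2norm_col exprn_ile1 ?l2norm_ge0.
Qed.

Variable d : nat.

Lemma eval_mx_entry I J n (P : 'M[free_poly R d]_(I, J)) (x : 'I_d -> 'M[C]_n.+1) a i b j :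
  eval_mx P x (mxtens_index (a, i)) (mxtens_index (b, j)) =
  free_eval (@scalar_mx C n.+1) x (P i j) a b.
Proof.
rewrite summxE (bigD1 i)//= [X in _ + X]big1 => [|i' i'i].
  rewrite addr0 summxE (bigD1 j)//= [X in _ + X]big1 => [|j' j'j].
    by rewrite addr0 tensmxE !mxE !eqxx mulr1.
  by rewrite tensmxE !mxE [j == _]eq_sym (negPf j'j) andbF mulr0.
rewrite summxE big1// => j' _.
by rewrite tensmxE !mxE [i == _]eq_sym (negPf i'i) mulr0.
Qed.

Lemma eval_mx_opnorm_le I J n (P : 'M[free_poly R d]_(I, J)) (x : 'I_d -> 'M[C]_n.+1)
    (c : R) : 0 <= c ->
  (mx_opnorm (eval_mx P x) <= c%:E)%E <->
  forall u : 'I_J -> 'cV[C]_n.+1,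
    \sum_i sqn (\sum_j free_eval (@scalar_mx C n.+1) x (P i j) *m u j) <=
    c ^+ 2 * \sum_j sqn (u j).
Proof.
move=> c0; pose glue (u : 'I_J -> 'cV[C]_n.+1) : 'cV[C]_(n.+1 * J) :=
  \col_k u (mxtens_unindex k).2 (mxtens_unindex k).1 0.
have sqn_glue u : sqn (glue u) = \sum_j sqn (u j).
  rewrite /sqn sum_mxtens exchange_big; apply: eq_bigr => j _; apply: eq_bigr => b _ /=.
  by rewrite mxE mxtens_indexK.
have mul_glue u : sqn (eval_mx P x *m glue u) =
    \sum_i sqn (\sum_j free_eval (@scalar_mx C n.+1) x (P i j) *m u j).
  rewrite /sqn sum_mxtens exchange_big; apply: eq_bigr => i _; apply: eq_bigr => a _ /=.
  congr (nrm _ ^+ 2); rewrite mxE sum_mxtens exchange_big summxE; apply: eq_bigr => j _ /=.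
  by rewrite mxE; apply: eq_bigr => b _; rewrite eval_mx_entry mxE mxtens_indexK.
rewrite mx_opnorm_le//; split=> H u; first by rewrite -mul_glue -sqn_glue.
have -> : u = glue (fun j => \col_b u (mxtens_index (b, j)) 0).
  by apply/colP => k; rewrite !mxE -{1}(mxtens_unindexK k); case: mxtens_unindex.
by rewrite mul_glue sqn_glue.
Qed.

End OperatorNorms.

Section AglerDecomposition.
Variables (R : realType) (d : nat).
Local Notation C := R[i].

Lemma sum_outer_hermitian n p (f : 'I_p -> 'cV[C]_n) :
  (\sum_i outer (f i)) ^t* = \sum_i outer (f i).
Proof. by rewrite tr_sumC; apply: eq_bigr => i _; rewrite outer_hermitian. Qed.

(** In the second alternative, conjugating by [Q] turns the new inner product into the standard one:
    [y = Q x Q^-1] is a genuine matrix point with [|delta(y)| <= r1]. As [r1 < r], it satisfies the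
    strict inequality of [Gset], and [|P(y)| <= M] contradicts negativity. *)
Lemma agler_decomposition n (x : 'I_d -> 'M[C]_n.+1) I J I' J'
    (delta : 'M[free_poly R d]_(I, J)) (P : 'M[free_poly R d]_(I', J'))
    (e : 'I_J' -> 'cV[C]_n.+1) (r1 r M eps : R) :
  0 < r1 < r -> 0 <= M -> 0 < eps ->
  (forall y, Gset delta r y -> (mx_opnorm (eval_mx P (projT2 y)) <= M%:E)%E) ->
  let ev := free_eval (@scalar_mx C n.+1) x in
  (forall v : 'I_J -> 'cV[C]_n.+1,
    \sum_i sqn (\sum_j ev (delta i j) *m v j) <= r1 ^+ 2 / 2 * \sum_j sqn (v j)) ->
  defect_cone (fun i j => ev (delta i j)) r1
    ((M ^+ 2)%:C%C *: (\sum_l outer (e l)) -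
     \sum_i outer (\sum_l ev (P i l) *m e l) + eps%:C%C%:M).
Proof.
move=> /andP[r10 r1r] M0 eps0 PM ev small.
set h := _ - _.
have hh : h ^t* = h.
  by rewrite /h tr_BC tr_ZC !sum_outer_hermitian.
have [//|[Q Qu [Qc Qneg]]] := defect_cone_alternative small hh eps0.
pose y k := Q *m x k *m invmx Q.
have evy p : free_eval (@scalar_mx C n.+1) y p = Q *m ev p *m invmx Q.
  symmetry; apply: (@free_eval_morph _ _ _ _ _ _ _ (fun A => Q *m A *m invmx Q)).
  - by move=> A B; rewrite mulmxDr mulmxDl.
  - by move=> A B; rewrite -!mulmxE !mulmxA mulmxKV.
  - by rewrite mulmx1 mulmxV.
  - by move=> a; rewrite scalar_mxC mulmxK.
have Gy : Gset delta r (existT _ n y).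
  apply: (@le_lt_trans _ _ r1%:E); last by rewrite lte_fin.
  apply/eval_mx_opnorm_le; first exact: ltW.
  move=> u; have := Qc (fun j => invmx Q *m u j).
  under [X in _ <= _ * X]eq_bigr do rewrite mulKVmx//.
  apply: le_trans; rewrite le_eqVlt; apply/orP; left; apply/eqP.
  apply: eq_bigr => i _; rewrite mulmx_sumr; congr sqn; apply: eq_bigr => j _.
  by rewrite evy !mulmxA.
have /eval_mx_opnorm_le - /(_ M0 (fun l => Q *m e l)) := PM _ Gy.
move: Qneg; rewrite /h rdotBr rdotZr !rdot_sumr subr_lt0 => neg pos.
have := lt_le_trans neg; have {}pos : \sum_i rdot (Q ^t* *m Q) (outer (\sum_l ev (P i l) *m e l)) <=
    M ^+ 2 * \sum_l rdot (Q ^t* *m Q) (outer (e l)).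
  rewrite (eq_bigr (fun l => sqn (Q *m e l)) (fun l _ => hform_mulC Q (e l))).
  apply: le_trans pos; rewrite le_eqVlt; apply/orP; left; apply/eqP.
  apply: eq_bigr => i _; rewrite -/(hform _ _) hform_mulC mulmx_sumr; congr sqn.
  by apply: eq_bigr => l _; rewrite evy !mulmxA mulmxKV.
by move=> /(_ _ pos); rewrite ltxx.
Qed.

Definition rowsof (n p : nat) (f : 'I_p -> 'cV[C]_n) : 'M[C]_(p, n) :=
  \matrix_(b, a) f b a 0.

(** The sum of [outer] over the rows. Vectors are stored as rows so that scalar matrices act from
    the left on the index of the family. *)
Definition gram (n p : nat) (F : 'M[C]_(p, n)) : 'M[C]_n := F^T *m (F^T) ^t*.

Lemma gram_rowsof n p (f : 'I_p -> 'cV[C]_n) : gram (rowsof f) = \sum_b outer (f b).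
Proof.
apply/matrixP => i j; rewrite mxE summxE; apply: eq_bigr => b _.
by rewrite outerE !mxE.
Qed.

Lemma gram_col n p q (F : 'M[C]_(p, n)) (G : 'M[C]_(q, n)) :
  gram (col_mx F G) = gram F + gram G.
Proof. by rewrite /gram tr_col_mx tr_row_mx map_col_mx mul_row_col. Qed.

Lemma gramZ n p (t : R) (F : 'M[C]_(p, n)) : gram (t%:C%C *: F) = (t ^+ 2)%:C%C *: gram F.
Proof.
rewrite /gram linearZ tr_ZC -scalemxAl -scalemxAr scalerA -rmorphM -expr2.
by [].
Qed.

Lemma gram1 n : gram (1%:M : 'M[C]_n) = 1%:M.
Proof. by rewrite /gram trmx1 tr_1C mulmx1. Qed.

Lemma gram_eq n p q (F : 'M[C]_(p, n)) (G : 'M[C]_(q, n)) : gram F = gram G ->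
  exists2 U, contraction U & F = U *m G.
Proof.
move=> FG; apply: lurking_isometry; apply: trmx_inj.
have gE m (H : 'M[C]_(m, n)) : (H ^t* *m H)^T = gram H.
  by rewrite trmx_mul /gram map_trmx.
by rewrite !gE.
Qed.

Lemma sum_mxtens_nth n m J (Y : seq ('I_J -> 'cV[C]_n)) v0 (F : 'cV[C]_n -> 'M[C]_n) :
  size Y = m ->
  \sum_(v <- Y) \sum_j F (v j) =
  \sum_(b < J * m) F (nth v0 Y (mxtens_unindex b).2 (mxtens_unindex b).1).
Proof.
move=> <-; rewrite sum_mxtens [RHS]exchange_big (big_nth v0) big_mkord.
by apply: eq_bigr => k _; apply: eq_bigr => j _; rewrite mxtens_indexK.
Qed.

(** Moving negative terms across gives an equality of Gram matrices: [f], [r v] and the squares [z]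
    on one side, [M e], [sqrt eps] times the identity and [D v] on the other. The isometry argument
    yields a contraction, and deleting the rows of [z] keeps it one. *)
Lemma transfer_function n I J I' J' (D : 'I_I -> 'I_J -> 'M[C]_n)
    (e : 'I_J' -> 'cV[C]_n) (f : 'I_I' -> 'cV[C]_n) (r M eps : R) : 0 <= eps ->
  defect_cone D r ((M ^+ 2)%:C%C *: (\sum_l outer (e l)) - \sum_i outer (f i) +
    eps%:C%C%:M) ->
  exists m (v : 'I_(J * m) -> 'cV[C]_n)
    (U : 'M[C]_(I' + J * m, (J' + n) + I * m)), contraction U /\
  col_mx (rowsof f) (r%:C%C *: rowsof v) =
  U *m col_mx (col_mx (M%:C%C *: rowsof e) ((Num.sqrt eps)%:C%C *: 1%:M))
    (rowsof (fun b => \sum_j D (mxtens_unindex b).1 j *m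
      v (mxtens_index (j, (mxtens_unindex b).2)))).
Proof.
move=> eps0 [Y [Z YZ]]; pose m := size Y; pose v0 : 'I_J -> 'cV[C]_n := fun=> 0.
pose v (b : 'I_(J * m)) := nth v0 Y (mxtens_unindex b).2 (mxtens_unindex b).1.
pose w (b : 'I_(I * m)) := \sum_j D (mxtens_unindex b).1 j *m
      v (mxtens_index (j, (mxtens_unindex b).2)).
pose z (k : 'I_(size Z)) := nth 0 Z k.
exists m, v.
have Yv : \sum_(y <- Y) \sum_j outer (y j) = gram (rowsof v).
  by rewrite gram_rowsof (sum_mxtens_nth v0 _ (erefl m)).
have Yw : \sum_(y <- Y) \sum_i outer (\sum_j D i j *m y j) = gram (rowsof w).
  rewrite gram_rowsof (big_nth v0) big_mkord sum_mxtens exchange_big.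
  apply: eq_bigr => k _; apply: eq_bigr => i _.
  rewrite /w mxtens_indexK; congr outer; apply: eq_bigr => j _.
  by rewrite /v mxtens_indexK.
have Zz : \sum_(y <- Z) outer y = gram (rowsof z).
  by rewrite gram_rowsof (big_nth 0) big_mkord.
move: YZ; rewrite /defect sumrB -scaler_sumr Yv Yw Zz => YZ.
pose A := col_mx (col_mx (rowsof f) (r%:C%C *: rowsof v)) (rowsof z).
pose B := col_mx (col_mx (M%:C%C *: rowsof e) ((Num.sqrt eps)%:C%C *: 1%:M)) (rowsof w).
have AB : gram A = gram B.
  rewrite /A /B !gram_col !gramZ !gram_rowsof gram1 sqr_sqrtr// scalemx1.
  rewrite -gram_rowsof -[\sum_b outer (z b)]gram_rowsof -[\sum_b outer (w b)]gram_rowsof.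
  have -> : (M ^+ 2)%:C%C *: \sum_b outer (e b) + eps%:C%C%:M =
     (r ^+ 2)%:C%C *: gram (rowsof v) - gram (rowsof w) + gram (rowsof z) + \sum_i outer (f i).
    by rewrite -YZ -!addrA [_%:M + _]addrC !addrA subrK.
  rewrite -!gram_rowsof.
  move: (gram (rowsof f)) (gram (rowsof v)) (gram (rowsof w)) (gram (rowsof z)).
  by move=> g1 g2 g3 g4; apply/matrixP => i j; rewrite !mxE; ring.
have [U Uc AE] := gram_eq AB.
exists (row_mx 1%:M 0 *m U); split; first exact/contractionM/Uc/contraction_row.
by rewrite -mulmxA -AE /A mul_row_col mul1mx mul0mx addr0.
Qed.

End AglerDecomposition.

(** * The truncated shift model *)

Section EvaluationAtZero.
Variables (R : realType) (d : nat).
Local Notation C := R[i].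

Lemma size0_word (w : fmonom 'I_d) : size (fmonom_val w) = 0%N -> w = FMonom [::].
Proof. by move/size0nil => w0; rewrite -[w]fmK w0. Qed.

Lemma free_eval_zero (A : pzRingType) (c : C -> A) (x : 'I_d -> A) (p : free_poly R d) :
  (forall a b, c (a + b) = c a + c b) -> (forall k, x k = 0) ->
  free_eval c x p = c (mcoeff (FMonom [::]) p).
Proof.
move=> cD x0; have c0 : c 0 = 0 by apply: (addrI (c 0)); rewrite -cD !addr0.
elim/poly_ind: p => [|p q IHp IHq|w a].
- by rewrite free_eval0 mcoeff0 c0.
- by rewrite free_evalD// mcoeffD cD IHp IHq.
rewrite free_eval_monomial// coef_monomial; case: w => [|k w] /=.
  by rewrite big_nil mulr1 mulr1n.
by rewrite big_cons x0 mul0r mulr0 mulr0n c0.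
Qed.

Lemma ordge1P (p : free_poly R d) : mcoeff (FMonom [::]) p = 0 -> ordge 1 p.
Proof. by move=> p0 w; rewrite ltnS leqn0 => /eqP/size0_word ->. Qed.

End EvaluationAtZero.

Section EntrySum.
Variables (R : realType) (n : nat).
Local Notation C := R[i].

(** An easily handled submultiplicative norm; the identity has norm [n]. *)
Definition entry_sum (A : 'M[C]_n) (M : R) : Prop := \sum_i \sum_j nrm (A i j) <= M.

Lemma entry_sum_ge0 A M : entry_sum A M -> 0 <= M.
Proof.
by apply: le_trans; rewrite sumr_ge0// => i _; rewrite sumr_ge0// => j _; rewrite nrm_ge0.
Qed.

Lemma entry_sumD A B M N : entry_sum A M -> entry_sum B N -> entry_sum (A + B) (M + N).
Proof.
move=> AM BN; apply: le_trans (lerD AM BN); rewrite -big_split.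
apply: ler_sum => i _; rewrite -big_split; apply: ler_sum => j _.
by rewrite mxE ler_nrmD.
Qed.

Lemma entry_sumM A B M N : entry_sum A M -> entry_sum B N -> entry_sum (A *m B) (M * N).
Proof.
move=> AM BN; have s0 (D : 'M[C]_n) : 0 <= \sum_i \sum_j nrm (D i j).
  by rewrite sumr_ge0// => i _; rewrite sumr_ge0// => j _; rewrite nrm_ge0.
apply: le_trans (ler_pM (s0 A) (s0 B) AM BN); rewrite mulr_suml.
apply: ler_sum => i _; rewrite mulr_suml.
apply: (@le_trans _ _ (\sum_j \sum_k nrm (A i k) * nrm (B k j))).
  apply: ler_sum => j _; rewrite mxE; apply: le_trans (ler_nrm_sum _ _ _) _.
  by apply: ler_sum => k _; rewrite nrmM.
rewrite exchange_big; apply: ler_sum => k _ /=; rewrite -mulr_sumr.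
rewrite ler_wpM2l ?nrm_ge0// [leRHS](bigD1 k)//= lerDl sumr_ge0// => l _.
by rewrite sumr_ge0// => j _; rewrite nrm_ge0.
Qed.

Lemma entry_sum_scalar (a : C) : entry_sum (a%:M) (n%:R * nrm a).
Proof.
rewrite /entry_sum mulr_natl -[X in _ *+ X](card_ord n) -sumr_const.
apply: ler_sum => i _; rewrite (bigD1 i)//= big1 => [|j ji].
  by rewrite mxE eqxx mulr1n addr0.
by rewrite mxE eq_sym (negPf ji) nrm0.
Qed.

(** A crude constant depending on the dimensions is enough: the scaling of the shifts will beat
    it. *)
Lemma sqn_family_le p q (D : 'I_p -> 'I_q -> 'M[C]_n) (L : R) (v : 'I_q -> 'cV[C]_n) :
  (forall i j, entry_sum (D i j) L) ->
  \sum_i sqn (\sum_j D i j *m v j) <=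
  (p * n)%:R * (q%:R * L) ^+ 2 * \sum_j sqn (v j).
Proof.
move=> DL; pose s := Num.sqrt (\sum_j sqn (v j)).
have ss : 0 <= \sum_j sqn (v j) by rewrite sumr_ge0// => j _; rewrite sqn_ge0.
have vs j b : nrm (v j b 0) <= s.
  rewrite -ler_sqr ?nnegrE ?nrm_ge0 ?sqrtr_ge0// sqr_sqrtr//.
  rewrite (bigD1 j)//= {1}/sqn (bigD1 b)//= -addrA lerDl addr_ge0//.
    by rewrite sumr_ge0// => k _; rewrite sqr_ge0.
  by rewrite sumr_ge0// => k _; rewrite sqn_ge0.
have entry i a : nrm ((\sum_j D i j *m v j) a 0) <= q%:R * L * s.
  rewrite summxE; apply: le_trans (ler_nrm_sum _ _ _) _.
  have -> : q%:R * L * s = \sum_(j < q) L * s.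
    by rewrite sumr_const card_ord -mulrA mulr_natl.
  apply: ler_sum => j _; rewrite mxE; apply: le_trans (ler_nrm_sum _ _ _) _.
  apply: (@le_trans _ _ ((\sum_b nrm (D i j a b)) * s)).
    rewrite mulr_suml; apply: ler_sum => b _; rewrite nrmM ler_wpM2l ?nrm_ge0//.
  rewrite ler_wpM2r ?sqrtr_ge0//; apply: le_trans (DL i j).
  rewrite [leRHS](bigD1 a)//= lerDl sumr_ge0// => b _.
  by rewrite sumr_ge0// => l _; rewrite nrm_ge0.
have -> : (p * n)%:R * (q%:R * L) ^+ 2 * \sum_j sqn (v j) =
    \sum_(i < p) \sum_(a < n) (q%:R * L * s) ^+ 2.
  rewrite !sumr_const !card_ord -mulrnA -[RHS]mulr_natl [(n * p)%N]mulnC.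
  have s2 : s ^+ 2 = \sum_j sqn (v j) by rewrite sqr_sqrtr.
  by rewrite -s2; ring.
apply: ler_sum => i _; apply: ler_sum => a _.
by rewrite lerXn2r ?nnegrE ?nrm_ge0//; apply: le_trans (entry i a); apply: nrm_ge0.
Qed.

End EntrySum.

Lemma sub_mxE (V : zmodType) m n (A B : 'M[V]_(m, n)) i j :
  (A - B) i j = A i j - B i j.
Proof. by rewrite !mxE. Qed.

Section RowEvaluation.
Variables (R : realType) (d n J' : nat).
Local Notation C := R[i].
Local Notation poly := (free_poly R d).
Variables (x : 'I_d -> 'M[C]_n.+1) (e : 'I_J' -> 'cV[C]_n.+1).
Local Notation ev := (free_eval (@scalar_mx C n.+1) x).

Let sD (a b : C) : (a + b)%:M = a%:M + b%:M :> 'M[C]_n.+1.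
Proof. exact: raddfD. Qed.

Let sM (a b : C) : (a * b)%:M = a%:M * b%:M :> 'M[C]_n.+1.
Proof. exact: scalar_mxM. Qed.

Let sC (a : C) (A : 'M[C]_n.+1) : a%:M * A = A * a%:M.
Proof. by rewrite -!mulmxE scalar_mxC. Qed.

(** The vectors [(Q(x) e)_b] laid out as rows; left multiplication by a scalar matrix then commutes
    with evaluation ([eval_rows_const]). *)
Definition eval_rows p (Q : 'M[poly]_(p, J')) : 'M[C]_(p, n.+1) :=
  rowsof (fun b => \sum_l ev (Q b l) *m e l).

Lemma eval_rowsE p (Q : 'M[poly]_(p, J')) b a :
  eval_rows Q b a = \sum_l (ev (Q b l) *m e l) a 0.
Proof. by rewrite mxE summxE. Qed.

Lemma eval_rowsB p (P Q : 'M[poly]_(p, J')) :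
  eval_rows (P - Q) = eval_rows P - eval_rows Q.
Proof.
apply/matrixP => b a; transitivity (eval_rows P b a - eval_rows Q b a); last first.
  by symmetry; apply: sub_mxE.
apply: etrans (eval_rowsE (P - Q) b a) _.
apply: etrans _ (esym (congr2 (fun u v => u - v) (eval_rowsE P b a) (eval_rowsE Q b a))).
rewrite -sumrB.
apply: eq_bigr => l _; by rewrite sub_mxE free_evalB// mulmxBl sub_mxE.
Qed.

Lemma eval_rows_col p q (P : 'M[poly]_(p, J')) (Q : 'M[poly]_(q, J')) :
  eval_rows (col_mx P Q) = col_mx (eval_rows P) (eval_rows Q).
Proof.
apply/matrixP => b a; rewrite -[b]splitK; case: (fintype.split b) => k /=.
  rewrite col_mxEu (eval_rowsE P) (eval_rowsE (col_mx P Q)); apply: eq_bigr => l _.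
  by rewrite col_mxEu.
rewrite col_mxEd (eval_rowsE Q) (eval_rowsE (col_mx P Q)); apply: eq_bigr => l _.
by rewrite col_mxEd.
Qed.

Lemma eval_rows_const p q (U : 'M[C]_(p, q)) (Q : 'M[poly]_(q, J')) :
  eval_rows (const_poly_mx U *m Q) = U *m eval_rows Q.
Proof.
apply/matrixP => b a; rewrite eval_rowsE [RHS]mxE.
under [RHS]eq_bigr do rewrite eval_rowsE mulr_sumr.
rewrite [RHS]exchange_big; apply: eq_bigr => l _ /=.
rewrite [(_ *m Q) b l]mxE free_eval_sum// mulmx_suml summxE; apply: eq_bigr => k _.
rewrite free_evalM// [const_poly_mx U b k]mxE free_eval_monomial// big_nil mulr1.
by rewrite -mulmxE -mulmxA mul_scalar_mx [LHS]mxE.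
Qed.

Lemma eval_rows_ampliation m I J (delta : 'M[poly]_(I, J)) (Q : 'M[poly]_(J * m, J')) :
  eval_rows (ampliation m delta *m Q) =
  rowsof (fun b => \sum_j ev (delta (mxtens_unindex b).1 j) *m
    (row (mxtens_index (j, (mxtens_unindex b).2)) (eval_rows Q))^T).
Proof.
apply/matrixP => b a; rewrite eval_rowsE [RHS]mxE summxE.
transitivity (\sum_l \sum_j ((ev (delta (mxtens_unindex b).1 j) *m
    (ev (Q (mxtens_index (j, (mxtens_unindex b).2)) l) *m e l)) a 0)).
  apply: eq_bigr => l _; rewrite [(_ *m Q) b l]mxE sum_mxtens free_eval_sum// mulmx_suml summxE.
  apply: eq_bigr => j _; rewrite (bigD1 (mxtens_unindex b).2)//= big1 => [|k kb].
    rewrite addr0 [ampliation _ _ _ _]mxE mxtens_indexK eqxx mulr1n free_evalM//.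
    by rewrite -mulmxE mulmxA.
  rewrite [ampliation _ _ _ _]mxE mxtens_indexK /= eq_sym (negPf kb) mulr0n.
  exact: mul0r.
rewrite exchange_big; apply: eq_bigr => j _ /=.
rewrite -summxE -mulmx_sumr; congr ((_ *m _) _ _).
by apply/colP => a'; rewrite [RHS]mxE [RHS]mxE [RHS]mxE.
Qed.

End RowEvaluation.

Section ShiftModel.
Variables (R : realType) (d N J' : nat).
Local Notation C := R[i].
Local Notation poly := (free_poly R d).
Local Notation index := ({bseq N of 'I_d} * 'I_J')%type.

(** Matrix points have size [n.+1], and [0 < J'] makes the index set inhabited, by the empty
    word. *)
Lemma index_ordinal : (0 < J')%N ->
  exists n (ix : index -> 'I_n.+1) (g : 'I_n.+1 -> index), cancel ix g /\ cancel g ix.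
Proof.
move=> J0; have c0 : (0 < #|{: index}|)%N.
  by apply/card_gt0P; exists ([bseq], Ordinal J0).
exists #|{: index}|.-1.
exists (fun u => cast_ord (esym (prednK c0)) (enum_rank u)).
exists (fun i => enum_val (cast_ord (prednK c0) i)).
split=> u; first by rewrite cast_ordKV enum_rankK.
by rewrite enum_valK cast_ordK.
Qed.

Variables (n : nat) (ix : index -> 'I_n.+1) (g : 'I_n.+1 -> index).
Hypotheses (ixK : cancel ix g) (gK : cancel g ix).
Variable tau : R.

Definition shift (k : 'I_d) : 'M[C]_n.+1 :=
  \matrix_(a, b) (((g a).1 == k :: (g b).1 :> seq 'I_d) && ((g a).2 == (g b).2))%:R.

(** Zero for words longer than [N]: this is the truncation, and it lets [shift_word] hold for every
    word. *)
Definition word_vec (w : seq 'I_d) (l : 'I_J') : 'cV[C]_n.+1 :=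
  \col_a (((g a).1 == w :> seq 'I_d) && ((g a).2 == l))%:R.

Lemma shift_word k w l : shift k *m word_vec w l = word_vec (k :: w) l.
Proof.
apply/colP => a; rewrite !mxE.
have [wN|wN] := leqP (size w) N.
  pose b0 := ix (Bseq wN, l).
  rewrite (bigD1 b0)//= [X in _ + X]big1 => [|b bb0].
    by rewrite addr0 !mxE ixK /= !eqxx mulr1.
  rewrite [word_vec _ _ _ _]mxE; case: eqP => [bw|_]; last by rewrite mulr0.
  case: eqP => [bl|_]; last by rewrite mulr0.
  case/eqP: bb0; rewrite /b0 -[b]gK; congr ix.
  by case: (g b) bw bl => u v /= uw ->; congr pair; apply: val_inj.
rewrite big1 => [|b _].
  case: eqP => // aw; have := size_bseq (g a).1; rewrite aw /=.
  by rewrite leqNgt ltnS ltnW.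
rewrite [word_vec _ _ _ _]mxE; case: eqP => [bw|_]; last by rewrite mulr0.
by have := size_bseq (g b).1; rewrite bw leqNgt wN.
Qed.

Definition model_point (k : 'I_d) : 'M[C]_n.+1 := (tau%:C%C)%:M * shift k.
Local Notation ev := (free_eval (@scalar_mx C n.+1) model_point).
Definition model_vec (l : 'I_J') : 'cV[C]_n.+1 := word_vec [::] l.

Lemma model_word w l :
  (\prod_(k <- w) model_point k) *m model_vec l = (tau ^+ size w)%:C%C *: word_vec w l.
Proof.
elim: w => [|k w IH]; first by rewrite big_nil mul1mx scale1r.
rewrite big_cons -mulmxE -mulmxA IH -scalemxAr /model_point -mulmxE -mulmxA.
by rewrite shift_word mul_scalar_mx scalerA -rmorphM -exprSr.
Qed.

(** Evaluation at the shifts reads off the coefficients of [q] up to degree [N], each weighted by a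
    power of [tau]. *)
Lemma model_eval q l a : (ev q *m model_vec l) a 0 =
  ((g a).2 == l)%:R * (tau ^+ size (g a).1)%:C%C * mcoeff (FMonom (g a).1) q.
Proof.
have sD (s t : C) : (s + t)%:M = s%:M + t%:M :> 'M[C]_n.+1 by apply: raddfD.
elim/poly_ind: q => [|p q IHp IHq|w s].
- by rewrite free_eval0 mul0mx mxE mcoeff0 mulr0.
- rewrite free_evalD// mulmxDl [LHS]mxE mcoeffD mulrDr.
  exact: (congr2 +%R IHp IHq).
rewrite free_eval_monomial// -mulmxE -mulmxA model_word mul_scalar_mx coef_monomial.
rewrite !mxE [w == _]eq_sym /=; case: eqP => [<-|_] /=; last by rewrite !mulr0.
by rewrite mulr1n; ring.
Qed.

Lemma model_rows p (Q : 'M[poly]_(p, J')) b a :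
  eval_rows model_point model_vec Q b a =
  (tau ^+ size (g a).1)%:C%C * mcoeff (FMonom (g a).1) (Q b (g a).2).
Proof.
rewrite eval_rowsE (bigD1 (g a).2)//= [X in _ + X]big1 => [|l lg].
  by rewrite model_eval eqxx mul1r addr0.
by rewrite model_eval eq_sym (negPf lg) !mul0r.
Qed.

Hypothesis tau0 : 0 < tau.

Let tauN0 k : (tau ^+ k)%:C%C != 0 :> C.
Proof. by rewrite fmorph_eq0 expf_neq0// gt_eqF. Qed.

Lemma model_rows_eq0 p (Q : 'M[poly]_(p, J')) :
  eval_rows model_point model_vec Q = 0 -> ordge_mx N.+1 Q.
Proof.
move=> Q0 b l w; rewrite ltnS => wN.
have /matrixP/(_ b (ix (Bseq wN, l)))/eqP := Q0.
rewrite model_rows ixK /= mxE mulf_eq0 (negPf (tauN0 _)) /= fmK.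
by move/eqP.
Qed.

(** The entries of [V], divided by powers of [tau], serve as coefficients. This turns vectors of the
    decomposition into polynomials. *)
Lemma model_rows_onto p (V : 'M[C]_(p, n.+1)) :
  exists Q : 'M[poly]_(p, J'), eval_rows model_point model_vec Q = V.
Proof.
exists (\matrix_(b, l) \sum_(u : {bseq N of 'I_d})
  monomial u ((tau ^+ size u)%:C%C^-1 * V b (ix (u, l)))).
apply/matrixP => b a; rewrite model_rows mxE raddf_sum (bigD1 (g a).1)//= big1 => [|u ua].
  rewrite addr0 coef_monomial eqxx mulr1n mulrA mulfV// mul1r.
  by rewrite -surjective_pairing gK.
rewrite coef_monomial [_ == _](_ : _ = false) ?mulr0n//.
by apply/negbTE; apply: contra ua => /eqP ua; apply/eqP/val_inj.
Qed.

End ShiftModel.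

Lemma shift_model (R : realType) (d N J' I J : nat) (delta : 'M[free_poly R d]_(I, J))
    (r : R) : (0 < J')%N -> 0 < r -> ordge_mx 1 delta ->
  exists n (x : 'I_d -> 'M[R[i]]_n.+1) (e : 'I_J' -> 'cV[R[i]]_n.+1),
  [/\ forall v : 'I_J -> 'cV[R[i]]_n.+1,
        \sum_i sqn (\sum_j free_eval (@scalar_mx R[i] n.+1) x (delta i j) *m v j) <=
        r ^+ 2 / 2 * \sum_j sqn (v j),
      forall p (V : 'M[R[i]]_(p, n.+1)),
        exists Q : 'M[free_poly R d]_(p, J'), eval_rows x e Q = V &
      forall p (Q : 'M[free_poly R d]_(p, J')), eval_rows x e Q = 0 -> ordge_mx N.+1 Q].
Proof.
move=> J0 r0 delta1; have [n [ix [g [ixK gK]]]] := index_ordinal d N J0.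
have sD (s t : R[i]) : (s + t)%:M = s%:M + t%:M :> 'M[R[i]]_n.+1 by apply: raddfD.
have sC (a : R[i]) (A : 'M[R[i]]_n.+1) : a%:M * A = A * a%:M.
  by rewrite -!mulmxE scalar_mxC.
have shb k : exists M, entry_sum (shift R g k : 'M[R[i]]_n.+1) M by eexists; apply: lexx.
have lip p := @free_eval_lipschitz R d _ (@scalar_mx R[i] n.+1) (@entry_sum R n.+1)
  sD (@scalar_mxM _ _) (erefl _) sC (@entry_sum_ge0 R n.+1) (@entry_sumD R n.+1)
  (@entry_sumM R n.+1) (fun _ _ _ MN yM => le_trans yM MN) n.+1%:R
  (@entry_sum_scalar R n.+1) (shift R g) p shb.
have [L L0 LP] : exists2 L : R, 0 <= L & forall tau : R, 0 <= tau <= 1 -> forall i j,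
    entry_sum (free_eval (@scalar_mx R[i] n.+1) (model_point g tau) (delta i j)) (L * tau).
  have /choice[f fP] : forall ij : 'I_I * 'I_J, exists L : R, 0 <= L /\
      forall tau : R, 0 <= tau <= 1 ->
      entry_sum (free_eval (@scalar_mx R[i] n.+1) (model_point g tau) (delta ij.1 ij.2)) (L * tau).
    move=> ij; have [L L0 LP] := lip (delta ij.1 ij.2); exists L; split=> // tau /andP[t0 t1].
    have := LP tau%:C%C 0; rewrite nrm0 nrm_real ger0_norm// subr0 nrm_real ger0_norm//.
    rewrite [X in _ - X](_ : _ = 0) ?subr0; last first.
      rewrite free_eval_zero// => [|k]; last by rewrite raddf0 mul0r.
      by rewrite (delta1 ij.1 ij.2)//= raddf0.
    by apply => //; apply: le_trans t1 _; rewrite ler1n.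
  exists (\sum_ij f ij); first by rewrite sumr_ge0// => ij _; case: (fP ij).
  move=> tau t01 i j; have [_ /(_ tau t01)] := fP (i, j).
  move/le_trans; apply; case/andP: t01 => t0 _; rewrite ler_wpM2r//.
  by rewrite (bigD1 (i, j))//= lerDl sumr_ge0// => ij _; case: (fP ij).
pose K : R := (I * n.+1)%:R * (J%:R * L) ^+ 2.
have K0 : 0 <= K by rewrite /K mulr_ge0 ?sqr_ge0.
have K1 : 0 < K + 1 by rewrite ltr_wpDl.
have r2 : 0 < r ^+ 2 / 2 by rewrite divr_gt0 ?exprn_gt0.
(* The squared norm of [delta] at the model point is at most [K tau^2], since [delta] vanishes at 0;
   then [K tau^2 <= (K + 1) tau <= r^2 / 2]. *)
pose tau := Num.min 1 (r ^+ 2 / 2 / (K + 1)).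
have tau0 : 0 < tau by rewrite lt_min ltr01 divr_gt0.
have tau1 : tau <= 1 by rewrite ge_min lexx.
have tauK : K * tau ^+ 2 <= r ^+ 2 / 2.
  apply: (@le_trans _ _ ((K + 1) * tau)).
    rewrite expr2 mulrA ler_pM2r//; apply: le_trans (_ : K <= _); last by rewrite lerDl.
    by rewrite ler_piMr.
  by rewrite mulrC -ler_pdivlMr// ge_min lexx orbT.
exists n, (model_point g tau), (model_vec R g); split.
- move=> v; have := @sqn_family_le R n.+1 I J _ (L * tau) v (LP tau _).
  rewrite ltW ?tau1// => /(_ isT); move/le_trans; apply.
  rewrite ler_wpM2r ?sumr_ge0// => [j _|]; first exact: sqn_ge0.
  apply: le_trans tauK; rewrite le_eqVlt; apply/orP; left; apply/eqP.
  by rewrite /K; ring.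
- by move=> p V; apply: model_rows_onto.
- by move=> p Q; apply: model_rows_eq0.
Qed.

Section Realization.
Variables (R : realType) (d : nat).
Local Notation C := R[i].
Local Notation poly := (free_poly R d).

Lemma eval_rowsD n p q (x : 'I_d -> 'M[C]_n.+1) (e : 'I_q -> 'cV[C]_n.+1)
    (P Q : 'M[poly]_(p, q)) :
  eval_rows x e (P + Q) = eval_rows x e P + eval_rows x e Q.
Proof.
apply: (addIr (- eval_rows x e Q)); apply: etrans (esym (eval_rowsB x e (P + Q) Q)) _.
by rewrite !addrK.
Qed.

Lemma eval_rows_const_mx n p q (x : 'I_d -> 'M[C]_n.+1) (e : 'I_q -> 'cV[C]_n.+1)
    (U : 'M[C]_(p, q)) :
  eval_rows x e (const_poly_mx U) = U *m rowsof e.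
Proof.
apply/matrixP => b a; rewrite eval_rowsE [RHS]mxE; apply: eq_bigr => l _.
rewrite [const_poly_mx U b l]mxE free_eval_monomial; last exact: raddfD.
by rewrite big_nil mulr1 mul_scalar_mx [LHS]mxE [rowsof e l a]mxE.
Qed.

(** [W] is chosen before [s]: it depends on [N] through the model, while [s], the square root of the
    cone error, remains free to be shrunk afterwards. *)
Lemma realization I J I' J' (delta : 'M[poly]_(I, J)) (P : 'M[poly]_(I', J'))
    (r1 r M : R) N : (0 < J')%N -> 0 < r1 < r -> 0 <= M -> ordge_mx 1 delta ->
  (forall y, Gset delta r y -> (mx_opnorm (eval_mx P (projT2 y)) <= M%:E)%E) ->
  exists n (W : 'M[poly]_(n, J')), forall s, 0 < s ->
  exists m (V : 'M[poly]_(J * m, J')) (A : 'M[C]_(I', J' + n)) (B : 'M[C]_(I', I * m))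
    (A' : 'M[C]_(J * m, J' + n)) (B' : 'M[C]_(J * m, I * m)),
  [/\ contraction A, contraction B, contraction A' & contraction B'] /\
  let E := col_mx (const_poly_mx (M%:C%C%:M)) (const_poly_mx (s%:C%C%:M) *m W) in
  let dV := ampliation m delta *m V in
  ordge_mx N.+1 (P - (const_poly_mx A *m E + const_poly_mx (r1^-1%:C%C *: B) *m dV)) /\
  ordge_mx N.+1 (V - (const_poly_mx A' *m E + const_poly_mx (r1^-1%:C%C *: B') *m dV)).
Proof.
move=> J'0 r1r M0 delta1 PM; have /andP[r10 _] := r1r.
have [n [x [e [small onto eq0]]]] := @shift_model R d N J' I J delta r1 J'0 r10 delta1.
(* [W] represents the identity rows with which the cone error enters the transfer function. *)
have [W WE] := onto _ 1%:M.
exists n.+1, W => s s0.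
have s20 : 0 < s ^+ 2 by rewrite exprn_gt0.
have cone := agler_decomposition e r1r M0 s20 PM small.
have [m [v [U [Uc UE]]]] := transfer_function (ltW s20) cone.
(* [V] represents [r1 v], whence the factor [r1^-1] in front of [delta V]. *)
have [V VE] := onto _ (r1%:C%C *: rowsof v).
exists m, V, (row_mx 1%:M 0 *m U *m col_mx 1%:M 0), (row_mx 1%:M 0 *m U *m col_mx 0 1%:M),
  (row_mx 0 1%:M *m U *m col_mx 1%:M 0), (row_mx 0 1%:M *m U *m col_mx 0 1%:M).
have c1 := contraction_row R I' (J * m); have c2 := contraction_row' R I' (J * m).
have c3 := contraction_col R (J' + n.+1) (I * m).
have c4 := contraction_col' R (J' + n.+1) (I * m).
split; first by split; apply: contractionM => //; apply: contractionM.
move=> E dV.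
have EE : eval_rows x e E = col_mx (M%:C%C *: rowsof e) ((Num.sqrt (s ^+ 2))%:C%C *: 1%:M).
  rewrite eval_rows_col eval_rows_const_mx mul_scalar_mx eval_rows_const WE mul_scalar_mx.
  by rewrite sqrtr_sqr gtr0_norm.
have dVE : r1^-1%:C%C *: eval_rows x e dV =
   rowsof (fun b => \sum_j free_eval (@scalar_mx C n.+1) x (delta (mxtens_unindex b).1 j) *m
      v (mxtens_index (j, (mxtens_unindex b).2))).
  rewrite eval_rows_ampliation VE; apply/matrixP => b a.
  rewrite [LHS]mxE [X in _ * X]mxE summxE mulr_sumr [RHS]mxE summxE.
  apply: eq_bigr => j _.
  rewrite (_ : (row _ _)^T = r1%:C%C *: v (mxtens_index (j, (mxtens_unindex b).2))); last first.
    by apply/colP => a'; rewrite [LHS]mxE [LHS]mxE [LHS]mxE [rowsof _ _ _]mxE [RHS]mxE.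
  rewrite -scalemxAr [X in _ * X]mxE mulrA -rmorphM mulVf ?gt_eqF//.
  by rewrite rmorph1 mul1r.
rewrite -EE -dVE in UE.
have Ublock : U = block_mx (row_mx 1%:M 0 *m U *m col_mx 1%:M 0)
  (row_mx 1%:M 0 *m U *m col_mx 0 1%:M) (row_mx 0 1%:M *m U *m col_mx 1%:M 0)
  (row_mx 0 1%:M *m U *m col_mx 0 1%:M).
  rewrite -{1}[U]submxK -[U in RHS]submxK !mul_row_block !mul_row_col.
  by rewrite !mul1mx !mul0mx !addr0 !add0r !mulmx1 !mulmx0 !addr0 !add0r.
have top : eval_rows x e P = rowsof (fun i => \sum_l free_eval (@scalar_mx C n.+1) x (P i l) *m e l).
  by [].
rewrite -top -VE {1}Ublock mul_block_col -!scalemxAr in UE.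
have [UE1 UE2] := eq_col_mx UE.
have rhsE p (Y : 'M[C]_(p, J' + n.+1)) (Z : 'M[C]_(p, I * m)) :
    eval_rows x e (const_poly_mx Y *m E + const_poly_mx (r1^-1%:C%C *: Z) *m dV) =
    Y *m eval_rows x e E + r1^-1%:C%C *: (Z *m eval_rows x e dV).
  by rewrite eval_rowsD !eval_rows_const scalemxAl.
by split; apply: eq0; apply: etrans (eval_rowsB _ _ _ _) _; rewrite rhsE;
   apply/eqP; rewrite subr_eq0; apply/eqP; [exact: UE1|exact: UE2].
Qed.

End Realization.

(** * Evaluation at operators *)

Section EvaluationAtOperators.
Variables (R : realType) (d : nat) (X : completeNormedModType R[i]).
Local Notation C := R[i].
Local Notation poly := (free_poly R d).
Local Notation sb := (@scalar_bop R X).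

Lemma scalar_bopD (a b : C) : sb (a + b) = sb a + sb b.
Proof. exact: scalerDl. Qed.

Lemma scalar_bopE (a : C) (f : bop X X) : sb a * f = a *: f.
Proof. by apply/val_inj. Qed.

Lemma scalar_bopM (a b : C) : sb (a * b) = sb a * sb b.
Proof. by rewrite scalar_bopE /sb scalerA. Qed.

Lemma scalar_bop1 : sb 1 = 1.
Proof. exact: scale1r. Qed.

Lemma scalar_bopC (a : C) (f : bop X X) : sb a * f = f * sb a.
Proof.
apply/val_inj/funext => u; rewrite scalar_bopE -[LHS]/(a *: f u) -[RHS]/(f (a *: u)).
by rewrite linearZ.
Qed.

(** Nonnegativity of [M] is included since over the zero space the inequality does not imply it. *)
Definition bop_le (f : bop X X) (M : R) : Prop :=
  0 <= M /\ forall u, nrm (f u) <= M * nrm u.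

Lemma bop_leD f g M N : bop_le f M -> bop_le g N -> bop_le (f + g) (M + N).
Proof.
move=> [M0 fM] [N0 gN]; split=> [|u]; first exact: addr_ge0.
by rewrite mulrDl bopDE; apply: le_trans (ler_nrmD _ _) _; apply: lerD.
Qed.

Lemma bop_leM f g M N : bop_le f M -> bop_le g N -> bop_le (f * g) (M * N).
Proof.
move=> [M0 fM] [N0 gN]; split=> [|u]; first exact: mulr_ge0.
rewrite -[(f * g) u]/(f (g u)); apply: le_trans (fM _) _.
by rewrite -mulrA ler_wpM2l.
Qed.

Lemma bop_le_le f M N : M <= N -> bop_le f M -> bop_le f N.
Proof.
move=> MN [M0 fM]; split=> [|u]; first exact: le_trans MN.
by apply: le_trans (fM u) _; rewrite ler_wpM2r ?nrm_ge0.
Qed.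

Lemma bop_le_scalar (a : C) : bop_le (sb a) (1 * nrm a).
Proof. by rewrite mul1r; split=> [|u]; rewrite ?nrm_ge0// -nrmZ. Qed.

Variable T : 'I_d -> bop X X.
Local Notation ev a := (free_eval sb (fun k => a *: T k)).

Lemma scaled_point (a : C) : (fun k => a *: T k) = (fun k => sb a * T k).
Proof. by apply/funext => k; rewrite scalar_bopE. Qed.

Lemma eval_lipschitz (p : poly) : exists2 L, 0 <= L &
  forall a b : C, nrm a <= 2 -> nrm b <= 2 -> bop_le (ev a p - ev b p) (L * nrm (a - b)).
Proof.
have Tb k : exists M, bop_le (T k) M.
  by have [M M0 MP] := bop_boundP (T k); exists M.
have [L L0 LP] := @free_eval_lipschitz R d _ sb bop_le scalar_bopD scalar_bopM scalar_bop1
  scalar_bopC (fun _ _ => @proj1 _ _) bop_leD bop_leM bop_le_le 1 bop_le_scalar T p Tb.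
by exists L => // a b a2 b2; rewrite !scaled_point; apply: LP.
Qed.

Lemma eval_bounded (p : poly) : exists2 M, 0 <= M &
  forall a : C, nrm a <= 2 -> bop_le (ev a p) M.
Proof.
have [L L0 LP] := eval_lipschitz p.
have [M M0 MP] := bop_boundP (ev 0 p).
exists (L * 2 + M) => [|a a2]; first by rewrite addr_ge0// mulr_ge0.
have := LP a 0 a2; rewrite nrm0 subr0 => /(_ (ler0n _ _)) La.
rewrite -[ev a p](subrK (ev 0 p)); apply: bop_leD => //.
by apply: bop_le_le La; rewrite ler_wpM2l.
Qed.

Lemma uniform_bound I J (Q : 'I_I -> 'I_J -> R -> Prop) :
  (forall i j, exists2 M, 0 <= M & Q i j M) ->
  exists f : 'I_I -> 'I_J -> R, forall i j, 0 <= f i j /\ Q i j (f i j).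
Proof.
move=> H; have /choice[f fP] : forall ij : 'I_I * 'I_J, exists M, 0 <= M /\ Q ij.1 ij.2 M.
  by move=> ij; have [M M0 MP] := H ij.1 ij.2; exists M.
by exists (fun i j => f (i, j)) => i j; apply: (fP (i, j)).
Qed.

(** [L] precedes [h]: the estimate is entrywise, so it survives the change of tensor norm along the
    segment. *)
Lemma eval_op_lipschitz I J (P : 'M[poly]_(I, J)) : exists2 L, 0 <= L &
  forall h (a b : C), nrm a <= 2 -> nrm b <= 2 ->
  hbound h (eval_op P (fun k => a *: T k) - eval_op P (fun k => b *: T k)) (L * nrm (a - b)).
Proof.
have [f fP] := uniform_bound (fun i j => eval_lipschitz (P i j)).
exists (\sum_i \sum_j f i j) => [|h a b a2 b2].
  by rewrite sumr_ge0// => i _; rewrite sumr_ge0// => j _; case: (fP i j).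
rewrite mulr_suml; under eq_bigr do rewrite mulr_suml.
apply: hbound_entries => i j; first by rewrite mulr_ge0 ?nrm_ge0//; case: (fP i j).
move=> x; have [_ /(_ a b a2 b2)[_ /(_ x)]] := fP i j.
by rewrite !mxE.
Qed.

Lemma eval_op_bounded I J (P : 'M[poly]_(I, J)) : exists2 M, 0 <= M &
  forall (a : C), nrm a <= 2 -> (forall h, hbound h (eval_op P (fun k => a *: T k)) M) /\
  forall i j, bop_le (eval_op P (fun k => a *: T k) i j) M.
Proof.
have [f fP] := uniform_bound (fun i j => eval_bounded (P i j)).
have f0 i j : 0 <= f i j by case: (fP i j).
exists (\sum_i \sum_j f i j) => [|a a2].
  by rewrite sumr_ge0// => i _; rewrite sumr_ge0.
have fa i j : bop_le (eval_op P (fun k => a *: T k) i j) (f i j).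
  by rewrite mxE; case: (fP i j) => _; apply.
split=> [h|i j]; first by apply: hbound_entries => // i j x; case: (fa i j).
apply: bop_le_le (fa i j); rewrite (bigD1 i)//= (bigD1 j)//= -addrA lerDl addr_ge0//.
  by rewrite sumr_ge0.
by rewrite sumr_ge0// => k _; rewrite sumr_ge0.
Qed.

Lemma eval_opM a m n k (P : 'M[poly]_(m, n)) (Q : 'M[poly]_(n, k)) :
  eval_op (P *m Q) (fun k => a *: T k) =
  eval_op P (fun k => a *: T k) *m eval_op Q (fun k => a *: T k).
Proof. exact: (map_free_evalM _ scalar_bopD scalar_bopM scalar_bopC). Qed.

Lemma eval_opD a m n (P Q : 'M[poly]_(m, n)) :
  eval_op (P + Q) (fun k => a *: T k) =
  eval_op P (fun k => a *: T k) + eval_op Q (fun k => a *: T k).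
Proof. exact: (map_free_evalD _ scalar_bopD). Qed.

Lemma eval_opB a m n (P Q : 'M[poly]_(m, n)) :
  eval_op (P - Q) (fun k => a *: T k) =
  eval_op P (fun k => a *: T k) - eval_op Q (fun k => a *: T k).
Proof. exact: (map_free_evalB _ scalar_bopD). Qed.

Lemma eval_op_const a m n (U : 'M[C]_(m, n)) :
  eval_op (const_poly_mx U) (fun k => a *: T k) = map_mx sb U.
Proof. exact: (map_free_eval_const _ scalar_bopD). Qed.

Lemma eval_op_ampliation a k m n (P : 'M[poly]_(m, n)) :
  eval_op (ampliation k P) (fun k => a *: T k) = ampliation k (eval_op P (fun k => a *: T k)).
Proof. exact: (map_free_eval_ampliation _ scalar_bopD). Qed.

(** The [k]-th coefficient collects the words of length [k], so vanishing order in the variables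
    becomes vanishing order in the scalar parameter. *)
Lemma eval_power_sum (p : poly) (u : X) : exists n c,
  (forall N, ordge N.+1 p -> forall k, (k <= N)%N -> c k = 0) /\
  forall a, ev a p u = power_sum n c a.
Proof.
exists (\max_(w <- msupp p) size (fmonom_val w)).+1.
exists (fun k => \sum_(w <- msupp p | size (fmonom_val w) == k)
  mcoeff w p *: (\prod_(l <- fmonom_val w) T l) u).
split=> [N pN k kN|a].
  by rewrite big1// => w /eqP wk; rewrite pN ?scale0r// wk ltnS.
rewrite scaled_point /free_eval bop_sumE /power_sum.
under [RHS]eq_bigr do rewrite scaler_sumr.
rewrite (exchange_big_dep xpredT)//; apply: eq_big_seq => w wp.
have wb : (size (fmonom_val w) < (\max_(w <- msupp p) size (fmonom_val w)).+1)%N.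
  by rewrite ltnS; apply: (@leq_bigmax_seq _ _ xpredT).
rewrite (big_pred1 (Ordinal wb)) => [|k]; last by rewrite /= -val_eqE /= eq_sym.
rewrite (wordZ scalar_bopM scalar_bop1 scalar_bopC) mulrA -scalar_bopM.
by rewrite scalar_bopE bopZE /= mulrC scalerA.
Qed.

End EvaluationAtOperators.

Lemma htn_map_scale (R : realType) (X : completeNormedModType R[i])
    (h : hilbertTensorNorm X) (K1 K2 : hilbertSpace R) a (S : bop X X) (T : bop K1 K2) z :
  htn_map h (a *: S) T z = a *: htn_map h S T z.
Proof.
rewrite -bopZE; move: z; apply: eq_on_dense => w; rewrite bopZE !htn_mapE -linearZ.
congr (compl_emb _ _); have [s ws] := tensor_map_sumE w.
rewrite !ws scaler_sumr; apply: eq_bigr => p _.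
by apply/val_inj/funext => B; apply: linearZl_LR.
Qed.

Lemma hbound_scalarZ (R : realType) (X : completeNormedModType R[i])
    (h : hilbertTensorNorm X) m n (U : 'M[R[i]]_(m, n)) (t : R) : 0 <= t ->
  contraction U -> hbound h (map_mx (@scalar_bop R X) (t%:C%C *: U)) t.
Proof.
move=> t0 Uc K z; have := @hbound_scalar _ _ h _ _ _ Uc K z; rewrite mul1r => Uz.
have -> : htn_matrix (map_mx (@scalar_bop R X) (t%:C%C *: U)) h K z =
    t%:C%C *: htn_matrix (map_mx (@scalar_bop R X) U) h K z.
  rewrite !htn_matrixE scaler_sumr; apply: eq_bigr => i _; rewrite scaler_sumr.
  apply: eq_bigr => j _; rewrite -htn_map_scale !mxE /scalar_bop scalerA.
  by [].
by rewrite nrmZ nrm_real ger0_norm// ler_wpM2l.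
Qed.

Lemma sub_add_sub (V : zmodType) (z x s s' : V) :
  z - (x + s') = z - (x + s) + (s - s').
Proof. by rewrite !opprD !addrA subrK. Qed.

(** * Solving the realization by iteration *)

Section Iteration.
Variables (R : realType) (d I J J' m q : nat).
Local Notation C := R[i].
Local Notation poly := (free_poly R d).
Variables (delta : 'M[poly]_(I, J)) (E : 'M[poly]_(q, J')).
Variables (A' : 'M[C]_(J * m, q)) (B' : 'M[C]_(J * m, I * m)) (rho : R).

Fixpoint iterate k : 'M[poly]_(J * m, J') :=
  if k is k'.+1 then
    const_poly_mx A' *m E + const_poly_mx (rho%:C%C *: B') *m (ampliation m delta *m iterate k')
  else 0.

Hypothesis delta1 : ordge_mx 1 delta.

Lemma ordge_mx_le k l a b (Q : 'M[poly]_(a, b)) : (l <= k)%N -> ordge_mx k Q -> ordge_mx l Q.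
Proof. by move=> lk Qk i j; apply: ordge_le (Qk i j). Qed.

Lemma ordge_mx_step k a p (U : 'M[C]_(a, I * m)) (Q : 'M[poly]_(J * m, p)) :
  ordge_mx k Q -> ordge_mx k.+1 (const_poly_mx U *m (ampliation m delta *m Q)).
Proof.
move=> Qk; apply: (@ordge_mxM _ _ 0 (1 + k)); first by move=> i j; apply: ordge0.
by apply: ordge_mxM => //; apply: ordge_ampliation.
Qed.

Lemma sub_step a p (U : 'M[C]_(a, I * m)) (Z X : 'M[poly]_(a, p)) (Q Q' : 'M[poly]_(J * m, p)) :
  Z - (X + const_poly_mx U *m (ampliation m delta *m Q')) =
  Z - (X + const_poly_mx U *m (ampliation m delta *m Q)) +
  const_poly_mx U *m (ampliation m delta *m (Q - Q')).
Proof.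
rewrite [X in _ = _ + _ *m X]mulmxBr [X in _ = _ + X]mulmxBr.
exact: sub_add_sub.
Qed.

(** Each step multiplies the error by [delta], which has no constant term, and so gains one
    degree. *)
Lemma iterate_order N (V : 'M[poly]_(J * m, J')) :
  ordge_mx N (V - (const_poly_mx A' *m E +
    const_poly_mx (rho%:C%C *: B') *m (ampliation m delta *m V))) ->
  forall k, (k <= N)%N -> ordge_mx k (V - iterate k).
Proof.
move=> VN; elim=> [|k IH] kN; first by move=> i j; apply: ordge0.
rewrite [iterate _]/= (sub_step _ _ _ V); apply: ordge_mxD; first exact: ordge_mx_le VN.
by apply: ordge_mx_step; apply: IH; apply: ltnW.
Qed.

Lemma transfer_order N I' (P : 'M[poly]_(I', J')) (A : 'M[C]_(I', q)) (B : 'M[C]_(I', I * m))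
    (V : 'M[poly]_(J * m, J')) :
  ordge_mx N (P - (const_poly_mx A *m E +
    const_poly_mx (rho%:C%C *: B) *m (ampliation m delta *m V))) ->
  ordge_mx N (V - (const_poly_mx A' *m E +
    const_poly_mx (rho%:C%C *: B') *m (ampliation m delta *m V))) ->
  ordge_mx N (P - (const_poly_mx A *m E +
    const_poly_mx (rho%:C%C *: B) *m (ampliation m delta *m iterate N))).
Proof.
move=> PN VN; rewrite (sub_step _ _ _ V); apply: ordge_mxD => //.
by apply: (ordge_mx_le (leqnSn N)); apply: ordge_mx_step; apply: iterate_order.
Qed.

Variables (X : completeNormedModType C) (T : 'I_d -> bop X X) (h : hilbertTensorNorm X).
Variables (a : C) (s c : R).
Hypotheses (rho0 : 0 <= rho) (s0 : 0 <= s) (c0 : 0 <= c) (rs1 : rho * s < 1).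
Hypothesis delta_s : hbound h (eval_op delta (fun k => a *: T k)) s.
Hypothesis E_c : hbound h (eval_op E (fun k => a *: T k)) c.

(** [c / (1 - rho * s)] is the fixed point of [t = c + rho * s * t]. The same step bounds the
    iterates and the output. *)
Lemma hbound_step p (A : 'M[C]_(p, q)) (B : 'M[C]_(p, I * m)) (V : 'M[poly]_(J * m, J')) :
  contraction A -> contraction B ->
  hbound h (eval_op V (fun k => a *: T k)) (c / (1 - rho * s)) ->
  hbound h (eval_op (const_poly_mx A *m E + const_poly_mx (rho%:C%C *: B) *m
    (ampliation m delta *m V)) (fun k => a *: T k)) (c / (1 - rho * s)).
Proof.
move=> Ac Bc Vc; rewrite eval_opD 3!eval_opM 2!eval_op_const eval_op_ampliation.
have -> : c / (1 - rho * s) = 1 * c + rho * (s * (c / (1 - rho * s))).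
  by field; rewrite subr_eq0 eq_sym lt_eqF.
apply: hboundD.
  by apply: hboundM => //; apply: hbound_scalar.
apply: hboundM => //; first exact: hbound_scalarZ.
by apply: hboundM => //; apply: hbound_ampliation.
Qed.

Lemma hbound_iterate k : contraction A' -> contraction B' ->
  hbound h (eval_op (iterate k) (fun k => a *: T k)) (c / (1 - rho * s)).
Proof.
move=> Ac Bc; elim: k => [|k IH]; last exact: hbound_step.
apply: (@hbound_le _ _ _ _ _ _ 0); first by rewrite divr_ge0// subr_ge0 ltW.
have -> : (0 : R) = \sum_(i < J * m) \sum_(j < J') 0 by rewrite big1// => i _; rewrite big1.
apply: hbound_entries => // i j x.
by rewrite !mxE free_eval0 mul0r nrm0.
Qed.

End Iteration.

(** * From the realization to the functional calculus *)

Lemma norm_bullet_lt (R : realType) (X : completeNormedModType R[i]) m n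
    (A : 'M[bop X X]_(m, n)) (s : R) : 0 <= s -> (norm_bullet A < s%:E)%E ->
  exists h : hilbertTensorNorm X, hbound h A s.
Proof.
move=> s0 /ereal_inf_lt[_ [h ->] hs]; exists h.
by apply/norm_h_le => //; apply: ltW.
Qed.

Lemma norm_bullet_le (R : realType) (X : completeNormedModType R[i]) m n
    (A : 'M[bop X X]_(m, n)) (h : hilbertTensorNorm X) (c : R) : 0 <= c ->
  hbound h A c -> (norm_bullet A <= c%:E)%E.
Proof.
move=> c0 Ac; apply: (@le_trans _ _ (norm_h A h)); last by apply/norm_h_le.
by apply: ereal_inf_lbound; exists h.
Qed.

Lemma lt1_ereal_real (R : realType) (x : \bar R) : (x < 1)%E ->
  exists s : R, 0 < s < 1 /\ (x < s%:E)%E.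
Proof.
case: x => [x||] //; last by exists 2^-1; rewrite ltNyr invr_gt0 ltr0n invf_lt1// ltr1n.
rewrite lte_fin => x1; exists ((Num.max x 0 + 1) / 2).
have m1 : Num.max x 0 < 1 by rewrite gt_max x1 ltr01.
have m0 : 0 <= Num.max x 0 by rewrite le_max lexx orbT.
have xm : x <= Num.max x 0 by rewrite le_max lexx.
by split; [apply/andP; split; lra|rewrite lte_fin; lra].
Qed.

Lemma ordge1_of_zero (R : realType) d I J (delta : 'M[free_poly R d]_(I, J)) :
  eval_mx delta (fun _ : 'I_d => (0 : 'M[R[i]]_1)) = 0 -> ordge_mx 1 delta.
Proof.
move=> /matrixP d0 i j; apply: ordge1P.
have := d0 (mxtens_index (ord0, i)) (mxtens_index (ord0, j)).
rewrite eval_mx_entry free_eval_zero//; last by move=> a b; apply: raddfD.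
by rewrite !mxE mulr1n.
Qed.

(** [N] is fixed before [Q]; this is essential because the polynomial it is applied to is built from
    [N]. *)
Lemma small_entries (R : realType) d (X : completeNormedModType R[i]) (T : 'I_d -> bop X X)
    I J (eta e B : R) : 0 < eta -> 0 < e -> 0 < B ->
  exists N, forall Q : 'M[free_poly R d]_(I, J), ordge_mx N.+1 Q ->
  (forall (t : R) a, 0 <= t <= 1 -> nrm (a - t%:C%C) <= 16 * eta -> forall i j u,
    nrm (eval_op Q (fun k => a *: T k) i j u) <= B * nrm u) ->
  forall i j u, nrm (eval_op Q (fun k => 1 *: T k) i j u) <= e * nrm u.
Proof.
move=> eta0 e0 B0; have [N NP] := @chain_of_discs R X eta e B eta0 e0 B0.
exists N => Q QN QB i j.
apply/(bopnorm_le (eval_op Q (fun k => 1 *: T k) i j) (ltW e0)).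
apply: ge_ereal_sup => _ [u u1 <-]; rewrite lee_fin.
have [n [c [c0 cE]]] := eval_power_sum T (Q i j) u.
rewrite [eval_op _ _ _ _]mxE cE; apply: NP => [k kN|t z t01 zt].
  by apply: (c0 N).
rewrite -cE; have := QB t z t01 zt i j u; rewrite [eval_op _ _ _ _]mxE.
by move/le_trans; apply; rewrite ler_piMr// ltW.
Qed.

Lemma col_mx_split (R : realType) d p q n (P : 'M[free_poly R d]_(p, n))
    (Q : 'M[free_poly R d]_(q, n)) :
  col_mx P Q = const_poly_mx (col_mx 1%:M 0) *m P + const_poly_mx (col_mx 0 1%:M) *m Q.
Proof.
have c1 k : const_poly_mx (1%:M : 'M_k) = 1%:M :> 'M[free_poly R d]_k.
  apply/matrixP => i j; rewrite !mxE; case: eqP => _; rewrite ?mulr1n ?mulr0n.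
    by rewrite /monomial -fmoneE; exact: mpolyC1E.
  exact: monalgU0.
have c0 k l : const_poly_mx (0 : 'M_(k, l)) = 0 :> 'M[free_poly R d]_(k, l).
  by apply/matrixP => i j; rewrite !mxE; exact: monalgU0.
have cc k l1 l2 (U : 'M_(l1, k)) (V : 'M_(l2, k)) :
    const_poly_mx (col_mx U V) = col_mx (const_poly_mx U) (const_poly_mx V)
      :> 'M[free_poly R d]_(l1 + l2, k).
  exact: map_col_mx.
by rewrite !cc !c1 !c0 !mul_col_mx !mul1mx !mul0mx add_col_mx addr0 add0r.
Qed.

Theorem theorem5p9 (R : realType) (X : completeNormedModType R[i]) (d I J : nat)
    (delta : 'M[free_poly R d]_(I, J)) (T : 'I_d -> bop X X)
    (delta0 : forall n : nat,
      eval_mx delta (fun _ : 'I_d => (0 : 'M[R[i]]_n.+1)) = 0)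
    (deltaT : (ereal_sup
       [set norm_bullet (eval_op delta (fun k => (r%:C)%C *: T k))
         | r in [set r : R | (0 <= r <= 1)%R]] < 1)%E) :
  cb_functional_calculus delta T.
Proof.
have delta1 := ordge1_of_zero (delta0 0%N).
have [s [/andP[s0 s1] sT]] := lt1_ereal_real deltaT.
have hs (t : R) : 0 <= t <= 1 ->
    exists h : hilbertTensorNorm X, hbound h (eval_op delta (fun k => t%:C%C *: T k)) s.
  move=> t01; apply: norm_bullet_lt; first exact: ltW.
  by apply: le_lt_trans sT; apply: ereal_sup_ubound; exists t.
have [L L0 LP] := eval_op_lipschitz T delta.
(* The first bound keeps the discs of radius [16 * eta] inside [|a| <= 2]; the second lets
   [delta(a T)] grow only from [s] to the midpoint [s2] of [s] and 1. *)
pose eta := Num.min 16^-1 ((1 - s) / 2 / (16 * (L + 1))).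
have L1 : 0 < 16 * (L + 1) by rewrite mulr_gt0// ltr_wpDl.
have eta0 : 0 < eta by rewrite lt_min invr_gt0 ltr0n !divr_gt0// subr_gt0.
have eta1 : 16 * eta <= 1 by rewrite -ler_pdivlMl// mulr1 ge_min lexx.
pose s2 := (1 + s) / 2.
have s20 : 0 <= s2 by rewrite /s2; lra.
have etaL : s + L * (16 * eta) <= s2.
  have : eta * (16 * (L + 1)) <= (1 - s) / 2 by rewrite -ler_pdivlMr// ge_min lexx orbT.
  by rewrite /s2; have := ltW eta0; nra.
have hs2 (t : R) : 0 <= t <= 1 -> exists h : hilbertTensorNorm X, forall a,
    nrm (a - t%:C%C) <= 16 * eta -> nrm a <= 2 /\ hbound h (eval_op delta (fun k => a *: T k)) s2.
  move=> t01; have [h ht] := hs t t01; exists h => a at16; have /andP[t0 t1] := t01.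
  have nt : nrm (t%:C%C : R[i]) <= 1 by rewrite nrm_real ger0_norm.
  have a2 : nrm a <= 2.
    rewrite -[a](subrK t%:C%C); apply: le_trans (ler_nrmD _ _) _; lra.
  split=> //; apply: hbound_le etaL _.
  rewrite -[eval_op delta _](subrK (eval_op delta (fun k => t%:C%C *: T k))) addrC.
  apply: hboundD => //; apply: hbound_le (LP h a t%:C%C a2 _); last by lra.
  by rewrite ler_wpM2l.
pose r1 := (1 + s2) / 2; pose r := (1 + r1) / 2.
have s2r1 : s2 < r1 by rewrite /r1 /s2; lra.
have r10 : 0 < r1 by apply: le_lt_trans s2r1.
have r1r : r1 < r by rewrite /r /r1 /s2; lra.
have r_lt1 : r < 1 by rewrite /r /r1 /s2; lra.
pose rho := r1^-1; have rho0 : 0 <= rho by rewrite invr_ge0 ltW.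
have rs1 : rho * s2 < 1 by rewrite mulrC ltr_pdivrMr// mul1r.
pose K := (1 - rho * s2)^-1.
have K0 : 0 < K by rewrite invr_gt0 subr_gt0.
exists r; split; first by rewrite r_lt1 (lt_trans r10).
exists K; split=> // I' J' P.
have [h1 h1P] : exists h : hilbertTensorNorm X, forall a,
    nrm (a - 1) <= 16 * eta -> nrm a <= 2 /\ hbound h (eval_op delta (fun k => a *: T k)) s2.
  by apply: (hs2 1); rewrite ler01 lexx.
set S := ereal_sup _.
(* The zero tuple lies in the set, since [delta] vanishes there; this excludes a supremum equal to
   [-oo]. *)
have S0 : (0 <= S)%E.
  apply: (@le_trans _ _ (mx_opnorm (eval_mx P (fun _ : 'I_d => (0 : 'M[R[i]]_1))))).
    apply: ereal_sup_ubound; exists 0; last first.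
      by rewrite mulmx0 /l2norm big1 ?sqrtr0// => i _; rewrite mxE nrm0 expr0n.
    by rewrite /= /l2norm big1 ?sqrtr0// => i _; rewrite mxE nrm0 expr0n.
  apply: ereal_sup_ubound; exists (existT _ 0%N (fun _ : 'I_d => (0 : 'M[R[i]]_1))) => //.
  rewrite /Gset /= delta0; apply: (@le_lt_trans _ _ 0%:E); last by rewrite lte_fin (lt_trans r10).
  by apply/mx_opnorm_le => // v; rewrite mul0mx sqn0 expr0n mul0r.
have PS y : Gset delta r y -> (mx_opnorm (eval_mx P (projT2 y)) <= S)%E.
  by move=> Gy; apply: ereal_sup_ubound; exists y.
move: S S0 PS => [M||] // M0 PM; last by rewrite gt0_muley ?lte_fin// leey.
rewrite lee_fin in M0; rewrite -EFinM; apply/lee_addgt0Pr => e e0.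
rewrite -EFinD; apply: (norm_bullet_le (h := h1)).
  by rewrite addr_ge0 ?mulr_ge0// ltW.
have T1 : T = (fun k => 1 *: T k) by apply/funext => k; rewrite scale1r.
rewrite T1; case: (posnP J') => [J'0|J'0].
  move=> k z; rewrite htn_matrixE big1 => [|i _].
    by rewrite nrm0 mulr_ge0 ?nrm_ge0// addr_ge0 ?mulr_ge0// ltW.
  by rewrite big1// => -[j jJ']; suff: (j < 0)%N by []; rewrite -J'0.
have [CP CP0 PB] := eval_op_bounded T P.
(* This will bound [P - F] near the segment; it does not involve [N], as [e1 <= 1] replaces the
   error by 1. *)
have B0 : 0 < CP + K * (M + 1) by rewrite ltr_wpDl// mulr_gt0// ltr_wpDl.
pose e1 := Num.min 1 (e / (2 * K)).
have e10 : 0 < e1 by rewrite lt_min ltr01 divr_gt0// mulr_gt0.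
have e11 : e1 <= 1 by rewrite ge_min lexx.
have e1K : K * e1 <= e / 2.
  have : e1 * (2 * K) <= e by rewrite -ler_pdivlMr ?mulr_gt0// ge_min lexx orbT.
  lra.
(* Half of [e] pays for the cone error through [K * e1], the other half for the entries of
   [(P - F)(T)]; the successor avoids division by 0. *)
pose e2 := e / 2 / (I' * J').+1%:R.
have e20 : 0 < e2 by rewrite !divr_gt0.
have [N NP] := @small_entries R d X T I' J' eta e2 _ eta0 e20 B0.
have r1r' : 0 < r1 < r by rewrite r10.
have [n [W WP]] := realization N J'0 r1r' M0 delta1 PM.
have [CW CW0 WB] := eval_op_bounded T W.
(* [CW] depends on [N] without control, but [sg] is chosen after it, so [sg * CW <= e1]. *)
pose sg := e1 / (CW + 1).
have CW1 : 0 < CW + 1 by rewrite ltr_wpDl.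
have sg0 : 0 < sg by rewrite divr_gt0.
have sgCW : sg * CW <= e1.
  by rewrite /sg mulrAC ler_pdivrMr// ler_pM2l// lerDl.
have [m [V [A [B [A' [B' [[Ac Bc A'c B'c] [PN VN]]]]]]]] := WP sg sg0.
set E := col_mx _ _ in PN VN.
pose F := const_poly_mx A *m E + const_poly_mx (rho%:C%C *: B) *m
  (ampliation m delta *m iterate delta E A' B' rho N.+1).
have QN : ordge_mx N.+1 (P - F) by apply: transfer_order PN VN.
have EB (h : hilbertTensorNorm X) a : nrm a <= 2 ->
    hbound h (eval_op E (fun k => a *: T k)) (M + e1).
  move=> a2; have [/(_ h) Wa _] := WB a a2.
  have -> : E = const_poly_mx (col_mx 1%:M 0) *m const_poly_mx (M%:C%C%:M) +
     const_poly_mx (col_mx 0 1%:M) *m (const_poly_mx (sg%:C%C%:M) *m W).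
    exact: col_mx_split.
  rewrite eval_opD 3!eval_opM 4!eval_op_const.
  apply: (@hbound_le _ _ _ _ _ _ (1 * M + 1 * (sg * CW))); first by rewrite !mul1r lerD2l.
  have scal p t : 0 <= t -> hbound h (map_mx (@scalar_bop R X) (t%:C%C%:M : 'M_p)) t.
    move=> t0; rewrite -scalemx1; apply: hbound_scalarZ => //.
    by exists 0%N, 0; rewrite tr_1C mul1mx mulmx0 addr0.
  apply: hboundD; apply: hboundM => //.
  - by apply: hbound_scalar; apply: contraction_col.
  - exact: scal.
  - by apply: hbound_scalar; apply: contraction_col'.
  - by apply: hboundM => //; [exact: ltW|apply: scal; exact: ltW].
have FB (h : hilbertTensorNorm X) a : nrm a <= 2 ->
    hbound h (eval_op delta (fun k => a *: T k)) s2 ->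
    hbound h (eval_op F (fun k => a *: T k)) (K * (M + e1)).
  move=> a2 da; have Me : 0 <= M + e1 by rewrite addr_ge0// ltW.
  rewrite mulrC; apply: hbound_step => //; first exact: EB.
  by apply: hbound_iterate => //; exact: EB.
(* At each [t] the bound of [F] comes from the tensor norm of that [t]; passing to entries removes
   the dependence on it. *)
have Qsmall : forall i j u, nrm (eval_op (P - F) (fun k => 1 *: T k) i j u) <= e2 * nrm u.
  apply: NP => // t a t01 at16 i j u; have [h hP] := hs2 t t01.
  have [a2 da] := hP a at16; have [_ /(_ i j)[_ /(_ u) Pa]] := PB a a2.
  have Fa := hbound_entry (FB h a a2 da) i j u.
  rewrite eval_opB !mxE; apply: le_trans (ler_nrmD _ _) _; rewrite nrmN mulrDl.
  rewrite !mxE in Pa Fa; apply: lerD => //; apply: le_trans Fa _.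
  by rewrite ler_wpM2r ?nrm_ge0// ler_pM2l// lerD2l.
have n1 : nrm (1 - 1 : R[i]) <= 16 * eta by rewrite subrr nrm0 mulr_ge0// ltW.
have [n2 d2] := h1P 1 n1.
(* [P(T)] is [F(T)], bounded in the norm [h1], plus a matrix with entries at most [e2], which is
   small in every tensor norm. *)
rewrite -[eval_op P _](subrK (eval_op F (fun k => 1 *: T k))) -eval_opB addrC.
apply: (@hbound_le _ _ _ _ _ _ (K * (M + e1) + \sum_(i < I') \sum_(j < J') e2)).
  rewrite !sumr_const !card_ord -mulrnA mulrDr -addrA lerD2l [leRHS]splitr lerD//.
  have <- : e2 * (I' * J').+1%:R = e / 2 by rewrite divfK// pnatr_eq0.
  by rewrite mulr_natr ler_wpMn2l ?(ltW e20)// mulnC leqnSn.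
apply: hboundD; first exact: FB.
by apply: hbound_entries => // i j; exact: ltW.
Qed.
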